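(* Let $d\ge2$, $a>0$, $m_1\in\mathbb{R}\setminus\{0\}$, $m_2\in\mathbb{R}$. On the region $\mathcal{R}_{sph}\subset T\mathbb{S}^d$ let $E_{sph,a}=E_{sKep}+\langle V_{sph,2}\rangle$ be the Hamiltonian of the partially-averaged spherical two-center problem, obtained by averaging $V_{sph,2}$ along the closed orbits of the spherical Kepler problem $E_{sKep}$, and let $D$ be the function on $T(\mathbb{S}^d\setminus\{\pm Z_1\})$ defined in the context. Then $D$ is a first integral of the partially-averaged system: $$\{E_{sph,a},D\}=0\quad\text{on }\mathcal{R}_{sph}.$$
   Context: Setting: $\mathbb{S}^d=\{Q\in\mathbb{R}^{d+1}:\|Q\|=1\}$ with the round metric; points of $T\mathbb{S}^d$ are $(Q,Q')$, $Q'$ being the velocity, $Q\cdot Q'=0$. The Poisson bracket on $T\mathbb{S}^d$ is the canonical bracket of $T^*\mathbb{S}^d$ transported by the Legendre transformation of the kinetic energy $\frac12\|Q'\|^2$. Centers: $Z_1=\frac{1}{\sqrt{1+a^2}}(0,\dots,0,a,-1)$ and $Z_2=\frac{1}{\sqrt{1+a^2}}(0,\dots,0,-a,-1)$; each Kepler center comes with its antipodal point, which is also a singularity. Let $\theta_i\in(0,\pi)$ be the central angle between $Q$ and $Z_i$. Energies: $E_{sKep}=\frac12\|Q'\|^2-m_1\sqrt{1+a^2}\,\cot\theta_1$, $V_{sph,2}=-m_2\sqrt{1+a^2}\,\cot\theta_2$, $E_{sph}=E_{sKep}+V_{sph,2}$. All non-singular orbits of $E_{sKep}$ (those not colliding with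 $\pm Z_1$) are closed. Region: $\mathcal{R}_{sph}$ is the set of points of $T\mathbb{S}^d$ whose orbit under $E_{sKep}$ is non-singular (does not collide with $\pm Z_1$) and whose projection to $\mathbb{S}^d$ does not pass through the other Kepler centers $\pm Z_2$. Average: $\langle V_{sph,2}\rangle(z)=\int_{S^1}V_{sph,2}\,ds=\frac1T\int_0^TV_{sph,2}(\varphi_t(z))\,dt$, with $\varphi_t$ the flow of $E_{sKep}$ and $T=T(z)$ the period of the orbit of $z$. The function $D$: on the lower hemisphere $\{Q_{d+1}<0\}$ use the central projection chart $x_i=-Q_i/Q_{d+1}$ ($1\le i\le d$) with rescaled velocities $\dot x_i=Q_iQ'_{d+1}-Q_{d+1}Q'_i$ (the velocities with respect to the time of the projectively corresponding Euclidean system), in which $\|Q'\|^2=\sum_i\dot x_i^2+\sum_{i<j\le d}(x_i\dot x_j-x_j\dot x_i)^2$. Put $\xi=(x_1,\dots,x_{d-1})$, $\eta=(x_d-a)/\sqrt{1+a^2}$, $q=(\xi,\eta)$, $v=(\dot\xi,\dot\eta)$ with $\dot\eta=\dot x_d/\sqrt{1+a^2}$. Then $D=C^2+\frac{2a}{\sqrt{1+a^2}}A_\eta$, where $C^2=\|q\|^2\|v\|^2-(q\cdot v)^2$ and $A_\eta$ is the $\eta$-component of $\|v\|^2q-(q\cdot v)v-m_1q/\|q\|$ (Euclidean norms). This extends analytically to the whole sphere outside $\pm Z_1$: with $L_{ij}=Q_iQ'_j-Q_jQ'_i$, $$D=\sum_{1\le i<j\le d-1}L_{ij}^2+\frac{1}{1+a^2}\sum_{i=1}^{d-1}(L_{id}+aL_{i,d+1})^2-\frac{2a}{1+a^2}\sum_{i=1}^{d-1}(L_{id}+aL_{i,d+1})L_{i,d+1}-\frac{2am_1}{\sqrt{1+a^2}}\,\frac{Q_d+aQ_{d+1}}{\sqrt{(1+a^2)\sum_{i=1}^{d-1}Q_i^2+(Q_d+aQ_{d+1})^2}}.$$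 *)

(* Defs.v *)
From mathcomp Require Import all_boot all_order all_algebra.
From mathcomp Require Import all_classical all_reals all_analysis.
From mathcomp Require Import ring lra.

Set Implicit Arguments.
Unset Strict Implicit.
Unset Printing Implicit Defensive.

Import Order.TTheory GRing.Theory Num.Theory.
Import numFieldNormedType.Exports.

Local Open Scope classical_set_scope.
Local Open Scope ring_scope.

(* The library norm on row vectors is the sup norm; the Euclidean structure
   of R^n is given by [dotv]. *)
Definition dotv {R : realType} {n : nat} (u v : 'rV[R]_n) : R :=
  \sum_i u ord0 i * v ord0 i.

(* [co Q k] is the coordinate Q_k in the usual numbering 1 <= k <= d+1. *)
Definition co {R : realType} {d : nat} (Q : 'rV[R]_d.+1) (k : nat) : R :=
  Q ord0 (inord k.-1).

(* Pairs (Q, Q') in R^(d+1) x R^(d+1). *)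
Notation phase R d := ('rV[R]_d.+1 * 'rV[R]_d.+1)%type.

(** * Symplectic geometry of T S^d *)

Definition TS {R : realType} {d : nat} : set (phase R d) :=
  [set z | dotv z.1 z.1 = 1 /\ dotv z.1 z.2 = 0].

Definition TTS {R : realType} {d : nat} (z : phase R d) : set (phase R d) :=
  [set X | dotv z.1 X.1 = 0 /\ dotv z.2 X.1 + dotv z.1 X.2 = 0].

(* The Legendre transformation of |Q'|^2/2 sends (Q, Q') to the covector
   u |-> Q'.u on T_Q S^d, so it pulls the Liouville form of T*S^d back to
   (u, w) |-> Q'.u, the restriction to T S^d of sum_i Q'_i dQ_i. Hence the
   canonical symplectic form sum dq /\ dp becomes the restriction of
   sum_i dQ_i /\ dQ'_i to the tangent spaces TTS. *)
Definition omegaS {R : realType} {d : nat} (X Y : phase R d) : R :=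
  dotv X.1 Y.2 - dotv X.2 Y.1.

(* A smooth retraction of {Q != 0} onto T S^d. A function F on T S^d is
   differentiable at z in the sense of manifolds iff F \o retrTS is
   differentiable at z, and then d_z F is the restriction of
   'd (F \o retrTS) z to TTS z. Only the values of F on T S^d matter. *)
Definition retrTS {R : realType} {d : nat} (z : phase R d) : phase R d :=
  let e := (Num.sqrt (dotv z.1 z.1))^-1 *: z.1 in
  (e, z.2 - dotv e z.2 *: e).

Definition differentiableTS {R : realType} {d : nat}
    (F : phase R d -> R) (z : phase R d) : Prop :=
  differentiable (F \o retrTS : phase R d -> R^o) z.

Definition dTS {R : realType} {d : nat} (F : phase R d -> R) (z : phase R d) :
    phase R d -> R :=
  'd (F \o retrTS : phase R d -> R^o) z.

(* omegaS is nondegenerate on TTS z, so that there is exactly one such X. *)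
Definition is_hamiltonian_vector {R : realType} {d : nat}
    (F : phase R d -> R) (z X : phase R d) : Prop :=
  TTS z X /\ forall Y, TTS z Y -> omegaS X Y = dTS F z Y.

Definition hamiltonian_field {R : realType} {d : nat}
    (F : phase R d -> R) (z : phase R d) : phase R d :=
  get [set X | is_hamiltonian_vector F z X].

(* {F, G} = dF(X_G) = omega(X_F, X_G), normalised by {q, p} = 1. *)
Definition poisson {R : realType} {d : nat}
    (F G : phase R d -> R) (z : phase R d) : R :=
  dTS F z (hamiltonian_field G z).

(** * The spherical Kepler problem *)

Definition Z1 {R : realType} (d : nat) (a : R) : 'rV[R]_d.+1 :=
  (Num.sqrt (1 + a ^+ 2))^-1 *:
  \row_(i < d.+1) (if i == d.-1 :> nat then a else if i == d :> nat then -1 else 0).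

Definition Z2 {R : realType} (d : nat) (a : R) : 'rV[R]_d.+1 :=
  (Num.sqrt (1 + a ^+ 2))^-1 *:
  \row_(i < d.+1) (if i == d.-1 :> nat then - a else if i == d :> nat then -1 else 0).

Definition cot {R : realType} (x : R) : R := cos x / sin x.

(* The angle between two points of the sphere. *)
Definition central_angle {R : realType} {d : nat} (Q Z : 'rV[R]_d.+1) : R :=
  acos (dotv Q Z).

Definition E_sKep {R : realType} {d : nat} (a m1 : R) (z : phase R d) : R :=
  2^-1 * dotv z.2 z.2
  - m1 * Num.sqrt (1 + a ^+ 2) * cot (central_angle z.1 (Z1 d a)).

Definition V_sph2 {R : realType} {d : nat} (a m2 : R) (z : phase R d) : R :=
  - m2 * Num.sqrt (1 + a ^+ 2) * cot (central_angle z.1 (Z2 d a)).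

(* [g] is the non-singular orbit of z: a solution of Hamilton's equations
   defined for all times, hence one that never runs into +-Z1. A solution
   colliding with +-Z1 exists only up to the time of the collision. *)
Definition nonsingular_orbit {R : realType} {d : nat} (a m1 : R)
    (z : phase R d) (g : R -> phase R d) : Prop :=
  g 0 = z /\
  forall t : R, [/\ TS (g t), (g t).1 <> Z1 d a, (g t).1 <> - Z1 d a &
    is_derive t (1 : R) g (hamiltonian_field (E_sKep a m1) (g t))].

Definition region_sph {R : realType} {d : nat} (a m1 : R) : set (phase R d) :=
  [set z | exists2 g, nonsingular_orbit a m1 z g &
    forall t, (g t).1 <> Z2 d a /\ (g t).1 <> - Z2 d a].

Definition flow_sKep {R : realType} {d : nat} (a m1 : R) (t : R)
    (z : phase R d) : phase R d :=
  get [set g | nonsingular_orbit a m1 z g] t.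

(* The minimal period. *)
Definition period_sKep {R : realType} {d : nat} (a m1 : R) (z : phase R d) : R :=
  inf [set T | 0 < T /\ flow_sKep a m1 T z = z].

Definition avg_V_sph2 {R : realType} {d : nat} (a m1 m2 : R) (z : phase R d) : R :=
  (period_sKep a m1 z)^-1 *
  \int[lebesgue_measure]_(t in `[0, period_sKep a m1 z])
    V_sph2 a m2 (flow_sKep a m1 t z).

Definition E_sph_avg {R : realType} {d : nat} (a m1 m2 : R) (z : phase R d) : R :=
  E_sKep a m1 z + avg_V_sph2 a m1 m2 z.

(** * The function D *)

Definition Lang {R : realType} {d : nat} (z : phase R d) (i j : nat) : R :=
  co z.1 i * co z.2 j - co z.1 j * co z.2 i.

Definition D_fun {R : realType} {d : nat} (a m1 : R) (z : phase R d) : R :=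
  let L := Lang z in
  let Q := co z.1 in
  \sum_(1 <= i < d) \sum_(i.+1 <= j < d) L i j ^+ 2
  + (1 + a ^+ 2)^-1 * \sum_(1 <= i < d) (L i d + a * L i d.+1) ^+ 2
  - 2 * a / (1 + a ^+ 2)
      * \sum_(1 <= i < d) (L i d + a * L i d.+1) * L i d.+1
  - 2 * a * m1 / Num.sqrt (1 + a ^+ 2)
      * ((Q d + a * Q d.+1)
         / Num.sqrt ((1 + a ^+ 2) * (\sum_(1 <= i < d) Q i ^+ 2)
                     + (Q d + a * Q d.+1) ^+ 2)).

(* The expression C^2 + 2a/sqrt(1+a^2) A_eta of D in the central projection
   chart of the lower hemisphere. The components 1 <= i <= d of q and v are
   those of (xi, eta) and of their rescaled velocities. *)
Section Chart.
Context {R : realType} {d : nat} (a m1 : R) (z : phase R d).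

Definition chart_x (i : nat) : R := - co z.1 i / co z.1 d.+1.

Definition chart_dx (i : nat) : R :=
  co z.1 i * co z.2 d.+1 - co z.1 d.+1 * co z.2 i.

Definition chart_q (i : nat) : R :=
  if (i < d)%N then chart_x i else (chart_x d - a) / Num.sqrt (1 + a ^+ 2).

Definition chart_v (i : nat) : R :=
  if (i < d)%N then chart_dx i else chart_dx d / Num.sqrt (1 + a ^+ 2).

Definition D_chart : R :=
  let q := chart_q in
  let v := chart_v in
  let qq := \sum_(1 <= i < d.+1) q i ^+ 2 in
  let vv := \sum_(1 <= i < d.+1) v i ^+ 2 in
  let qv := \sum_(1 <= i < d.+1) q i * v i in
  (qq * vv - qv ^+ 2)
  + 2 * a / Num.sqrt (1 + a ^+ 2)
    * (vv * q d - qv * v d - m1 * q d / Num.sqrt qq).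

End Chart.

Lemma lagrange_nat {R : realType} (n : nat) (q v : nat -> R) :
  (\sum_(1 <= i < n) q i ^+ 2) * (\sum_(1 <= i < n) v i ^+ 2)
    - (\sum_(1 <= i < n) q i * v i) ^+ 2
  = \sum_(1 <= i < n) \sum_(i.+1 <= j < n) (q i * v j - q j * v i) ^+ 2.
Proof.
case: n => [|n]; first by rewrite !big_geq //; ring.
elim: n => [|n IH]; first by rewrite !big_geq //; ring.
rewrite [RHS]big_nat_recr //= [X in _ = _ + X]big_geq // addr0.
under [RHS]eq_big_nat => i /andP[_ hi] do rewrite big_nat_recr //=.
rewrite big_split /= -IH !(big_nat_recr n.+1) //=.
set A := \sum_(1 <= i < n.+1) q i ^+ 2.
set B := \sum_(1 <= i < n.+1) v i ^+ 2.
set C := \sum_(1 <= i < n.+1) q i * v i.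
have -> : \sum_(1 <= i < n.+1) (q i * v n.+1 - q n.+1 * v i) ^+ 2
   = A * v n.+1 ^+ 2 + B * q n.+1 ^+ 2 - 2 * q n.+1 * v n.+1 * C.
  rewrite /A /B /C !mulr_suml !mulr_sumr -big_split -sumrB /=.
  by apply: eq_bigr => i _; ring.
ring.
Qed.

Lemma D_chartE {R : realType} (d : nat) (a m1 : R) (z : phase R d) :
  (2 <= d)%N -> co z.1 d.+1 < 0 -> D_fun a m1 z = D_chart a m1 z.
Proof.
move=> d2 Qn0; have Qn : co z.1 d.+1 != 0 by rewrite lt_eqF.
have s0 : 0 < 1 + a ^+ 2 by rewrite ltr_wpDr ?sqr_ge0.
rewrite /D_fun /D_chart /=.
have r0 : Num.sqrt (1 + a ^+ 2) != 0 by rewrite gt_eqF // sqrtr_gt0.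
have r2 : Num.sqrt (1 + a ^+ 2) ^+ 2 = 1 + a ^+ 2 by rewrite sqr_sqrtr // ltW.
rewrite lagrange_nat.
case: d z d2 Qn0 Qn => // n z d2 Qn0 Qn.
have qd : chart_q a z n.+1 = - (co z.1 n.+1 + a * co z.1 n.+2)
     / (co z.1 n.+2 * Num.sqrt (1 + a ^+ 2)).
  by rewrite /chart_q ltnn /chart_x; field; rewrite r0 Qn.
have qi i : (i < n.+1)%N -> chart_q a z i = chart_x z i by rewrite /chart_q => ->.
have vi i : (i < n.+1)%N -> chart_v a z i = chart_dx z i by rewrite /chart_v => ->.
have vd : chart_v a z n.+1 = chart_dx z n.+1 / Num.sqrt (1 + a ^+ 2).
  by rewrite /chart_v ltnn.
have qvd i : (i < n.+1)%N ->
    chart_q a z i * chart_v a z n.+1 - chart_q a z n.+1 * chart_v a z i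
    = (Lang z i n.+1 + a * Lang z i n.+2) / Num.sqrt (1 + a ^+ 2).
  move=> hi; rewrite (qi _ hi) (vi _ hi) qd vd /chart_x /chart_dx /Lang.
  by field; rewrite r0 Qn.
have -> : Num.sqrt (\sum_(1 <= i < n.+2) chart_q a z i ^+ 2) =
   Num.sqrt ((1 + a ^+ 2) * (\sum_(1 <= i < n.+1) co z.1 i ^+ 2)
     + (co z.1 n.+1 + a * co z.1 n.+2) ^+ 2)
   / (- co z.1 n.+2 * Num.sqrt (1 + a ^+ 2)).
  have p0 : 0 < - co z.1 n.+2 * Num.sqrt (1 + a ^+ 2).
    by rewrite mulr_gt0 ?oppr_gt0 ?sqrtr_gt0.
  rewrite -[X in _ / X]gtr0_norm // -sqrtr_sqr -sqrtrV ?sqr_ge0 // -sqrtrM; last first.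
    by rewrite addr_ge0 ?sqr_ge0 // mulr_ge0 ?(ltW s0) // sumr_ge0 // => i _; rewrite sqr_ge0.
  congr Num.sqrt; rewrite (big_nat_recr n.+1) //= qd mulrDl mulr_sumr mulr_suml.
  congr (_ + _); last by field; rewrite r0 Qn.
  apply: eq_big_nat => i /andP[_ hi]; rewrite qi // /chart_x.
  by move: (Num.sqrt (1 + a ^+ 2)) r0 r2 => r r0 <-; field; rewrite r0 Qn.
set S := Num.sqrt ((_ * _) + _).
have -> : (\sum_(1 <= i < n.+2) chart_v a z i ^+ 2) * chart_q a z n.+1
    - (\sum_(1 <= i < n.+2) chart_q a z i * chart_v a z i) * chart_v a z n.+1
  = - ((Num.sqrt (1 + a ^+ 2))^-1
     * \sum_(1 <= i < n.+1) (Lang z i n.+1 + a * Lang z i n.+2) * Lang z i n.+2).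
  rewrite !(big_nat_recr n.+1) //= !mulrDl opprD addrACA.
  rewrite [X in _ + X = _](_ : _ = 0) ?addr0; last by ring.
  rewrite !mulr_suml mulr_sumr -sumrB -sumrN; apply: eq_big_nat => i /andP[_ hi].
  transitivity (- (chart_q a z i * chart_v a z n.+1
      - chart_q a z n.+1 * chart_v a z i) * chart_v a z i); first by ring.
  by rewrite qvd // vi // /chart_dx /Lang; field.
have -> : \sum_(1 <= i < n.+2) \sum_(i.+1 <= j < n.+2)
      (chart_q a z i * chart_v a z j - chart_q a z j * chart_v a z i) ^+ 2
   = \sum_(1 <= i < n.+1) \sum_(i.+1 <= j < n.+1) Lang z i j ^+ 2
     + (1 + a ^+ 2)^-1
       * \sum_(1 <= i < n.+1) (Lang z i n.+1 + a * Lang z i n.+2) ^+ 2.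
  rewrite (big_nat_recr n.+1) //= [X in _ + X = _]big_geq // addr0 mulr_sumr -big_split /=.
  apply: eq_big_nat => i /andP[_ hi]; rewrite (big_nat_recr n.+1) //= qvd //.
  congr (_ + _); last by move: (Num.sqrt (1 + a ^+ 2)) r0 r2 => r r0 <-; field; rewrite r0.
  apply: eq_big_nat => j /andP[_ hj]; rewrite !qi // !vi // /chart_x /chart_dx /Lang.
  by field.
rewrite qd; move: {qd vd qvd} (Num.sqrt (1 + a ^+ 2)) r0 r2 => r r0 <-.
have [->|S0] := eqVneq S 0; first by rewrite !(invr0, mul0r, mulr0); field.
by field; rewrite r0 Qn S0.
Qed.

(* Main.v *)
(* Write theta for the central angle between Q and the first center Z.  Along a
   non-singular orbit of E_sKep, cot theta is an affine function of cos and sin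
   of the polar angle t in the plane of the orbit, and the time element is
   dt / (C (1 + cot^2 theta)) with C the conserved angular momentum.  Hence all
   these orbits close up after one turn, and the average of V_sph2 is a quotient
   of two integrals over a turn of explicit functions of t and of finitely many
   scalar invariants of the initial point.  Differentiation under the integral
   sign gives the differentiability.
   The Hamiltonian field X of D commutes with the one of E_sKep, and the second
   integral of the unaveraged two-center problem, linear in m2, says that X V_sph2
   is the derivative of an explicit function along the orbits of E_sKep.  So X
   multiplies both integrals by the same constant: it does so to the integrands up
   to total derivatives of functions of period 2 pi in t. *)
Require Import Defs.
From HB Require Import structures.
From mathcomp Require Import all_boot all_order all_algebra.
From mathcomp Require Import all_classical all_reals all_analysis.
From mathcomp Require Import ring lra.

Set Implicit Arguments.
Unset Strict Implicit.
Unset Printing Implicit Defensive.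

Import Order.TTheory GRing.Theory Num.Theory.
Import numFieldNormedType.Exports.

Local Open Scope classical_set_scope.
Local Open Scope ring_scope.

(** * Uniform differentiability *)

(** The average is built from [get], an [inf] and an integral over a varying period, and near the
    given point no orbit is supplied. The Kepler problem is therefore solved explicitly. The vector
    rho = Q / sin theta obeys the linear equation rho'' + rho = kappa Z in the polar angle, which
    yields existence, uniqueness and the minimal period wherever sin theta > 0 and C > 0. These
    conditions, together with the avoidance of the second pair of centers, are open; so the closed
    formula for the average holds at all points of T S^d near the given one, and it can be
    differentiated. In the polar angle the domain of integration is fixed, so neither the flow nor
    the period is ever differentiated. The assumption on m1 excludes C = 0: a radial orbit defined
    for all times would have an unbounded central angle. Differentiability is stated for families
    indexed by a set, with uniform constants: one calculus then serves scalar functions (one index)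
    and integrands (indexed by the polar angle). *)

Section UniformDifferentiability.
Context {R : realType} {V : normedModType R} {I : Type}.
Implicit Types (D : set I) (F G : V -> I -> R) (A B : V -> I -> R) (z h : V).

(* Frechet differentiability of [x |-> F x _] at [z], with derivative [A], for
   the sup norm over [D]. *)
Definition unif_diff D F z A : Prop :=
  [/\ forall i c h h', A (c *: h + h') i = c * A h i + A h' i,
      exists2 M, 0 < M & forall i, D i -> `|F z i| <= M,
      exists2 M, 0 < M & forall i h, D i -> `|A h i| <= M * `|h| &
      forall e, 0 < e -> exists2 d, 0 < d & forall i h, D i -> `|h| < d ->
        `|F (z + h) i - F z i - A h i| <= e * `|h|].

Lemma unif_diff_lipschitz D F z A : unif_diff D F z A ->
  exists2 K, 0 < K & exists2 d, 0 < d & forall i h, D i -> `|h| < d ->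
    `|F (z + h) i - F z i| <= K * `|h|.
Proof.
case=> _ _ [M M0 HM] /(_ 1 ltr01) [d d0 Hd].
exists (M + 1); first by rewrite addr_gt0.
exists d => // i h Di hd.
rewrite -(subrK (A h i) (F (z + h) i - F z i)) (le_trans (ler_normD _ _))//.
by rewrite addrC mulrDl lerD// ?HM// Hd.
Qed.

Lemma unif_diff_cont D F z A : unif_diff D F z A ->
  forall e, 0 < e -> exists2 d, 0 < d & forall i h, D i -> `|h| < d ->
    `|F (z + h) i - F z i| <= e.
Proof.
move=> /unif_diff_lipschitz[K K0 [d d0 H]] e e0.
exists (Num.min d (e / K)); first by rewrite lt_min d0 divr_gt0.
move=> i h Di; rewrite lt_min => /andP[hd he].
by rewrite (le_trans (H _ _ Di hd))// mulrC -ler_pdivlMr// ltW.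
Qed.

Lemma unif_diff_near D F G z A : unif_diff D F z A ->
  (exists2 d, 0 < d & forall i h, D i -> `|h| < d -> F (z + h) i = G (z + h) i) ->
  unif_diff D G z A.
Proof.
case=> lA [M M0 HM] bA H [d0 d00 FG].
have FGz i : D i -> F z i = G z i.
  by move=> Di; have := FG i 0 Di; rewrite normr0 addr0; apply.
split=> //; first by exists M => // i Di; rewrite -FGz// HM.
move=> e /H[d d1 Hd]; exists (Num.min d d0); first by rewrite lt_min d1.
by move=> i h Di; rewrite lt_min => /andP[hd hd0]; rewrite -FG// -FGz// Hd.
Qed.

Lemma unif_diff_ext D F G z A B : unif_diff D F z A ->
  (forall x i, F x i = G x i) -> (forall h i, A h i = B h i) ->
  unif_diff D G z B.
Proof.
move=> H /(_ _)/funext FG AB.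
have -> : G = F by apply/funext => x; apply/funext => i; rewrite FG.
by have -> : B = A by apply/funext => x; apply/funext => i; rewrite AB.
Qed.

Lemma unif_diff_cst D (c : I -> R) z : (exists M, forall i, D i -> `|c i| <= M) ->
  unif_diff D (fun _ => c) z (fun _ _ => 0).
Proof.
move=> [M HM]; split=> [i ? ? ?| | |].
- by rewrite mulr0 addr0.
- exists (Num.max 1 M); first by rewrite lt_max ltr01.
  by move=> i Di; rewrite le_max HM// orbT.
- by exists 1 => // i h _; rewrite normr0 mul1r.
- by move=> e e0; exists 1 => // i h _ _; rewrite subrr subr0 normr0 mulr_ge0// ltW.
Qed.

Lemma unif_diff_const D (c : R) z : unif_diff D (fun _ _ => c) z (fun _ _ => 0).
Proof. by apply: unif_diff_cst; exists `|c|. Qed.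

Lemma unif_diff_add D F G z A B : unif_diff D F z A -> unif_diff D G z B ->
  unif_diff D (fun x i => F x i + G x i) z (fun h i => A h i + B h i).
Proof.
case=> lA [M M0 HM] [MA MA0 HMA] HA [lB [N N0 HN] [MB MB0 HMB] HB].
split=> [i c h h'| | |].
- by rewrite lA lB; ring.
- exists (M + N); first exact: addr_gt0.
  by move=> i Di; rewrite (le_trans (ler_normD _ _))// lerD ?HM ?HN.
- exists (MA + MB); first exact: addr_gt0.
  move=> i h Di; rewrite (le_trans (ler_normD _ _))// mulrDl.
  by rewrite lerD ?HMA ?HMB.
- move=> e e0; have e20 : 0 < e / 2 by rewrite divr_gt0.
  have [d d0 Hd] := HA _ e20; have [d' d'0 Hd'] := HB _ e20.
  exists (Num.min d d'); first by rewrite lt_min d0.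
  move=> i h Di; rewrite lt_min => /andP[hd hd'].
  rewrite (_ : _ - _ - _ = (F (z + h) i - F z i - A h i) +
    (G (z + h) i - G z i - B h i)); last by ring.
  rewrite (le_trans (ler_normD _ _))// [e]splitr mulrDl.
  by rewrite lerD ?Hd ?Hd'.
Qed.

Lemma unif_diff_mul D F G z A B : unif_diff D F z A -> unif_diff D G z B ->
  unif_diff D (fun x i => F x i * G x i) z
    (fun h i => A h i * G z i + F z i * B h i).
Proof.
move=> uF uG; have [K K0 [dK dK0 HK]] := unif_diff_lipschitz uF.
have [L L0 [dL dL0 HL]] := unif_diff_lipschitz uG.
case: uF uG => lA [M M0 HM] [MA MA0 HMA] HA [lB [N N0 HN] [MB MB0 HMB] HB].
split=> [i c h h'| | |].
- by rewrite lA lB; ring.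
- exists (M * N); first exact: mulr_gt0.
  by move=> i Di; rewrite normrM ler_pM ?HM ?HN.
- exists (MA * N + M * MB); first by rewrite addr_gt0 ?mulr_gt0.
  move=> i h Di; rewrite (le_trans (ler_normD _ _))// mulrDl !normrM.
  rewrite lerD//; last by rewrite -mulrA ler_pM ?HM ?HMB.
  by rewrite mulrAC ler_pM ?HN ?HMA.
move=> e e0.
(* Each of the three error terms gets e / 3. The third is a product of two increments, at most K L
   |h|^2, and [d3] bounds one of the factors |h|. *)
pose e1 := e / (3 * N); pose e2 := e / (3 * M).
have e10 : 0 < e1 by rewrite divr_gt0 ?mulr_gt0.
have e20 : 0 < e2 by rewrite divr_gt0 ?mulr_gt0.
have [d d0 Hd] := HA _ e10; have [d' d'0 Hd'] := HB _ e20.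
pose d3 := e / (3 * (K * L)).
have d30 : 0 < d3 by rewrite divr_gt0 ?mulr_gt0.
exists (Num.min (Num.min d d') (Num.min d3 (Num.min dK dL))).
  by rewrite !lt_min d0 d'0 d30 dK0 dL0.
move=> i h Di; rewrite !lt_min => /andP[/andP[hd hd'] /andP[hd3 /andP[hK hL]]].
rewrite (_ : _ - _ - _ = (F (z + h) i - F z i - A h i) * G z i
    + F z i * (G (z + h) i - G z i - B h i)
    + (F (z + h) i - F z i) * (G (z + h) i - G z i)); last by ring.
have -> : e * `|h| = e1 * `|h| * N + M * (e2 * `|h|) + d3 * K * L * `|h|.
  by rewrite /e1 /e2 /d3; field; rewrite !gt_eqF.
rewrite (le_trans (ler_normD _ _))// lerD//.
  rewrite (le_trans (ler_normD _ _))// !normrM lerD//.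
    by rewrite ler_pM ?HN ?Hd.
  by rewrite ler_pM ?HM ?Hd'.
rewrite normrM (le_trans (ler_pM _ _ (HK _ _ Di hK) (HL _ _ Di hL)))//.
rewrite [leLHS](_ : _ = `|h| * (K * L * `|h|)); last by ring.
rewrite [leRHS](_ : _ = d3 * (K * L * `|h|)); last by ring.
by rewrite ler_wpM2r ?(ltW hd3)// !mulr_ge0// ltW.
Qed.

Lemma unif_diff_scale D F z A (c : R) : unif_diff D F z A ->
  unif_diff D (fun x i => c * F x i) z (fun h i => c * A h i).
Proof.
move=> uF; apply: unif_diff_ext (unif_diff_mul (unif_diff_const D c z) uF) _ _ => //.
by move=> h i; rewrite mul0r add0r.
Qed.

Lemma unif_diff_sub D F G z A B : unif_diff D F z A -> unif_diff D G z B ->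
  unif_diff D (fun x i => F x i - G x i) z (fun h i => A h i - B h i).
Proof.
move=> uF uG; apply: unif_diff_ext (unif_diff_add uF (unif_diff_scale (-1) uG)) _ _.
  by move=> x i; rewrite mulN1r.
by move=> x i; rewrite mulN1r.
Qed.

Lemma unif_diff_sum D (J : Type) (r : seq J) (F A : J -> V -> I -> R) z :
  (forall j, unif_diff D (F j) z (A j)) ->
  unif_diff D (fun x i => \sum_(j <- r) F j x i) z
    (fun h i => \sum_(j <- r) A j h i).
Proof.
move=> H; elim: r => [|j r IH].
  by apply: unif_diff_ext (unif_diff_const D 0 z) _ _ => ? ?; rewrite big_nil.
by apply: unif_diff_ext (unif_diff_add (H j) IH) _ _ => ? ?; rewrite big_cons.
Qed.

(** The values F z i may range over infinitely many points, so a second-order Taylor bound with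
    constants uniform in i takes the place of differentiability of f at each of them. *)
Lemma unif_diff_comp D F z A (f : R -> R) (df : I -> R) : unif_diff D F z A ->
  (exists2 M, 0 < M & forall i, D i -> `|f (F z i)| <= M /\ `|df i| <= M) ->
  (exists2 K, 0 < K & exists2 r, 0 < r & forall i t, D i -> `|t| <= r ->
    `|f (F z i + t) - f (F z i) - df i * t| <= K * t ^+ 2) ->
  unif_diff D (fun x i => f (F x i)) z (fun h i => df i * A h i).
Proof.
move=> uF [M M0 HM] [K K0 [r r0 HK]].
have [L L0 [dL dL0 HL]] := unif_diff_lipschitz uF.
have [dr dr0 Hr] := unif_diff_cont uF r0.
case: uF => lA _ [MA MA0 HMA] HA.
split=> [i c h h'| | |].
- by rewrite lA; ring.
- by exists M => // i /HM[].
- exists (M * MA); first exact: mulr_gt0.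
  by move=> i h Di; rewrite normrM -mulrA ler_pM ?HMA//; case: (HM _ Di).
move=> e e0.
pose e1 := e / (2 * M); have e10 : 0 < e1 by rewrite divr_gt0 ?mulr_gt0.
have [d d0 Hd] := HA _ e10.
pose d3 := e / (2 * (K * L ^+ 2)).
have d30 : 0 < d3 by rewrite divr_gt0 ?mulr_gt0 ?exprn_gt0.
exists (Num.min (Num.min d d3) (Num.min dr dL)); first by rewrite !lt_min d0 d30 dr0.
move=> i h Di; rewrite !lt_min => /andP[/andP[hd hd3] /andP[hr hL]].
set t := F (z + h) i - F z i.
have -> : F (z + h) i = F z i + t by rewrite /t; ring.
rewrite (_ : _ - _ - _ = (f (F z i + t) - f (F z i) - df i * t)
    + df i * (t - A h i)); last by ring.
have -> : e * `|h| = d3 * (K * L ^+ 2 * `|h|) + M * (e1 * `|h|).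
  by rewrite /e1 /d3; field; rewrite !gt_eqF.
rewrite (le_trans (ler_normD _ _))// lerD//; last first.
  by rewrite normrM ler_pM ?Hd//; case: (HM _ Di).
rewrite (le_trans (HK _ _ Di (Hr _ _ Di hr)))//.
have tL : t ^+ 2 <= (L * `|h|) ^+ 2.
  by rewrite -[t ^+ 2]ger0_norm ?sqr_ge0// normrX ler_sqr ?nnegrE ?mulr_ge0 ?HL// ltW.
apply: (@le_trans _ _ (K * (L * `|h|) ^+ 2)); first by rewrite ler_pM2l.
rewrite [leLHS](_ : _ = `|h| * (K * L ^+ 2 * `|h|)); last by ring.
by rewrite ler_wpM2r ?(ltW hd3)// !mulr_ge0// ?exprn_ge0// ltW.
Qed.

Lemma unif_diff_inv D F z A : unif_diff D F z A ->
  (exists2 m, 0 < m & forall i, D i -> m <= F z i) ->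
  unif_diff D (fun x i => (F x i)^-1) z (fun h i => - (F z i) ^- 2 * A h i).
Proof.
move=> uF [m m0 Hm].
have F0 i : D i -> 0 < F z i by move=> /Hm; exact: lt_le_trans.
apply: (@unif_diff_comp _ _ _ _ (fun t => t^-1) (fun i => - (F z i) ^- 2)) => //.
  exists (Num.max m^-1 (m ^- 2)); first by rewrite lt_max invr_gt0 m0.
  move=> i Di; have Fi := F0 _ Di; have mF := Hm _ Di; split.
    by rewrite gtr0_norm ?invr_gt0// le_max lef_pV2// ?posrE// mF.
  rewrite normrN gtr0_norm ?invr_gt0 ?exprn_gt0// le_max; apply/orP; right.
  by rewrite lef_pV2 ?posrE ?exprn_gt0// lerXn2r ?nnegrE ?(ltW m0) ?(ltW Fi).
(* The remainder is t^2 / (F^2 (F + t)), and |t| <= m / 2 keeps F + t above m / 2. *)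
exists (2 / m ^+ 3); first by rewrite divr_gt0 ?exprn_gt0.
exists (m / 2); first by rewrite divr_gt0.
move=> i t Di ht; have mF := Hm _ Di; have Fi := F0 _ Di.
have Ft : m / 2 <= F z i + t.
  have : - t <= m / 2 by rewrite (le_trans _ ht)// -normrN ler_norm.
  lra.
have Ft0 : 0 < F z i + t by apply: lt_le_trans Ft; rewrite divr_gt0.
have -> : (F z i + t)^-1 - (F z i)^-1 - - F z i ^- 2 * t =
    (F z i ^+ 2 * (F z i + t))^-1 * t ^+ 2.
  by field; rewrite !gt_eqF.
rewrite normrM [`|t ^+ 2|]ger0_norm ?sqr_ge0// ler_wpM2r ?sqr_ge0//.
rewrite gtr0_norm; last by rewrite invr_gt0 mulr_gt0 ?exprn_gt0.
have -> : 2 / m ^+ 3 = (m ^+ 2 * (m / 2))^-1 by field; rewrite gt_eqF.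
rewrite lef_pV2 ?posrE ?mulr_gt0 ?exprn_gt0 ?invr_gt0//.
by rewrite ler_pM ?exprn_ge0 ?(ltW m0)// ?divr_ge0// ?(ltW m0)// lerXn2r ?nnegrE ?(ltW m0) ?(ltW Fi).
Qed.

Lemma unif_diff_sqrt D F z A : unif_diff D F z A ->
  (exists2 m, 0 < m & forall i, D i -> m <= F z i) ->
  unif_diff D (fun x i => Num.sqrt (F x i)) z
    (fun h i => (2 * Num.sqrt (F z i))^-1 * A h i).
Proof.
move=> uF [m m0 Hm].
have F0 i : D i -> 0 < F z i by move=> /Hm; exact: lt_le_trans.
have sm0 : 0 < Num.sqrt m by rewrite sqrtr_gt0.
have sm i : D i -> Num.sqrt m <= Num.sqrt (F z i) by move=> Di; rewrite ler_wsqrtr ?Hm.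
apply: (@unif_diff_comp _ _ _ _ Num.sqrt (fun i => (2 * Num.sqrt (F z i))^-1)) => //.
  case: uF => _ [M M0 HM] _ _.
  exists (Num.max (Num.sqrt M) (2 * Num.sqrt m)^-1).
    by rewrite lt_max sqrtr_gt0 M0.
  move=> i Di; have Fi := F0 _ Di; split.
    rewrite ger0_norm ?sqrtr_ge0// le_max ler_wsqrtr// (le_trans (ler_norm _))//.
    exact: HM.
  have s0 : 0 < Num.sqrt (F z i) by rewrite sqrtr_gt0.
  rewrite gtr0_norm ?invr_gt0 ?mulr_gt0// le_max; apply/orP; right.
  by rewrite lef_pV2 ?posrE ?mulr_gt0// ler_pM2l// sm.
(* With p and q the roots of F and F + t, the remainder is - t^2 / (2 p (q + p)^2), and both p and q
   + p are at least the root of m. *)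
exists (2 * Num.sqrt m ^+ 3)^-1; first by rewrite invr_gt0 mulr_gt0 ?exprn_gt0.
exists (m / 2); first by rewrite divr_gt0.
move=> i t Di ht; have mF := Hm _ Di; have Fi := F0 _ Di.
have Ft0 : 0 < F z i + t.
  have : - t <= m / 2 by rewrite (le_trans _ ht)// -normrN ler_norm.
  lra.
have s0 : 0 < Num.sqrt (F z i) by rewrite sqrtr_gt0.
have st0 : 0 < Num.sqrt (F z i + t) by rewrite sqrtr_gt0.
have := sqr_sqrtr (ltW Fi); have := sqr_sqrtr (ltW Ft0).
have := sm _ Di.
move: (Num.sqrt (F z i)) (Num.sqrt (F z i + t)) s0 st0 => p q p0 q0 mp Hq Hp.
have -> : t = q ^+ 2 - p ^+ 2 by rewrite Hq Hp; ring.
have -> : q - p - (2 * p)^-1 * (q ^+ 2 - p ^+ 2) =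
    - ((2 * (p * (q + p) ^+ 2))^-1 * (q ^+ 2 - p ^+ 2) ^+ 2).
  by field; rewrite !gt_eqF// addr_gt0.
rewrite normrN normrM [`|_ ^+ 2|]ger0_norm ?sqr_ge0// ler_wpM2r ?sqr_ge0//.
have qp : 0 < q + p by rewrite addr_gt0.
rewrite gtr0_norm; last by rewrite invr_gt0 !mulr_gt0 ?exprn_gt0.
rewrite lef_pV2 ?posrE ?mulr_gt0 ?exprn_gt0// ler_pM2l//.
rewrite exprS ler_pM ?exprn_ge0// ?(ltW sm0)//.
by rewrite lerXn2r ?nnegrE ?(ltW sm0) ?(ltW qp)//; lra.
Qed.

Lemma unif_diff_lower D F z A (m : R) : unif_diff D F z A -> 0 < m ->
  (forall i, D i -> m <= F z i) ->
  exists2 d, 0 < d & forall i h, D i -> `|h| < d -> 0 < F (z + h) i.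
Proof.
move=> uF m0 Hm; have m20 : 0 < m / 2 by rewrite divr_gt0.
have [d d0 Hd] := unif_diff_cont uF m20.
exists d => // i h Di /(Hd _ _ Di); rewrite ler_distl => /andP[+ _].
by have := Hm _ Di; lra.
Qed.

End UniformDifferentiability.

(** * Frechet differentiability from the case of a single index *)

Section ToFrechet.
Context {R : realType} {V : normedModType R}.

Lemma unif_diff_differentiable (F : V -> R) z (A : V -> R) :
  unif_diff setT (fun x (_ : unit) => F x) z (fun h _ => A h) ->
  differentiable (F : V -> R^o) z /\ forall h, 'd (F : V -> R^o) z h = A h.
Proof.
move=> [lA _ [M M0 HM] HA].
have lA' : linear (A : V -> R^o) by move=> c h h'; exact: (lA tt).
pose lm := GRing.isLinear.Build R V R^o *:%R A lA'.
pose L : {linear V -> R^o} := HB.pack A lm.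
have cL : continuous L.
  apply/linear_bounded_continuous.
  apply/linear_boundedP; exists M; split; first exact: num_real.
  by move=> r Mr h; rewrite (le_trans (HM tt h I))// ler_wpM2r// ltW.
have Lo : (F : V -> R^o) \o shift z = cst (F z : R^o) + L +o_ 0 id.
  apply/eqaddoP => _/posnumP[e].
  have [d d0 Hd] := HA _ [gt0 of e%:num].
  near=> h.
  rewrite [X in `|X|](_ : _ = F (z + h) - F z - A h); last first.
    by rewrite !fctE /= [h + z]addrC opprD addrA.
  apply: (Hd tt h I); near: h; apply/nbhs_ballP; exists d => //= h.
  by rewrite -ball_normE /= sub0r normrN.
have dL := diff_unique cL Lo.
split; last by move=> h; rewrite dL.
by apply/diff_locallyP; rewrite dL.
Unshelve. all: by end_near. Qed.

End ToFrechet.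

(** * Differentiation on T S^d *)

Section Dot.
Context {R : realType} {n : nat}.
Implicit Types u v w : 'rV[R]_n.

Lemma dotvC u v : dotv u v = dotv v u.
Proof. by apply: eq_bigr => i _; rewrite mulrC. Qed.

Lemma dotvDl u v w : dotv (u + v) w = dotv u w + dotv v w.
Proof. by rewrite /dotv -big_split; apply: eq_bigr => i _; rewrite mxE mulrDl. Qed.

Lemma dotvZl c u w : dotv (c *: u) w = c * dotv u w.
Proof. by rewrite /dotv mulr_sumr; apply: eq_bigr => i _; rewrite mxE mulrA. Qed.

Lemma dotvNl u w : dotv (- u) w = - dotv u w.
Proof. by rewrite -scaleN1r dotvZl mulN1r. Qed.

Lemma dotvBl u v w : dotv (u - v) w = dotv u w - dotv v w.
Proof. by rewrite dotvDl dotvNl. Qed.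

Lemma dotvDr u v w : dotv w (u + v) = dotv w u + dotv w v.
Proof. by rewrite !(dotvC w) dotvDl. Qed.

Lemma dotvZr c u w : dotv w (c *: u) = c * dotv w u.
Proof. by rewrite !(dotvC w) dotvZl. Qed.

Lemma dotvNr u w : dotv w (- u) = - dotv w u.
Proof. by rewrite !(dotvC w) dotvNl. Qed.

Lemma dotvBr u v w : dotv w (u - v) = dotv w u - dotv w v.
Proof. by rewrite !(dotvC w) dotvBl. Qed.

Lemma dotv0l w : dotv 0 w = 0.
Proof. by rewrite -(scale0r 0) dotvZl mul0r. Qed.

Lemma dotv_ge0 u : 0 <= dotv u u.
Proof. by apply: sumr_ge0 => i _; rewrite -expr2 sqr_ge0. Qed.

Lemma dotv_eq0 u : dotv u u = 0 -> u = 0.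
Proof.
move=> /eqP; rewrite psumr_eq0 => [/allP H|i _]; last by rewrite -expr2 sqr_ge0.
apply/rowP => i; rewrite mxE; have := H i (mem_index_enum _).
by rewrite mulf_eq0 orbb => /eqP.
Qed.

Lemma dotv_ext u v : (forall w, dotv u w = dotv v w) -> u = v.
Proof. by move=> uv; apply/subr0_eq/dotv_eq0; rewrite dotvBl uv subrr. Qed.

Lemma dotv_unit u z : dotv u u = 1 -> dotv z z = 1 ->
  dotv (u - dotv u z *: z) (u - dotv u z *: z) = 1 - dotv u z ^+ 2.
Proof.
move=> uu zz; rewrite !(dotvBl, dotvBr, dotvZl, dotvZr) uu zz (dotvC z u); ring.
Qed.

Lemma dotv_unit_le1 u z : dotv u u = 1 -> dotv z z = 1 -> dotv u z ^+ 2 <= 1.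
Proof. by move=> uu zz; rewrite -subr_ge0 -dotv_unit// dotv_ge0. Qed.

(** The equality case of Cauchy-Schwarz. It turns the avoidance of a center and of its antipode into
    a strict inequality, that is, into an open condition. *)
Lemma dotv_unit_lt1 u z : dotv u u = 1 -> dotv z z = 1 -> u <> z -> u <> - z ->
  dotv u z ^+ 2 < 1.
Proof.
move=> uu zz uz uNz; rewrite lt_neqAle dotv_unit_le1// andbT; apply/eqP => w1.
have /dotv_eq0/subr0_eq uE : dotv (u - dotv u z *: z) (u - dotv u z *: z) = 0.
  by rewrite dotv_unit// w1 subrr.
move/eqP: w1; rewrite sqrf_eq1 => /orP[] /eqP w1; rewrite w1 in uE.
  by apply: uz; rewrite uE scale1r.
by apply: uNz; rewrite uE scaleN1r.
Qed.

End Dot.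

Definition dotvE := (@dotvDl, @dotvDr, @dotvBl, @dotvBr, @dotvZl, @dotvZr,
  @dotvNl, @dotvNr, @dotv0l).

Section TSdiff.
Context {R : realType} {d : nat} {I : Type}.
Local Notation V := (phase R d).
Implicit Types (D : set I) (F G A B : V -> I -> R) (z h x Y : V).

Lemma retrTS_id z : TS z -> retrTS z = z.
Proof.
case: z => Q P [/= QQ QP]; rewrite /retrTS /= QQ sqrtr1 invr1 !scale1r QP.
by rewrite scale0r subr0.
Qed.

Lemma TS_retrTS x : 0 < dotv x.1 x.1 -> TS (retrTS x).
Proof.
case: x => Q P /= q0; rewrite /TS/= /retrTS /=.
have s0 : Num.sqrt (dotv Q Q) != 0 by rewrite gt_eqF ?sqrtr_gt0.
have s2 : Num.sqrt (dotv Q Q) ^+ 2 = dotv Q Q by rewrite sqr_sqrtr// ltW.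
rewrite !dotvE; move: s0 s2; set s := Num.sqrt _ => s0 s2; rewrite -s2.
by split; field.
Qed.

(** The square roots of the retraction cancel in the velocity, which leaves a rational expression in
    scalar products. *)
Lemma retrTS_dot2 x w : 0 < dotv x.1 x.1 ->
  dotv (retrTS x).2 w = dotv x.2 w - (dotv x.1 x.1)^-1 * dotv x.1 x.2 * dotv x.1 w.
Proof.
move=> q0; rewrite /retrTS /= !dotvE.
have s0 : Num.sqrt (dotv x.1 x.1) != 0 by rewrite gt_eqF ?sqrtr_gt0.
by move: s0 (sqr_sqrtr (ltW q0)); move: (Num.sqrt _) => s s0 <-; field.
Qed.

Lemma retrTS_dot22 x : 0 < dotv x.1 x.1 ->
  dotv (retrTS x).2 (retrTS x).2 =
  dotv x.2 x.2 - (dotv x.1 x.1)^-1 * dotv x.1 x.2 * dotv x.1 x.2.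
Proof.
move=> q0; rewrite retrTS_dot2// /retrTS /= !dotvE (dotvC x.2 x.1).
have s0 : Num.sqrt (dotv x.1 x.1) != 0 by rewrite gt_eqF ?sqrtr_gt0.
by move: s0 (sqr_sqrtr (ltW q0)); move: (Num.sqrt _) => s s0 <-; field.
Qed.

Lemma phase_norm1 (h : V) i : `|h.1 ord0 i| <= `|h|.
Proof.
rewrite prod_normE le_max; apply/orP; left.
by rewrite [leRHS]/Num.Def.normr/= mx_normrE; exact: (le_bigmax _ _ (ord0, i)).
Qed.

Lemma phase_norm2 (h : V) i : `|h.2 ord0 i| <= `|h|.
Proof.
rewrite prod_normE le_max; apply/orP; right.
by rewrite [leRHS]/Num.Def.normr/= mx_normrE; exact: (le_bigmax _ _ (ord0, i)).
Qed.

Lemma unif_diff_coord1 D z j :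
  unif_diff D (fun x _ => x.1 ord0 j) z (fun h _ => h.1 ord0 j).
Proof.
split=> [i c h h' | | | e e0]; first by rewrite !mxE.
- by exists (`|z.1 ord0 j| + 1) => [|i _]; rewrite ?ltr_wpDl// lerDl.
- by exists 1 => // i h _; rewrite mul1r phase_norm1.
- exists 1 => // i h _ _; rewrite /= mxE [X in `|X|](_ : _ = 0); last ring.
  by rewrite normr0 mulr_ge0// ltW.
Qed.

Lemma unif_diff_coord2 D z j :
  unif_diff D (fun x _ => x.2 ord0 j) z (fun h _ => h.2 ord0 j).
Proof.
split=> [i c h h' | | | e e0]; first by rewrite !mxE.
- by exists (`|z.2 ord0 j| + 1) => [|i _]; rewrite ?ltr_wpDl// lerDl.
- by exists 1 => // i h _; rewrite mul1r phase_norm2.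
- exists 1 => // i h _ _; rewrite /= mxE [X in `|X|](_ : _ = 0); last ring.
  by rewrite normr0 mulr_ge0// ltW.
Qed.

Lemma unif_diff_dot1 D z (w : 'rV_d.+1) :
  unif_diff D (fun x _ => dotv x.1 w) z (fun h _ => dotv h.1 w).
Proof.
apply: unif_diff_ext (unif_diff_sum (index_enum _)
  (fun j => unif_diff_scale (w ord0 j) (unif_diff_coord1 D z j))) _ _ => x i;
  by apply: eq_bigr => j _; rewrite mulrC.
Qed.

Lemma unif_diff_dot2 D z (w : 'rV_d.+1) :
  unif_diff D (fun x _ => dotv x.2 w) z (fun h _ => dotv h.2 w).
Proof.
apply: unif_diff_ext (unif_diff_sum (index_enum _)
  (fun j => unif_diff_scale (w ord0 j) (unif_diff_coord2 D z j))) _ _ => x i;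
  by apply: eq_bigr => j _; rewrite mulrC.
Qed.

Lemma unif_diff_dot11 D z :
  unif_diff D (fun x _ => dotv x.1 x.1) z (fun h _ => dotv h.1 z.1 + dotv z.1 h.1).
Proof.
apply: unif_diff_ext (unif_diff_sum (index_enum _)
  (fun j => unif_diff_mul (unif_diff_coord1 D z j) (unif_diff_coord1 D z j))) _ _.
  by [].
by move=> h i; rewrite big_split.
Qed.

Lemma unif_diff_dot12 D z :
  unif_diff D (fun x _ => dotv x.1 x.2) z (fun h _ => dotv h.1 z.2 + dotv z.1 h.2).
Proof.
apply: unif_diff_ext (unif_diff_sum (index_enum _)
  (fun j => unif_diff_mul (unif_diff_coord1 D z j) (unif_diff_coord2 D z j))) _ _.
  by [].
by move=> h i; rewrite big_split.
Qed.

Lemma unif_diff_dot22 D z :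
  unif_diff D (fun x _ => dotv x.2 x.2) z (fun h _ => dotv h.2 z.2 + dotv z.2 h.2).
Proof.
apply: unif_diff_ext (unif_diff_sum (index_enum _)
  (fun j => unif_diff_mul (unif_diff_coord2 D z j) (unif_diff_coord2 D z j))) _ _.
  by [].
by move=> h i; rewrite big_split.
Qed.

End TSdiff.

Section DiffTS.
Context {R : realType} {d : nat}.

Lemma near_TS (z : phase R d) : TS z ->
  exists2 r, 0 < r & forall h, `|h| < r -> TS (retrTS (z + h)).
Proof.
move=> [QQ _]; have uF := unif_diff_dot11 (setT : set unit) z.
have [] := unif_diff_lower uF ltr01; first by move=> i _; rewrite QQ.
by move=> r r0 H; exists r => // h /(H tt h I)/TS_retrTS.
Qed.

Context {I : Type}.
Local Notation V := (phase R d).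
Implicit Types (D : set I) (F G A B : V -> I -> R) (z h x Y : V).

(* Only the values of [A] on [TTS z] are meaningful. *)
Definition diffTS D F z A : Prop :=
  exists2 B, unif_diff D (fun x i => F (retrTS x) i) z B &
    forall Y i, TTS z Y -> D i -> B Y i = A Y i.

Lemma diffTS_ext D F G z A B : diffTS D F z A ->
  (forall x i, F x i = G x i) -> (forall Y i, TTS z Y -> D i -> A Y i = B Y i) ->
  diffTS D G z B.
Proof.
move=> [A' uF AE] FG AB; exists A'; last by move=> Y i tY Di; rewrite AE// AB.
by apply: unif_diff_ext uF _ _.
Qed.

Lemma diffTS_cst D (c : I -> R) z : (exists M, forall i, D i -> `|c i| <= M) ->
  diffTS D (fun _ => c) z (fun _ _ => 0).
Proof. by move=> bc; exists (fun _ _ => 0) => //; exact: unif_diff_cst. Qed.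

Lemma diffTS_const D (c : R) z : diffTS D (fun _ _ => c) z (fun _ _ => 0).
Proof. by apply: diffTS_cst; exists `|c|. Qed.

Lemma diffTS_add D F G z A B : diffTS D F z A -> diffTS D G z B ->
  diffTS D (fun x i => F x i + G x i) z (fun h i => A h i + B h i).
Proof.
move=> [A' uF AE] [B' uG BE]; eexists; first exact: unif_diff_add uF uG.
by move=> Y i tY Di /=; rewrite AE ?BE.
Qed.

Lemma diffTS_sub D F G z A B : diffTS D F z A -> diffTS D G z B ->
  diffTS D (fun x i => F x i - G x i) z (fun h i => A h i - B h i).
Proof.
move=> [A' uF AE] [B' uG BE]; eexists; first exact: unif_diff_sub uF uG.
by move=> Y i tY Di /=; rewrite AE ?BE.
Qed.

Lemma diffTS_scale D F z A (c : R) : diffTS D F z A ->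
  diffTS D (fun x i => c * F x i) z (fun h i => c * A h i).
Proof.
move=> [A' uF AE]; eexists; first exact: unif_diff_scale uF.
by move=> Y i tY Di /=; rewrite AE.
Qed.

Lemma diffTS_mul D F G z A B : TS z -> diffTS D F z A -> diffTS D G z B ->
  diffTS D (fun x i => F x i * G x i) z (fun h i => A h i * G z i + F z i * B h i).
Proof.
move=> Tz [A' uF AE] [B' uG BE]; eexists; first exact: unif_diff_mul uF uG.
by move=> Y i tY Di /=; rewrite AE ?BE ?retrTS_id.
Qed.

Lemma diffTS_inv D F z A : TS z -> diffTS D F z A ->
  (exists2 m, 0 < m & forall i, D i -> m <= F z i) ->
  diffTS D (fun x i => (F x i)^-1) z (fun h i => - (F z i) ^- 2 * A h i).
Proof.
move=> Tz [A' uF AE] Hm; eexists.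
  by apply: unif_diff_inv uF _; rewrite retrTS_id.
by move=> Y i tY Di /=; rewrite AE ?retrTS_id.
Qed.

Lemma diffTS_sqrt D F z A : TS z -> diffTS D F z A ->
  (exists2 m, 0 < m & forall i, D i -> m <= F z i) ->
  diffTS D (fun x i => Num.sqrt (F x i)) z
    (fun h i => (2 * Num.sqrt (F z i))^-1 * A h i).
Proof.
move=> Tz [A' uF AE] Hm; eexists.
  by apply: unif_diff_sqrt uF _; rewrite retrTS_id.
by move=> Y i tY Di /=; rewrite AE ?retrTS_id.
Qed.

(** Agreement is asked at nearby points of T S^d only. This is how [E_sKep], [D_fun] and the average
    are exchanged for their expressions in reduced coordinates. *)
Lemma diffTS_near D F G z A : TS z -> diffTS D F z A ->
  (exists2 r, 0 < r & forall h, `|h| < r -> TS (retrTS (z + h)) ->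
    forall i, D i -> F (retrTS (z + h)) i = G (retrTS (z + h)) i) ->
  diffTS D G z A.
Proof.
move=> Tz [A' uF AE] [r r0 FG]; exists A' => //.
have [r' r'0 H] := near_TS Tz.
apply: unif_diff_near uF _; exists (Num.min r r'); first by rewrite lt_min r0.
by move=> i h Di; rewrite lt_min => /andP[hr hr']; apply: FG => //; exact: H.
Qed.

Lemma diffTS_pos D F z A (m : R) : TS z -> diffTS D F z A -> 0 < m ->
  (forall i, D i -> m <= F z i) ->
  exists2 r, 0 < r & forall h, `|h| < r -> forall i, D i -> 0 < F (retrTS (z + h)) i.
Proof.
move=> Tz [A' uF _] m0 Hm; have [] := unif_diff_lower uF m0.
  by move=> i Di; rewrite retrTS_id// Hm.
by move=> r r0 H; exists r => // h hr i Di; apply: H.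
Qed.

(** The differential of the retraction is the identity on [TTS z]: the equations of the tangent
    space cancel the terms that come from the normalization. *)
Lemma diffTS_dot1 D z w : TS z ->
  diffTS D (fun x _ => dotv x.1 w) z (fun h _ => dotv h.1 w).
Proof.
move=> Tz; have [QQ QP] := Tz.
have q1 : exists2 m : R, 0 < m & forall i, D i -> m <= dotv z.1 z.1.
  by exists 1 => // i _; rewrite QQ.
have s1 : exists2 m : R, 0 < m & forall i, D i -> m <= Num.sqrt (dotv z.1 z.1).
  by exists 1 => // i _; rewrite QQ sqrtr1.
eexists.
  apply: unif_diff_ext (unif_diff_mul
    (unif_diff_inv (unif_diff_sqrt (unif_diff_dot11 D z) q1) s1)
    (unif_diff_dot1 D z w)) _ _; last by [].
  by move=> x i; rewrite /retrTS /= dotvZl.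
move=> Y i [tY _] Di /=; rewrite QQ sqrtr1 (dotvC Y.1) tY; by field.
Qed.

Lemma diffTS_dot2 D z w : TS z ->
  diffTS D (fun x _ => dotv x.2 w) z (fun h _ => dotv h.2 w).
Proof.
move=> Tz; have [QQ QP] := Tz.
have q1 : exists2 m : R, 0 < m & forall i, D i -> m <= dotv z.1 z.1.
  by exists 1 => // i _; rewrite QQ.
eexists.
  apply: unif_diff_near (unif_diff_sub (unif_diff_dot2 D z w)
    (unif_diff_mul (unif_diff_mul (unif_diff_inv (unif_diff_dot11 D z) q1) (unif_diff_dot12 D z))
       (unif_diff_dot1 D z w))) _.
  have [|r r0 Hr] := unif_diff_lower (unif_diff_dot11 D z) ltr01.
    by move=> i _; rewrite QQ.
  by exists r => // i h Di /(Hr i h Di) q0; rewrite retrTS_dot2.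
move=> Y i [tY tY2] Di /=; rewrite QQ QP (dotvC Y.1) tY.
rewrite (dotvC Y.1) tY2; by field.
Qed.

Lemma diffTS_dot22 D z : TS z ->
  diffTS D (fun x _ => dotv x.2 x.2) z (fun h _ => 2 * dotv z.2 h.2).
Proof.
move=> Tz; have [QQ QP] := Tz.
have q1 : exists2 m : R, 0 < m & forall i, D i -> m <= dotv z.1 z.1.
  by exists 1 => // i _; rewrite QQ.
eexists.
  apply: unif_diff_near (unif_diff_sub (unif_diff_dot22 D z)
    (unif_diff_mul (unif_diff_mul (unif_diff_inv (unif_diff_dot11 D z) q1) (unif_diff_dot12 D z))
       (unif_diff_dot12 D z))) _.
  have [|r r0 Hr] := unif_diff_lower (unif_diff_dot11 D z) ltr01.
    by move=> i _; rewrite QQ.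
  by exists r => // i h Di /(Hr i h Di) q0; rewrite retrTS_dot22.
move=> Y i [tY tY2] Di /=; rewrite QQ QP (dotvC Y.1) tY (dotvC Y.2); by field.
Qed.

End DiffTS.

(** * Hamiltonian fields *)

Section Poisson.
Context {R : realType} {d : nat}.
Local Notation V := (phase R d).
Implicit Types (z X Y : V) (F G : V -> R).

Lemma diffTS_dTS F z (A : V -> R) : TS z ->
  diffTS setT (fun x (_ : unit) => F x) z (fun h _ => A h) ->
  differentiableTS F z /\ forall Y, TTS z Y -> dTS F z Y = A Y.
Proof.
move=> Tz [B uF AE].
have uF' : unif_diff setT (fun x (_ : unit) => (F \o retrTS) x) z (fun h _ => B h tt).
  by apply: unif_diff_ext uF _ _ => // h [].
have [dF dE] := unif_diff_differentiable uF'.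
by split=> // Y tY; rewrite /dTS dE (AE Y tt).
Qed.

(** (W, - U) is the Hamiltonian vector for the ambient canonical form. It is made tangent by
    multiples of (Q, - Q') and (0, Q), which come from the constraints Q.Q' and |Q|^2 and have zero
    [omegaS] with all of [TTS z]. *)
Definition ham_vec z (U W : 'rV[R]_d.+1) : V :=
  (W - dotv z.1 W *: z.1,
   - U + (dotv z.1 U - dotv z.2 W) *: z.1 + dotv z.1 W *: z.2).

Lemma ham_vec_TTS z U W : TS z -> TTS z (ham_vec z U W).
Proof.
by move=> [QQ QP]; split; rewrite /= !dotvE ?(dotvC z.2 z.1) ?QQ ?QP; ring.
Qed.

Lemma omegaS_nondegenerate z X : TS z -> TTS z X ->
  (forall Y, TTS z Y -> omegaS X Y = 0) -> X = 0.
Proof.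
case: z X => Q P [X1 X2] [/= QQ QP] [/= t1 t2] H.
have E1 : X1 = 0.
  apply: dotv_eq0; have := H (0, X1); rewrite /omegaS /= (dotvC X2) dotv0l subr0.
  by apply; split; rewrite /= ?(dotvC _ 0) dotv0l ?add0r.
rewrite {}E1 (dotvC P) dotv0l add0r in t1 t2 H *.
have E2 : X2 = 0.
  apply: dotv_eq0; apply/eqP; rewrite -oppr_eq0; apply/eqP.
  (* The multiple of Q restores the second equation of [TTS] and does not change [omegaS], as X1 =
     0. *)
  have := H (X2, - dotv P X2 *: Q); rewrite /omegaS /= dotv0l sub0r; apply.
  by split; rewrite /= ?dotvE // QQ; ring.
by rewrite E2.
Qed.

Lemma hamiltonian_vector_unique F z X X' : TS z ->
  is_hamiltonian_vector F z X -> is_hamiltonian_vector F z X' -> X = X'.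
Proof.
move=> Tz [[t1 t2] H] [[t1' t2'] H']; apply/subr0_eq.
apply: (omegaS_nondegenerate Tz).
  split; first by rewrite dotvBr t1 t1' subrr.
  by rewrite !dotvBr addrACA -opprD t2 t2' subrr.
by move=> Y tY; have := H Y tY; rewrite -(H' Y tY) /omegaS !dotvE; lra.
Qed.

(** By uniqueness [get] returns this vector. Any ambient gradients that represent the differential
    on [TTS z] will do; they need not be tangent. *)
Lemma hamiltonian_fieldE F z U W : TS z ->
  (forall Y, TTS z Y -> dTS F z Y = dotv U Y.1 + dotv W Y.2) ->
  hamiltonian_field F z = ham_vec z U W.
Proof.
move=> Tz dF; have [QQ QP] := Tz.
have Hh : is_hamiltonian_vector F z (ham_vec z U W).
  split=> [|Y tY]; first exact: ham_vec_TTS.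
  have [t1 t2] := tY; rewrite dF// /omegaS /= !dotvE t1.
  rewrite (_ : dotv z.2 Y.1 = - dotv z.1 Y.2); first ring.
  by apply/eqP; rewrite -subr_eq0 opprK t2.
apply: (@hamiltonian_vector_unique F z) => //.
exact: (@getPex _ (fun X => is_hamiltonian_vector F z X)) (ex_intro _ _ Hh).
Qed.

End Poisson.

(** * Reduced coordinates *)

Section Reduced.
Context {R : realType} {d : nat} (Z Y : 'rV[R]_d.+1) (mu k0 h : R).
Implicit Types x z : phase R d.

(* With theta the angle between Q and Z: [cs] = sin theta, and [cL] is the angular
   momentum about Z. At polar angle t from the current point, in the plane of the
   orbit, cot theta is kappa + (u0 - kappa) cos t + u1 sin t, and b1 cos t + b2 sin t
   is the Y-component of the unit vector along the projection of Q to the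
   orthogonal of Z. *)
Definition cw x := dotv x.1 Z.
Definition cv x := dotv x.2 Z.
Definition cy x := dotv x.1 Y.
Definition cp x := dotv x.2 Y.
Definition ck x := dotv x.2 x.2.
Definition cs x := Num.sqrt (1 - cw x ^+ 2).
Definition cL2 x := ck x * (1 - cw x ^+ 2) - cv x ^+ 2.
Definition cL x := Num.sqrt (cL2 x).
Definition kappa x := mu / cL2 x.
Definition u0 x := cw x / cs x.
Definition u1 x := cv x / (cs x * cL x).
Definition b1 x := cy x / cs x.
Definition b2 x := (cs x * cp x + cw x * cv x * cy x / cs x) / cL x.

(* E_sKep and D on T S^d, with [(k0, h)] the coordinates of the other center in
   the basis [(Z, Y)]. *)
Definition Ered x := 2^-1 * ck x - mu * (cw x / cs x).

Definition Dred x :=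
  cL2 x - (1 - k0) * ((1 - cw x ^+ 2) * cp x ^+ 2 + 2 * cw x * cv x * cy x * cp x
                      + (ck x - cv x ^+ 2) * cy x ^+ 2)
  - h * (cv x * cp x + ck x * cw x * cy x - mu * (cy x / cs x)).

(* Ambient gradients in Q ([EU], [DU]) and in Q' ([DW]). *)
Definition EU z := (- mu / cs z ^+ 3) *: Z.

Definition DU z : 'rV[R]_d.+1 :=
  (- 2 * ck z * cw z
   - (1 - k0) * (- 2 * cw z * cp z ^+ 2 + 2 * cv z * cy z * cp z)
   - h * (ck z * cy z - mu * cy z * cw z / cs z ^+ 3)) *: Z
  + (- (1 - k0) * (2 * cw z * cv z * cp z + 2 * (ck z - cv z ^+ 2) * cy z)
     - h * (ck z * cw z - mu / cs z)) *: Y.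

Definition DW z : 'rV[R]_d.+1 :=
  (- 2 * cv z - (1 - k0) * (2 * cw z * cy z * cp z - 2 * cv z * cy z ^+ 2)
   - h * cp z) *: Z
  + (- (1 - k0) * (2 * (1 - cw z ^+ 2) * cp z + 2 * cw z * cv z * cy z)
     - h * cv z) *: Y
  + (2 * ((1 - cw z ^+ 2) - (1 - k0) * cy z ^+ 2 - h * (cw z * cy z))) *: z.2.

Section At.
Context {I : Type} (D : set I) (z : phase R d).
Context (Tz : TS z).
Context (w1 : cw z ^+ 2 < 1).

Local Notation "F ~> A" := (diffTS D (fun x _ => F x) z (fun g _ => A g))
  (at level 70, A at level 69).

Let dw : cw ~> (fun g => dotv g.1 Z). Proof. exact: diffTS_dot1. Qed.
Let dv : cv ~> (fun g => dotv g.2 Z). Proof. exact: diffTS_dot2. Qed.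
Let dy : cy ~> (fun g => dotv g.1 Y). Proof. exact: diffTS_dot1. Qed.
Let dp : cp ~> (fun g => dotv g.2 Y). Proof. exact: diffTS_dot2. Qed.
Let dk : ck ~> (fun g => 2 * dotv z.2 g.2). Proof. exact: diffTS_dot22. Qed.

Lemma cs_gt0 : 0 < cs z.
Proof. by rewrite sqrtr_gt0 subr_gt0. Qed.

Lemma cs_sqr : cs z ^+ 2 = 1 - cw z ^+ 2.
Proof. by rewrite sqr_sqrtr// subr_ge0 ltW. Qed.

Let dw2 : (fun x => 1 - cw x ^+ 2) ~> (fun g => - 2 * cw z * dotv g.1 Z).
Proof.
apply: diffTS_ext (diffTS_sub (diffTS_const D 1 z) (diffTS_mul Tz dw dw)) _ _.
  by move=> x i; rewrite expr2.
by move=> g i _ _; ring.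
Qed.

Let ds : cs ~> (fun g => - cw z * dotv g.1 Z / cs z).
Proof.
apply: diffTS_ext (diffTS_sqrt Tz dw2 _) _ _.
- by exists (1 - cw z ^+ 2) => //; rewrite subr_gt0.
- by [].
- by move=> g i _ _; rewrite -/(cs z); field; rewrite gt_eqF ?cs_gt0.
Qed.

Lemma diffTS_csV : (fun x => (cs x)^-1) ~> (fun g => cw z * dotv g.1 Z / cs z ^+ 3).
Proof.
apply: diffTS_ext (diffTS_inv Tz ds _) _ _.
- by exists (cs z) => //; rewrite cs_gt0.
- by [].
- by move=> g i _ _; field; rewrite gt_eqF ?cs_gt0.
Qed.

Lemma diffTS_u0 : u0 ~> (fun g => dotv g.1 Z / cs z ^+ 3).
Proof.
apply: diffTS_ext (diffTS_mul Tz dw diffTS_csV) _ _ => // g i _ _.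
rewrite (_ : dotv g.1 Z / cs z ^+ 3 =
  dotv g.1 Z * (cs z ^+ 2 + cw z ^+ 2) / cs z ^+ 3); last first.
  by rewrite cs_sqr subrK mulr1.
by field; rewrite gt_eqF ?cs_gt0.
Qed.

Lemma diffTS_b1 : b1 ~> (fun g => dotv g.1 Y / cs z
  + cy z * cw z * dotv g.1 Z / cs z ^+ 3).
Proof.
apply: diffTS_ext (diffTS_mul Tz dy diffTS_csV) _ _ => // g i _ _.
by field; rewrite gt_eqF ?cs_gt0.
Qed.

Let dvv : (fun x => cv x ^+ 2) ~> (fun g => 2 * cv z * dotv g.2 Z).
Proof.
by apply: diffTS_ext (diffTS_mul Tz dv dv) _ _ => [x i|g i _ _]; ring.
Qed.

Lemma diffTS_cL2 : cL2 ~> (fun g => 2 * dotv z.2 g.2 * (1 - cw z ^+ 2)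
  - 2 * ck z * cw z * dotv g.1 Z - 2 * cv z * dotv g.2 Z).
Proof.
apply: diffTS_ext (diffTS_sub (diffTS_mul Tz dk dw2) dvv) _ _ => // g i _ _.
ring.
Qed.

Lemma diffTS_Ered : Ered ~> (fun g => dotv (EU z) g.1 + dotv z.2 g.2).
Proof.
apply: diffTS_ext (diffTS_sub (diffTS_scale 2^-1 dk) (diffTS_scale mu diffTS_u0)) _ _.
  by [].
by move=> g i _ _; rewrite /EU dotvZl (dotvC Z); field; rewrite gt_eqF ?cs_gt0.
Qed.

Lemma diffTS_Dred : Dred ~> (fun g => dotv (DU z) g.1 + dotv (DW z) g.2).
Proof.
have dyy := diffTS_mul Tz dy dy; have dpp := diffTS_mul Tz dp dp.
have dA := diffTS_add (diffTS_add (diffTS_mul Tz dw2 dpp)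
  (diffTS_scale 2 (diffTS_mul Tz (diffTS_mul Tz (diffTS_mul Tz dw dv) dy) dp)))
  (diffTS_mul Tz (diffTS_sub dk dvv) dyy).
have dB := diffTS_sub (diffTS_add (diffTS_mul Tz dv dp)
  (diffTS_mul Tz (diffTS_mul Tz dk dw) dy)) (diffTS_scale mu diffTS_b1).
apply: diffTS_ext (diffTS_sub (diffTS_sub diffTS_cL2 (diffTS_scale (1 - k0) dA))
  (diffTS_scale h dB)) _ _.
  by move=> x i; rewrite /Dred /b1; ring.
move=> g i _ _; rewrite /DU /DW !dotvE !(dotvC Z) !(dotvC Y).
by field; rewrite gt_eqF ?cs_gt0.
Qed.

Context (L0 : 0 < cL2 z).

Lemma cL_gt0 : 0 < cL z. Proof. by rewrite sqrtr_gt0. Qed.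

Lemma cL_sqr : cL z ^+ 2 = cL2 z. Proof. by rewrite sqr_sqrtr// ltW. Qed.

Lemma diffTS_kappa : kappa ~> (fun g => - mu / cL z ^+ 4 *
  (2 * dotv z.2 g.2 * (1 - cw z ^+ 2)
  - 2 * ck z * cw z * dotv g.1 Z - 2 * cv z * dotv g.2 Z)).
Proof.
apply: diffTS_ext (diffTS_scale mu (diffTS_inv Tz diffTS_cL2 _)) _ _ => //.
  by exists (cL2 z).
by move=> g i _ _; rewrite -cL_sqr; field; rewrite gt_eqF ?cL_gt0.
Qed.

Let dLV : (fun x => (cL x)^-1) ~> (fun g => - (2 * cL z ^+ 3)^-1 *
  (2 * dotv z.2 g.2 * (1 - cw z ^+ 2)
  - 2 * ck z * cw z * dotv g.1 Z - 2 * cv z * dotv g.2 Z)).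
Proof.
apply: diffTS_ext (diffTS_inv Tz (diffTS_sqrt Tz diffTS_cL2 _) _) _ _ => //.
- by exists (cL2 z).
- by exists (cL z) => //; rewrite cL_gt0.
by move=> g i _ _; rewrite -/(cL z); field; rewrite gt_eqF ?cL_gt0.
Qed.

Lemma diffTS_u1 : u1 ~> (fun g => dotv g.2 Z / (cs z * cL z)
  + cv z * cw z * dotv g.1 Z / (cs z ^+ 3 * cL z)
  - cv z / (2 * cs z * cL z ^+ 3) * (2 * dotv z.2 g.2 * (1 - cw z ^+ 2)
  - 2 * ck z * cw z * dotv g.1 Z - 2 * cv z * dotv g.2 Z)).
Proof.
apply: diffTS_ext (diffTS_mul Tz (diffTS_mul Tz dv diffTS_csV) dLV) _ _.
  by move=> x i; rewrite /u1 invfM mulrA.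
by move=> g i _ _; field; rewrite !gt_eqF ?cL_gt0 ?cs_gt0.
Qed.

Lemma diffTS_b2 : b2 ~> (fun g => ((- cw z * dotv g.1 Z / cs z) * cp z
  + cs z * dotv g.2 Y
  + (dotv g.1 Z * cv z * cy z + cw z * dotv g.2 Z * cy z
     + cw z * cv z * dotv g.1 Y) / cs z
  + cw z * cv z * cy z * cw z * dotv g.1 Z / cs z ^+ 3) / cL z
  - (cs z * cp z + cw z * cv z * cy z / cs z) / (2 * cL z ^+ 3)
   * (2 * dotv z.2 g.2 * (1 - cw z ^+ 2)
  - 2 * ck z * cw z * dotv g.1 Z - 2 * cv z * dotv g.2 Z)).
Proof.
apply: diffTS_ext (diffTS_mul Tz (diffTS_add (diffTS_mul Tz ds dp)
  (diffTS_mul Tz (diffTS_mul Tz (diffTS_mul Tz dw dv) dy) diffTS_csV)) dLV) _ _ => //.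
by move=> g i _ _; field; rewrite !gt_eqF ?cL_gt0 ?cs_gt0.
Qed.

End At.
End Reduced.

(** * Derivatives of the reduced coordinates along the Hamiltonian field of D *)

Section Brackets.
Context {R : realType} {d : nat} (Z Y : 'rV[R]_d.+1) (mu k0 h : R).
Implicit Types x z : phase R d.
Context (ZZ : dotv Z Z = 1) (YY : dotv Y Y = 1) (ZY : dotv Z Y = 0).

Local Notation XD z := (ham_vec z (DU Z Y mu k0 h z) (DW Z Y k0 h z)).
Local Notation cw := (cw Z).
Local Notation cv := (cv Z).
Local Notation cy := (cy Y).
Local Notation cp := (cp Y).
Local Notation cs := (cs Z).
Local Notation cL := (cL Z).
Local Notation cL2 := (cL2 Z).
Local Notation kap := (kappa Z mu).
Local Notation u0 := (u0 Z).
Local Notation u1 := (u1 Z).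
Local Notation b1 := (b1 Z Y).
Local Notation b2 := (b2 Z Y).

(* This parametrization turns identities modulo s^2 + w^2 = 1 into identities of
   rational functions, which [field] decides. *)
Lemma rational_circle (s w : R) : 0 < s -> s ^+ 2 = 1 - w ^+ 2 ->
  exists2 t, 0 < t & s = 2 * t / (1 + t ^+ 2) /\ w = (1 - t ^+ 2) / (1 + t ^+ 2).
Proof.
move=> s0 sw; have w1 : 0 < 1 + w.
  have : 0 < s ^+ 2 by rewrite exprn_gt0.
  rewrite sw ltNge => w2; rewrite ltNge; apply: contra w2 => w2.
  nra.
exists (s / (1 + w)); first by rewrite divr_gt0.
have E : 1 + (s / (1 + w)) ^+ 2 = 2 / (1 + w).
  by rewrite exprMn sw; field; rewrite gt_eqF.
by rewrite E; split; [field|rewrite exprMn sw; field]; rewrite gt_eqF.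
Qed.

Section At.
Context (z : phase R d) (Tz : TS z) (w1 : cw z ^+ 2 < 1) (L0 : 0 < cL2 z).

Let dot_EZ (al be ga : R) : dotv (al *: Z + be *: Y + ga *: z.2) Z = al + ga * cv z.
Proof. by rewrite !dotvE ZZ (dotvC Y) ZY -/(cv z); ring. Qed.

Let dot_EY (al be ga : R) : dotv (al *: Z + be *: Y + ga *: z.2) Y = be + ga * cp z.
Proof. by rewrite !dotvE YY ZY -/(cp z); ring. Qed.

Let dot_UZ (al be : R) : dotv (al *: Z + be *: Y) Z = al.
Proof. by rewrite !dotvE ZZ (dotvC Y) ZY; ring. Qed.

Let dot_UY (al be : R) : dotv (al *: Z + be *: Y) Y = be.
Proof. by rewrite !dotvE YY ZY; ring. Qed.

Let dot_QE (al be ga : R) :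
  dotv z.1 (al *: Z + be *: Y + ga *: z.2) = al * cw z + be * cy z.
Proof. by rewrite !dotvE (Tz.2) -/(cw z) -/(cy z); ring. Qed.

Let dot_QU (al be : R) : dotv z.1 (al *: Z + be *: Y) = al * cw z + be * cy z.
Proof. by rewrite !dotvE -/(cw z) -/(cy z); ring. Qed.

Let dot_PE (al be ga : R) :
  dotv z.2 (al *: Z + be *: Y + ga *: z.2) = al * cv z + be * cp z + ga * ck z.
Proof. by rewrite !dotvE. Qed.

Let dot_PU (al be : R) : dotv z.2 (al *: Z + be *: Y) = al * cv z + be * cp z.
Proof. by rewrite !dotvE. Qed.

(** The inverse change of variables. With t parametrizing the point (sin theta, cos theta) of the
    circle, the quantities t, C, kappa, u1, b1 and b2 can be treated as independent variables, and
    the brackets become identities of rational functions. *)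
Lemma reduced_coordinates : exists s C t : R, [/\ [/\ 0 < s, 0 < C & 0 < t],
   [/\ s = 2 * t / (1 + t ^+ 2), u0 z = (1 - t ^+ 2) / (2 * t),
       cs z = s, cL z = C & cL2 z = C ^+ 2],
   [/\ cw z = u0 z * s, cv z = C * s * u1 z, cy z = s * b1 z,
       cp z = C * b2 z / s - C * s * u0 z * u1 z * b1 z &
       ck z = C ^+ 2 * (1 + u0 z ^+ 2 + u1 z ^+ 2)] &
   1 - cw z ^+ 2 = s ^+ 2 /\ mu = kap z * C ^+ 2].
Proof.
have s0 := cs_gt0 w1; have C0 := cL_gt0 L0.
have sE := cs_sqr w1; have CE := cL_sqr L0.
have [t t0 [st wt]] := rational_circle s0 sE.
have t21 : 1 + t ^+ 2 != 0 by rewrite gt_eqF// addr_gt0// exprn_gt0.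
have tn0 : t != 0 by rewrite gt_eqF.
exists (cs z), (cL z), t; split=> //.
- split=> //.
  by rewrite /u0 wt st; field; rewrite t21 tn0.
- split.
  + by rewrite /u0 divfK// gt_eqF.
  + by rewrite /u1; field; rewrite !gt_eqF.
  + by rewrite /b1; field; rewrite !gt_eqF.
  + by rewrite /u1 /u0 /b1 /b2; field; rewrite !gt_eqF.
  + rewrite /u0 /u1.
    have -> : ck z = (cL z ^+ 2 + cv z ^+ 2) / cs z ^+ 2.
      by rewrite CE sE /cL2 subrK mulfK// -sE gt_eqF// exprn_gt0.
    have -> : 1 + (cw z / cs z) ^+ 2 = (cs z ^+ 2)^-1.
      transitivity ((cs z ^+ 2 + cw z ^+ 2) / cs z ^+ 2).
        by field; rewrite gt_eqF.
      by rewrite sE subrK mul1r.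
    by field; rewrite !gt_eqF.
- split; first by rewrite sE.
  by rewrite /kappa CE divfK// gt_eqF.
Qed.

Let Wd := b1 z * u1 z - b2 z * (u0 z - kap z).
Let c0 := (u0 z + kap z) * b1 z.

Let XD1Z : dotv (XD z).1 Z = dotv (DW Z Y k0 h z) Z
  - dotv z.1 (DW Z Y k0 h z) * cw z.
Proof. by rewrite /ham_vec /= dotvBl dotvZl. Qed.

Let XD1Y : dotv (XD z).1 Y = dotv (DW Z Y k0 h z) Y
  - dotv z.1 (DW Z Y k0 h z) * cy z.
Proof. by rewrite /ham_vec /= dotvBl dotvZl. Qed.

Let XD2 w : dotv (XD z).2 w = - dotv (DU Z Y mu k0 h z) w
  + (dotv z.1 (DU Z Y mu k0 h z) - dotv z.2 (DW Z Y k0 h z)) * dotv z.1 w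
  + dotv z.1 (DW Z Y k0 h z) * dotv z.2 w.
Proof. by rewrite /ham_vec /= 2!dotvDl dotvNl 2!dotvZl. Qed.

Let XD2P : dotv z.2 (XD z).2 = - dotv z.2 (DU Z Y mu k0 h z)
  + dotv z.1 (DW Z Y k0 h z) * ck z.
Proof. by rewrite dotvC XD2 (Tz.2) mulr0 addr0 (dotvC z.2). Qed.

(** The first equation is {E_sKep, D} = 0. In the others the left-hand sides have the shape of the
    derivatives in [diffTS_cL2], [diffTS_u1], [diffTS_b1] and [diffTS_b2], taken at the field of D.
    [Wd] is a Wronskian of the tilt and of the cotangent minus kappa, constant along each Kepler
    orbit. *)
Lemma XD_brackets :
  let L2' := 2 * dotv z.2 (XD z).2 * (1 - cw z ^+ 2)
    - 2 * ck z * cw z * dotv (XD z).1 Z - 2 * cv z * dotv (XD z).2 Z in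
  (- mu / cs z ^+ 3 * dotv (XD z).1 Z + dotv z.2 (XD z).2 = 0) /\
  [/\ dotv (XD z).1 Z = - h * cL z * b2 z * cs z,
    L2' = - 2 * h * cL z ^+ 3 * Wd,
    dotv (XD z).2 Z / (cs z * cL z)
      + cv z * cw z * dotv (XD z).1 Z / (cs z ^+ 3 * cL z)
      - cv z / (2 * cs z * cL z ^+ 3) * L2'
    = h * cL z * ((1 + kap z ^+ 2) * b1 z + Wd * u1 z + c0 * (u0 z - kap z)),
    dotv (XD z).1 Y / cs z + cy z * cw z * dotv (XD z).1 Z / cs z ^+ 3
    = - h * cL z * (u1 z - b1 z * Wd + c0 * b2 z) + 2 * cL z * k0 * b2 z &
    ((- cw z * dotv (XD z).1 Z / cs z) * cp z
      + cs z * dotv (XD z).2 Y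
      + (dotv (XD z).1 Z * cv z * cy z + cw z * dotv (XD z).2 Z * cy z
         + cw z * cv z * dotv (XD z).1 Y) / cs z
      + cw z * cv z * cy z * cw z * dotv (XD z).1 Z / cs z ^+ 3) / cL z
      - (cs z * cp z + cw z * cv z * cy z / cs z) / (2 * cL z ^+ 3) * L2'
    = h * cL z * (u0 z - kap z + b2 z * Wd + c0 * b1 z) - 2 * cL z * k0 * b1 z].
Proof.
have [s [C [t [[s0 C0 t0] [st ut csE cLE CE] [wE vE yE pE kE] [w2E muE]]]]] :=
  reduced_coordinates.
have t21 : 1 + t ^+ 2 != 0 by rewrite gt_eqF// addr_gt0// exprn_gt0.
have tn0 : t != 0 by rewrite gt_eqF.
have Cn0 : C != 0 by rewrite gt_eqF.
rewrite /= /Wd /c0 XD1Z XD1Y XD2P !XD2 /DU /DW.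
rewrite !(dot_EZ, dot_EY, dot_UZ, dot_UY, dot_QE, dot_QU, dot_PE, dot_PU).
rewrite -!/(cw z) -!/(cy z) -!/(cv z) -!/(cp z) csE cLE.
move: (kap z) muE => K ->.
rewrite !(wE, vE, yE, pE, kE).
move: (u0 z) ut => U0 ->.
move: (u1 z) (b1 z) (b2 z) => U1 B1 B2; rewrite st.
by split; [|split]; field; rewrite ?t21 ?tn0 ?Cn0.
Qed.

End At.
End Brackets.

(** * Integrals over a turn *)

Section Primitive.
Context {R : realType}.
Implicit Types (f F G : R -> R) (a b x : R).
Notation mu := (@lebesgue_measure R).

Definition primitive f F := forall x, is_derive x (1 : R) F (f x).

Lemma primitive_continuous f F : primitive f F -> continuous F.
Proof.
move=> dF x; apply: differentiable_continuous; apply/derivable1_diffP.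
by have [] := dF x.
Qed.

Lemma primitive_unique f F G a b : primitive f F -> primitive f G ->
  F b - F a = G b - G a.
Proof.
move=> dF dG.
have d0 x : is_derive x (1 : R) (F - G) 0.
  by rewrite -(subrr (f x)); apply: is_deriveB.
have : F a - G a = F b - G b by exact: (is_derive_0_is_cst a b d0).
lra.
Qed.

Lemma primitive_D f g F G : primitive f F -> primitive g G ->
  primitive (fun x => f x + g x) (fun x => F x + G x).
Proof. by move=> dF dG x; apply: is_deriveD. Qed.

Lemma primitive_Z f F c : primitive f F ->
  primitive (fun x => c * f x) (fun x => c * F x).
Proof. by move=> dF x; apply: is_deriveZ. Qed.

Lemma Rintegral_primitive f F b : continuous f -> primitive f F -> 0 < b ->
  \int[mu]_(t in `[0, b]) f t = F b - F 0.
Proof.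
move=> cf dF b0; rewrite /Rintegral (@continuous_FTC2 _ f F) //.
- exact: continuous_subspaceT.
- split=> [x _| |]; first by have [] := dF x.
  + exact/cvg_at_right_filter/(primitive_continuous dF).
  + exact/cvg_at_left_filter/(primitive_continuous dF).
- by move=> x _; rewrite derive1E; have [] := dF x.
Qed.

Lemma primitive_right f a : continuous f ->
  exists F, forall x, a < x -> is_derive x (1 : R) F (f x).
Proof.
move=> cf; exists (fun x => \int[mu]_(t in `[a, x]) f t) => x ax.
have x1 : x < x + 1 by rewrite ltrDl.
have fi : mu.-integrable `[a, x + 1] (EFin \o f).
  apply: continuous_compact_integrable; first exact: segment_compact.
  exact: continuous_subspaceT.
have [dF F'] := continuous_FTC1_closed x1 fi ax (cf x).
by apply: (DeriveDef dF); rewrite -derive1E.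
Qed.

(** [primitive_right] works only to the right of a base point. The increments do not depend on the
    base point, so it may move with x, as - |x| - 1, and the whole line is covered. *)
Lemma ex_primitive f : continuous f -> exists2 F, F 0 = 0 & primitive f F.
Proof.
move=> cf.
have [F dF] : exists F : R -> R -> R, forall a x, a < x ->
    is_derive x (1 : R) (F a) (f x).
  by have /choice[F HF] := fun a => primitive_right a cf; exists F.
have FE a b c x : a < b -> b < c -> b < x -> F a x - F a c = F b x - F b c.
  move=> ab bc bx.
  wlog cx : c x bc bx / c <= x.
    move=> H; have [cx|/ltW xc] := leP c x; first exact: H.
    have := H x c bx bc xc; lra.
  have d0 y : y \in `]c, x[%R -> is_derive y (1 : R) (F a - F b) ((fun=> 0) y).
    move=> /itvP yc; rewrite -(subrr (f y)).
    have cy : c < y by rewrite yc.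
    by apply: is_deriveB; apply: dF; rewrite (lt_trans _ cy)// (lt_trans ab).
  have [|e _] := MVT_segment cx d0.
    apply: continuous_in_subspaceT => y /set_mem /= /itvP yc.
    have by_ : b < y by rewrite (lt_le_trans bc)// yc.
    have ay : a < y by exact: lt_trans by_.
    by apply: continuousB; apply/differentiable_continuous/derivable1_diffP;
      apply: ex_derive; apply: dF.
  rewrite mul0r => E; have : F a x - F b x - (F a c - F b c) = 0 by [].
  lra.
pose G x := F (- `|x| - 1) x - F (- `|x| - 1) 0.
exists G; first by rewrite /G subrr.
(* A common base point: it lies to the left of - |y| - 1 for every y at distance less than 1 from
   x. *)
move=> x; pose a := - `|x| - 3.
have ax : a < x.
  by rewrite /a; have := ler_norm (- x); rewrite normrN; lra.
apply: (@near_eq_is_derive _ _ _ (fun y => F a y - F a 0)); last first.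
  apply: is_derive_eq; first exact: (is_deriveB (dF a x ax) (is_derive_cst _ _ _)).
  by rewrite subr0.
near=> y.
have yx : `|y - x| < 1.
  by near: y; apply/nbhs_ballP; exists 1 => //= y; rewrite /ball/= distrC.
have y2 : `|y| < `|x| + 1.
  by rewrite -(subrK x y) (le_lt_trans (ler_normD _ _))// addrC ltrD2l.
have yN : - `|y| - 1 < y by have := ler_norm (- y); rewrite normrN; lra.
have y0 : - `|y| - 1 < 0 by have := normr_ge0 y; lra.
by rewrite /G; apply: FE => //; rewrite /a; lra.
Unshelve. all: by end_near. Qed.

(* Unspecified if [f] has no primitive. *)
Definition prim f : R -> R := get [set F | F 0 = 0 /\ primitive f F].

Lemma prim_primitive f F : primitive f F -> prim f 0 = 0 /\ primitive f (prim f).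
Proof.
move=> dF; apply: (@getPex _ [set F | F 0 = 0 /\ primitive f F]).
exists (fun x => F x - F 0); split=> [|x]; first by rewrite /= subrr.
by rewrite -[f x]subr0; apply: is_deriveB.
Qed.

Lemma primP f : continuous f -> prim f 0 = 0 /\ primitive f (prim f).
Proof. by move=> /ex_primitive[F _ /prim_primitive]. Qed.

(** The integral over a turn is encoded by a primitive: linearity and the vanishing of total
    derivatives then come from the uniqueness of primitives, and bounds from the mean value
    theorem. *)
Definition circle_int f := prim f (pi *+ 2).

Lemma pi2_gt0 : 0 < pi *+ 2 :> R. Proof. by rewrite mulrn_wgt0 ?pi_gt0. Qed.

Lemma circle_intE f F : primitive f F -> circle_int f = F (pi *+ 2) - F 0.
Proof.
move=> dF; have [p0 dp] := prim_primitive dF.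
by rewrite -(primitive_unique 0 (pi *+ 2) dp dF) p0 subr0.
Qed.

Lemma circle_intD f g : continuous f -> continuous g ->
  circle_int (fun x => f x + g x) = circle_int f + circle_int g.
Proof.
move=> cf cg; have [f0 df] := primP cf; have [g0 dg] := primP cg.
by rewrite (circle_intE (primitive_D df dg)) f0 g0 addr0 subr0.
Qed.

Lemma circle_intZ c f : continuous f ->
  circle_int (fun x => c * f x) = c * circle_int f.
Proof.
move=> cf; have [f0 df] := primP cf.
by rewrite (circle_intE (primitive_Z c df)) f0 mulr0 subr0.
Qed.

Lemma circle_int_gt0 f : continuous f -> (forall x, 0 < f x) -> 0 < circle_int f.
Proof.
move=> cf fp; have [f0 df] := primP cf.
have [|c _ E] := MVT pi2_gt0 (fun x _ => df x).
  exact/continuous_subspaceT/(primitive_continuous df).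
by rewrite f0 subr0 in E; rewrite /circle_int E subr0 mulr_gt0// pi2_gt0.
Qed.

Lemma circle_int_le f M : continuous f -> (forall x, `|f x| <= M) ->
  `|circle_int f| <= M * pi *+ 2.
Proof.
move=> cf fM; have [f0 df] := primP cf.
have [|c _ E] := MVT pi2_gt0 (fun x _ => df x).
  exact/continuous_subspaceT/(primitive_continuous df).
rewrite f0 subr0 in E; rewrite /circle_int E subr0 normrM -mulrnAr.
by rewrite ler_pM// ger0_norm// ltW// pi2_gt0.
Qed.

Lemma periodic_int f (T : R) : (forall x, f (x + T) = f x) ->
  forall x (n : int), f (x + T *~ n) = f x.
Proof.
move=> fT; have fTn x (n : nat) : f (x + T *+ n) = f x.
  by elim: n => [|n IH]; rewrite ?mulr0n ?addr0// mulrS addrCA addrC fT.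
move=> x [n|n]; first exact: fTn.
by rewrite -(fTn _ n.+1) NegzE mulrNz addrNK.
Qed.

Lemma periodic_lower f (T : R) : 0 < T -> continuous f ->
  (forall x, f (x + T) = f x) -> (forall x, 0 < f x) ->
  exists2 m, 0 < m & forall x, m <= f x.
Proof.
move=> T0 cf fT fp.
have [c _ cmin] := EVT_min (ltW T0) (continuous_subspaceT cf).
exists (f c) => // x; pose n := Num.floor (x / T).
rewrite -(subrK (T *~ n) x) (periodic_int fT); apply: cmin.
have /andP[n1 n2] : n%:~R <= x / T < (n + 1)%:~R by exact/real_floor_itv/num_real.
move: n1 n2; rewrite ler_pdivlMr// ltr_pdivrMr// intrD mulrDl mul1r in_itv /=.
rewrite -(mulrzl T n) => n1 n2; rewrite subr_ge0 n1/= lerBlDl ltW//.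
Qed.

End Primitive.

(** * Differentiation under the integral sign *)

Section IntegralDiff.
Context {R : realType} {V : normedModType R}.
Implicit Types (F A : V -> R -> R) (z h : V).

Lemma continuous_unif_approx (f : R -> R) :
  (forall e, 0 < e -> exists2 g : R -> R, continuous g & forall x, `|f x - g x| <= e) ->
  continuous f.
Proof.
move=> H x; apply/cvgrPdist_le => e e0; have e30 : 0 < e / 3 by rewrite divr_gt0.
have [g cg fg] := H _ e30.
near=> y.
have : `|g x - g y| <= e / 3.
  by near: y; have /cvgrPdist_le := cg x; apply.
rewrite (_ : f x - f y = (f x - g x) + ((g x - g y) - (f y - g y))); last ring.
move=> gxy; have fx := fg x; have fy := fg y.
rewrite (le_trans (ler_normD _ _))//.
have := ler_normB (g x - g y) (f y - g y); lra.
Unshelve. all: by end_near. Qed.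

(** [A h] is a uniform limit of difference quotients of continuous functions. Without its continuity
    [circle_int (A h)] could be unspecified. *)
Lemma unif_diff_continuous F z A : unif_diff setT F z A ->
  (exists2 r, 0 < r & forall h, `|h| < r -> continuous (F (z + h))) ->
  forall h, continuous (A h).
Proof.
move=> [lA _ _ HA] [r r0 cF] h; apply: continuous_unif_approx => e e0.
have A0 x : A 0 x = 0.
  by have := lA x 1 0 0; rewrite scaler0 addr0 mul1r; lra.
have [->|h0] := eqVneq h 0.
  exists (fun=> 0); first by move=> x; exact: cvg_cst.
  by move=> x; rewrite subr0 A0 normr0 ltW.
have hp : 0 < `|h| by rewrite normr_gt0.
have [d d0 Hd] := HA _ (divr_gt0 e0 hp).
pose t := Num.min d r / (2 * `|h|).
have dr0 : 0 < Num.min d r by rewrite lt_min d0.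
have t0 : 0 < t by rewrite divr_gt0 ?mulr_gt0.
have th : `|t *: h| = Num.min d r / 2.
  by rewrite normrZ gtr0_norm// /t; field; rewrite gt_eqF.
have : `|t *: h| < Num.min d r by rewrite th ltr_pdivrMr// ltr_pMr// ltr1n.
rewrite lt_min => /andP[thd thr].
exists (fun x => t^-1 * (F (z + t *: h) x - F z x)).
  move=> x; apply: cvgM; first exact: cvg_cst.
  apply: cvgB; first exact: cF.
  by have := cF 0; rewrite normr0 addr0 => /(_ r0); exact.
move=> x; have := Hd x _ I thd.
have -> : A (t *: h) x = t * A h x.
  by have := lA x t h 0; rewrite A0 !addr0.
rewrite normrZ (gtr0_norm t0) mulrCA divfK ?gt_eqF// => H.
rewrite (_ : _ - _ = - (t^-1 * (F (z + t *: h) x - F z x - t * A h x))); last first.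
  by field; rewrite gt_eqF.
rewrite normrN normrM gtr0_norm ?invr_gt0// mulrC.
by rewrite ler_pdivrMr// [leRHS]mulrC.
Qed.

Lemma unif_diff_circle_int F z A : unif_diff setT F z A ->
  (exists2 r, 0 < r & forall h, `|h| < r -> continuous (F (z + h))) ->
  unif_diff setT (fun x (_ : unit) => circle_int (F x)) z
    (fun h _ => circle_int (A h)).
Proof.
move=> uF cF; have cA := unif_diff_continuous uF cF.
case: uF => lA [M M0 HM] [N N0 HN] HA.
have [r r0 cFr] := cF.
have cz : continuous (F z) by have := cFr 0; rewrite normr0 addr0 => /(_ r0); exact.
have p20 := @pi2_gt0 R.
split=> [_ c h h'| | |].
- rewrite -circle_intZ// -circle_intD//; last first.
    by move=> x; apply: cvgM; [exact: cvg_cst|exact: cA].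
  by congr circle_int; apply/funext => x; rewrite lA.
- exists (M * pi *+ 2); first by rewrite -mulrnAr mulr_gt0.
  by move=> _ _; apply: circle_int_le => // x; exact: HM.
- exists (N * pi *+ 2); first by rewrite -mulrnAr mulr_gt0.
  move=> _ h _; rewrite -mulrnAr mulrAC mulrnAr.
  by apply: circle_int_le => // x; exact: HN.
move=> e e0; have [d d0 Hd] := HA _ (divr_gt0 e0 p20).
exists (Num.min d r); first by rewrite lt_min d0.
move=> _ h _; rewrite lt_min => /andP[hd hr].
have cB : continuous (fun x => F (z + h) x - F z x - A h x).
  move=> x; apply: cvgB; last exact: cA.
  by apply: cvgB; [exact: cFr|exact: cz].
have -> : circle_int (F (z + h)) - circle_int (F z) - circle_int (A h) =
    circle_int (fun x => F (z + h) x - F z x - A h x).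
  rewrite (_ : circle_int (F (z + h)) = circle_int (fun x =>
    (F (z + h) x - F z x - A h x) + (F z x + A h x))); last first.
    by congr circle_int; apply/funext => x; ring.
  have cG : continuous (fun x => F z x + A h x).
    by move=> x; apply: cvgD; [exact: cz|exact: cA].
  by rewrite (circle_intD cB cG) (circle_intD cz (cA h)); ring.
have -> : e * `|h| = (e / (pi *+ 2) * `|h|) * pi *+ 2.
  by rewrite -[RHS]mulrnAr mulrAC divfK// gt_eqF.
by apply: circle_int_le => // x; exact: Hd.
Qed.

End IntegralDiff.

(** * The average in reduced coordinates *)

Section AveragedReduced.
Context {R : realType} {d : nat} (Z Y : 'rV[R]_d.+1) (mu k0 h : R).
Implicit Types x z : phase R d.

(* At polar angle t on the orbit of x, the cotangent of the angle to the center
   k0 Z + h Y is [center_lin / Num.sqrt center_gap], and the time element is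
   [time_density] dt / [cL]. *)
Definition orbit_cot x (t : R) :=
  kappa Z mu x + (u0 Z x - kappa Z mu x) * cos t + u1 Z x * sin t.
Definition orbit_tilt x (t : R) := b1 Z Y x * cos t + b2 Z Y x * sin t.
Definition center_lin x t := k0 * orbit_cot x t + h * orbit_tilt x t.
Definition center_gap x t := 1 + orbit_cot x t ^+ 2 - center_lin x t ^+ 2.
Definition time_density x t := (1 + orbit_cot x t ^+ 2)^-1.
Definition cot_density x t :=
  center_lin x t * (time_density x t / Num.sqrt (center_gap x t)).
Definition avg_red x := circle_int (cot_density x) / circle_int (time_density x).

Definition orbit_cot' x (t : R) := - (u0 Z x - kappa Z mu x) * sin t + u1 Z x * cos t.
Definition orbit_tilt' x (t : R) := - b1 Z Y x * sin t + b2 Z Y x * cos t.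

Lemma is_derive_orbit_cot x t : is_derive t (1 : R) (orbit_cot x) (orbit_cot' x t).
Proof.
have -> : orbit_cot' x t = 0 + (u0 Z x - kappa Z mu x) * (- sin t) + u1 Z x * cos t.
  by rewrite /orbit_cot'; ring.
exact: is_deriveD.
Qed.

Lemma is_derive_orbit_tilt x t : is_derive t (1 : R) (orbit_tilt x) (orbit_tilt' x t).
Proof.
have -> : orbit_tilt' x t = b1 Z Y x * (- sin t) + b2 Z Y x * cos t
  by rewrite /orbit_tilt'; ring.
exact: is_deriveD.
Qed.

Lemma is_derive_center_lin x t : is_derive t (1 : R) (center_lin x)
  (k0 * orbit_cot' x t + h * orbit_tilt' x t).
Proof.
by apply: is_deriveD; apply: is_deriveZ; [exact: is_derive_orbit_cot|exact: is_derive_orbit_tilt].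
Qed.

Lemma is_derive_sqr (f : R -> R) t a : is_derive t (1 : R) f a ->
  is_derive t (1 : R) (fun s => f s ^+ 2) (2 * f t * a).
Proof.
move=> df; have -> : 2 * f t * a = f t * a + f t * a by ring.
by rewrite (_ : (fun s => _) = f * f); [exact: is_deriveM|apply/funext].
Qed.

Lemma is_derive_oneD (f : R -> R) t a : is_derive t (1 : R) f a ->
  is_derive t (1 : R) (fun s => 1 + f s) a.
Proof.
by move=> df; rewrite -[a]add0r; apply: is_deriveD.
Qed.

Lemma is_derive_center_gap x t : is_derive t (1 : R) (center_gap x)
  (2 * orbit_cot x t * orbit_cot' x t
    - 2 * center_lin x t * (k0 * orbit_cot' x t + h * orbit_tilt' x t)).
Proof.
apply: is_deriveB; last by apply: is_derive_sqr; exact: is_derive_center_lin.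
by apply: is_derive_oneD; apply: is_derive_sqr; exact: is_derive_orbit_cot.
Qed.

Lemma is_derive_continuous (f f' : R -> R) :
  (forall t, is_derive t (1 : R) f (f' t)) -> continuous f.
Proof. exact: primitive_continuous. Qed.

Lemma continuous_orbit_cot x : continuous (orbit_cot x).
Proof. exact: is_derive_continuous (is_derive_orbit_cot x). Qed.

Lemma continuous_center_gap x : continuous (center_gap x).
Proof. exact: is_derive_continuous (is_derive_center_gap x). Qed.

Lemma oneDsqr_gt0 (a : R) : 0 < 1 + a ^+ 2.
Proof. by rewrite ltr_pwDl// sqr_ge0. Qed.

Lemma is_derive_time_density x t :
  is_derive t (1 : R) (time_density x)
    (- (1 + orbit_cot x t ^+ 2) ^- 2 * (2 * orbit_cot x t * orbit_cot' x t)).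
Proof.
apply: is_deriveV; first by rewrite gt_eqF ?oneDsqr_gt0.
by apply: is_derive_oneD; apply: is_derive_sqr; exact: is_derive_orbit_cot.
Qed.

Lemma is_derive_sqrt_center_gapV x t : 0 < center_gap x t ->
  is_derive t (1 : R) (fun t => (Num.sqrt (center_gap x t))^-1)
    (- (2 * Num.sqrt (center_gap x t) ^+ 3)^-1
     * (2 * orbit_cot x t * orbit_cot' x t
    - 2 * center_lin x t * (k0 * orbit_cot' x t + h * orbit_tilt' x t))).
Proof.
move=> S0; have s0 : Num.sqrt (center_gap x t) != 0 by rewrite gt_eqF ?sqrtr_gt0.
have ds : is_derive t (1 : R) (Num.sqrt \o center_gap x) ((2 * Num.sqrt (center_gap x t))^-1 *
    (2 * orbit_cot x t * orbit_cot' x t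
    - 2 * center_lin x t * (k0 * orbit_cot' x t + h * orbit_tilt' x t))).
  by apply: is_derive1_comp; [exact: is_derive1_sqrt|exact: is_derive_center_gap].
have dV := @is_deriveV R (Num.sqrt \o center_gap x) t _ 1 s0 ds.
rewrite (_ : - _ * _ = - ((Num.sqrt \o center_gap x) t) ^- 2 *: ((2 * Num.sqrt (center_gap x t))^-1 *
    (2 * orbit_cot x t * orbit_cot' x t
    - 2 * center_lin x t * (k0 * orbit_cot' x t + h * orbit_tilt' x t)))); last first.
  by rewrite /= /GRing.scale /=; field.
exact: dV.
Qed.

Lemma continuous_time_density x : continuous (time_density x).
Proof. exact: is_derive_continuous (is_derive_time_density x). Qed.

Lemma continuous_cot_density x : (forall t, 0 < center_gap x t) -> continuous (cot_density x).
Proof.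
move=> S0 t; apply: cvgM; first exact: is_derive_continuous (is_derive_center_lin x) t.
apply: cvgM; first exact: continuous_time_density.
exact: (is_derive_continuous (fun t => is_derive_sqrt_center_gapV (S0 t))).
Qed.

Section At.
Context (z : phase R d) (Tz : TS z) (w1 : cw Z z ^+ 2 < 1) (L0 : 0 < cL2 Z z).
Context (S0 : forall t, 0 < center_gap z t).

Lemma diffTS_trig (F : phase R d -> R) (A : phase R d -> R) (T : R -> R) :
  T = cos \/ T = sin ->
  diffTS setT (fun x (_ : R) => F x) z (fun g _ => A g) ->
  diffTS setT (fun x t => F x * T t) z (fun g t => A g * T t).
Proof.
move=> HT dF; have bT : exists M, forall t : R, setT t -> `|T t| <= M.
  by exists 1 => t _; case: HT => ->; rewrite (cos_max, sin_max).
apply: diffTS_ext (diffTS_mul Tz dF (diffTS_cst z bT)) _ _ => //.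
by move=> g t _ _; rewrite mulr0 addr0.
Qed.

Lemma diffTS_circle_int (F A : phase R d -> R -> R) : diffTS setT F z A ->
  (exists2 r, 0 < r & forall g, `|g| < r -> continuous (F (retrTS (z + g)))) ->
  diffTS setT (fun x (_ : unit) => circle_int (F x)) z
    (fun g _ => circle_int (A g)).
Proof.
move=> [B uF BA] cF; exists (fun g _ => circle_int (B g)).
  exact: (unif_diff_circle_int uF).
move=> X _ tX _; congr circle_int; apply/funext => t; exact: BA.
Qed.

Context (ZZ : dotv Z Z = 1) (YY : dotv Y Y = 1) (ZY : dotv Z Y = 0).
Context (h0 : h < 0) (kh : k0 ^+ 2 + h ^+ 2 = 1).

Let X := ham_vec z (DU Z Y mu k0 h z) (DW Z Y k0 h z).
Let C := cL Z z.
Let K := kappa Z mu z.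
Let W := b1 Z Y z * u1 Z z - b2 Z Y z * (u0 Z z - K).
(** The constant that makes [time_flux] vanish at t = 0: the polar angle is counted from the current
    point, so it is not displaced at time 0. *)
Let c0 := (u0 Z z + K) * b1 Z Y z.
Let C0 : 0 < C. Proof. exact: cL_gt0. Qed.
Let muE : mu = K * C ^+ 2.
Proof. by rewrite /K /kappa /C cL_sqr// divfK// gt_eqF. Qed.

(* The derivatives of [orbit_cot] and [orbit_tilt] in the direction [X] at fixed
   polar angle. *)
Definition d_cot t := - h * C * ((1 + K ^+ 2) * orbit_tilt' z t
  - W * (orbit_cot z t + K) + c0 * orbit_cot' z t).
Definition d_tilt t := - h * C * (orbit_cot' z t - W * orbit_tilt z t + c0 * orbit_tilt' z t)
  + 2 * C * k0 * orbit_tilt' z t.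

Lemma diffTS_orbit_cot : exists2 A, diffTS setT orbit_cot z A & forall t, A X t = d_cot t.
Proof.
have [_ [dw dL2 du1 _ _]] := XD_brackets mu k0 h ZZ YY ZY Tz w1 L0.
have dK := diffTS_kappa mu [set: R] Tz L0.
have dF := diffTS_sub (diffTS_u0 [set: R] Tz w1) dK.
eexists.
  exact: diffTS_add (diffTS_add dK (diffTS_trig (or_introl erefl) dF))
    (diffTS_trig (or_intror erefl) (diffTS_u1 [set: R] Tz w1 L0)).
move=> t /=; rewrite -/X in dw dL2 du1 *; rewrite dL2 in du1 *; rewrite du1 dw.
rewrite -/C -/K muE.
have s0 := cs_gt0 w1; have s2 := cs_sqr w1.
have -> : - h * C * b2 Z Y z * cs Z z / cs Z z ^+ 3 =
    - h * C * b2 Z Y z * (1 + u0 Z z ^+ 2).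
  transitivity (- h * C * b2 Z Y z * (cs Z z ^+ 2 + cw Z z ^+ 2) / cs Z z ^+ 2).
    by rewrite (_ : cs Z z ^+ 2 + _ = 1); [field; rewrite gt_eqF|rewrite s2 subrK].
  by rewrite /u0; field; rewrite gt_eqF.
rewrite /d_cot /orbit_cot /orbit_cot' /orbit_tilt' /c0 -/W -/K.
have Cn : C != 0 by rewrite gt_eqF.
rewrite /W; field.
by rewrite Cn.
Qed.

Lemma diffTS_orbit_tilt : exists2 A, diffTS setT orbit_tilt z A & forall t, A X t = d_tilt t.
Proof.
have [_ [_ dL2 _ db1 db2]] := XD_brackets mu k0 h ZZ YY ZY Tz w1 L0.
eexists.
  exact: diffTS_add (diffTS_trig (or_introl erefl) (diffTS_b1 Y [set: R] Tz w1))
    (diffTS_trig (or_intror erefl) (diffTS_b2 Y [set: R] Tz w1 L0)).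
move=> t /=; rewrite -/X in dL2 db1 db2 *; rewrite db1 db2 -/C -/K.
by rewrite /d_tilt /orbit_cot' /orbit_tilt /orbit_tilt' -/K -/W -/c0; ring.
Qed.

(* Since [X] commutes with the Kepler field, [X] applied to a time density is a
   total derivative; [time_flux] is minus the displacement under [X] of the polar
   angle at fixed time, times the density. The first term of [cot_flux] comes from
   the second integral of the two-center problem with centers Z and k0 Z + h Y. *)
Definition time_flux t := h * C * (((orbit_cot z t + K) * orbit_tilt z t - c0) * time_density z t).
Definition cot_flux t := - h * C *
    ((h * orbit_cot z t - k0 * orbit_tilt z t) / Num.sqrt (center_gap z t))
  + h * C * (center_lin z t / Num.sqrt (center_gap z t)
    * (((orbit_cot z t + K) * orbit_tilt z t - c0) * time_density z t)).

(** With u the cotangent and b the tilt, this turns [d_cot] into - h C (1 + u^2) b' + h C u' ((u +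
    K) b - c0): the derivative of u at fixed time, plus the correction for the displacement of the
    polar angle. *)
Let wronskian t : W = orbit_tilt z t * orbit_cot' z t - orbit_tilt' z t * (orbit_cot z t - K).
Proof.
rewrite /W /orbit_tilt /orbit_tilt' /orbit_cot /orbit_cot' -/K.
transitivity ((b1 Z Y z * u1 Z z - b2 Z Y z * (u0 Z z - K))
  * (cos t ^+ 2 + sin t ^+ 2)); first by rewrite cos2Dsin2 mulr1.
ring.
Qed.

Lemma is_derive_time_flux t : is_derive t (1 : R) time_flux
  (- time_density z t ^+ 2 * (2 * orbit_cot z t * d_cot t) - (- h * C * W) * time_density z t).
Proof.
have dub := is_deriveM (is_deriveD (is_derive_orbit_cot z t) (is_derive_cst K t 1))
   (is_derive_orbit_tilt z t).
have dR := is_deriveZ (h * C) (is_deriveM (is_deriveB dub (is_derive_cst c0 t 1))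
   (is_derive_time_density z t)).
set rhs := (X in is_derive _ _ _ X).
move: dR; set lhs := (X in is_derive _ _ _ X) => dR.
suff <- : lhs = rhs by exact: dR.
rewrite /lhs /rhs /GRing.scale /= !fctE /d_cot (wronskian t) /time_density.
field.
by rewrite gt_eqF ?oneDsqr_gt0.
Qed.

Definition d_lin t := k0 * d_cot t + h * d_tilt t.
Definition d_gap t := 2 * orbit_cot z t * d_cot t - 2 * center_lin z t * d_lin t.
Definition d_time t := - time_density z t ^+ 2 * (2 * orbit_cot z t * d_cot t).
Definition d_density t := d_lin t * (time_density z t / Num.sqrt (center_gap z t))
  + center_lin z t * (d_time t / Num.sqrt (center_gap z t)
              + time_density z t * (- (2 * Num.sqrt (center_gap z t) ^+ 3)^-1 * d_gap t)).

(** The quotient (h u - k0 b) / sqrt(gap) is the component of Q along h Z - k0 Y divided by the sine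
    of the angle to k0 Z + h Y. It plays for this center the part that [cy / cs] plays for Z in
    [Dred]. *)
Lemma is_derive_cot_flux t : is_derive t (1 : R) cot_flux (d_density t - (- h * C * W) * cot_density z t).
Proof.
have dub := is_deriveM (is_deriveD (is_derive_orbit_cot z t) (is_derive_cst K t 1))
   (is_derive_orbit_tilt z t).
have dT := is_deriveM (is_deriveB dub (is_derive_cst c0 t 1)) (is_derive_time_density z t).
have dS := is_derive_sqrt_center_gapV (S0 t).
have dG := is_deriveM (is_deriveB (is_deriveZ h (is_derive_orbit_cot z t))
   (is_deriveZ k0 (is_derive_orbit_tilt z t))) dS.
have dR := is_deriveD (is_deriveZ (- h * C) dG)
  (is_deriveZ (h * C) (is_deriveM (is_deriveM (is_derive_center_lin z t) dS) dT)).
set rhs := (X in is_derive _ _ _ X).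
move: dR; set lhs := (X in is_derive _ _ _ X) => dR.
suff <- : lhs = rhs by exact: dR.
rewrite /lhs /rhs !fctE /= /GRing.scale /= /GRing.scale /= /d_density /d_gap /d_time /d_lin /cot_density.
have q0 : Num.sqrt (center_gap z t) != 0 by rewrite gt_eqF ?sqrtr_gt0.
(* Once every power of the root is a multiple of its inverse cube, both sides are linear in that
   cube and no root remains in the identity. *)
have q2 : (Num.sqrt (center_gap z t))^-1 = center_gap z t * (Num.sqrt (center_gap z t)) ^- 3.
  move: q0 (sqr_sqrtr (ltW (S0 t))); move: (Num.sqrt _) => q q0 <-.
  by field.
have -> : (2 * Num.sqrt (center_gap z t) ^+ 3)^-1 = 2^-1 * Num.sqrt (center_gap z t) ^- 3.
  by rewrite invfM.
rewrite q2; move: (Num.sqrt (center_gap z t) ^- 3) => q3.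
rewrite /d_tilt /d_cot (wronskian t) /time_density /center_gap /center_lin.
have u10 : 1 + orbit_cot z t ^+ 2 != 0 by rewrite gt_eqF ?oneDsqr_gt0.
(* [rational_circle] takes a positive sine, hence - h. *)
have [tau _ [hE kE]] : exists2 tau, 0 < tau &
    - h = 2 * tau / (1 + tau ^+ 2) /\ k0 = (1 - tau ^+ 2) / (1 + tau ^+ 2).
  by apply: rational_circle; rewrite ?oppr_gt0// sqrrN -kh; ring.
have {}hE : h = - (2 * tau / (1 + tau ^+ 2)) by rewrite -hE opprK.
have t10 : 1 + tau ^+ 2 != 0 by rewrite gt_eqF ?oneDsqr_gt0.
move: (orbit_cot z t) (orbit_cot' z t) (orbit_tilt z t) (orbit_tilt' z t) u10 => U U' B B' u10.
rewrite hE kE; field.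
by rewrite u10 t10.
Qed.

Lemma flux_periodic : time_flux (pi *+ 2) = time_flux 0 /\ cot_flux (pi *+ 2) = cot_flux 0.
Proof.
have E : (orbit_cot z (pi *+ 2) = orbit_cot z 0) * (orbit_tilt z (pi *+ 2) = orbit_tilt z 0).
  by rewrite /orbit_cot /orbit_tilt cos2pi sin2pi cos0 sin0.
by rewrite /time_flux /cot_flux /center_gap /center_lin /time_density !E.
Qed.

(** Periodicity makes up for the non-compact set of indices; the uniform bound is what the root and
    the inverse of the gap require. *)
Lemma center_gap_lower : exists2 m, 0 < m & forall t, setT t -> m <= center_gap z t.
Proof.
have [|m m0 H] := periodic_lower (@pi2_gt0 R) (@continuous_center_gap z) _ S0.
  by move=> t; rewrite /center_gap /center_lin /orbit_cot /orbit_tilt cosD2pi sinD2pi.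
by exists m.
Qed.

Lemma diffTS_time_density : exists2 A, diffTS setT time_density z A & forall t, A X t = d_time t.
Proof.
have [Au du Aux] := diffTS_orbit_cot.
have d1 := diffTS_add (diffTS_const _ 1 z) (diffTS_mul Tz du du).
eexists; first apply: (diffTS_ext (diffTS_inv Tz d1 _)) => //.
- exists 1 => // t _; rewrite lerDl -expr2 sqr_ge0 //.
- move=> t /=; rewrite Aux /d_time /time_density; field.
  by rewrite -?expr2 gt_eqF ?oneDsqr_gt0.
Qed.

Lemma diffTS_center_gap : exists2 A, diffTS setT center_gap z A & forall t, A X t = d_gap t.
Proof.
have [Au du Aux] := diffTS_orbit_cot; have [Ab db Abx] := diffTS_orbit_tilt.
have dP := diffTS_add (diffTS_scale k0 du) (diffTS_scale h db).
eexists.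
  by apply: (diffTS_ext (diffTS_sub (diffTS_add (diffTS_const _ 1 z)
    (diffTS_mul Tz du du)) (diffTS_mul Tz dP dP))).
by move=> t /=; rewrite Aux Abx /d_gap /d_lin /center_lin; ring.
Qed.

Lemma diffTS_cot_density : exists2 A, diffTS setT cot_density z A & forall t, A X t = d_density t.
Proof.
have [Au du Aux] := diffTS_orbit_cot; have [Ab db Abx] := diffTS_orbit_tilt.
have [AT dT ATx] := diffTS_time_density; have [AS dS ASx] := diffTS_center_gap.
have dP := diffTS_add (diffTS_scale k0 du) (diffTS_scale h db).
have [m m0 Hm] := center_gap_lower.
have dq := diffTS_sqrt Tz dS (ex_intro2 _ _ m m0 Hm).
have Hq : exists2 m, 0 < m & forall t, setT t -> m <= Num.sqrt (center_gap z t).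
  by exists (Num.sqrt m) => [|t _]; rewrite ?sqrtr_gt0// ler_wsqrtr// Hm.
eexists.
  exact: (diffTS_mul Tz dP (diffTS_mul Tz dT (diffTS_inv Tz dq Hq))).
move=> t /=; rewrite Aux Abx ATx ASx /d_density -/(d_lin t) -/(center_lin z t).
have q0 : Num.sqrt (center_gap z t) != 0 by rewrite gt_eqF ?sqrtr_gt0.
by move: (Num.sqrt (center_gap z t)) q0 => q q0; field.
Qed.

Lemma near_center_gap : exists2 r, 0 < r & forall g, `|g| < r ->
  forall t, 0 < center_gap (retrTS (z + g)) t.
Proof.
have [A dS _] := diffTS_center_gap; have [m m0 Hm] := center_gap_lower.
have [r r0 H] := diffTS_pos Tz dS m0 Hm.
by exists r => // g gr t; exact: H.
Qed.

Lemma circle_int_total (f g G : R -> R) (c : R) : continuous f ->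
  primitive (fun t => g t - c * f t) G -> G (pi *+ 2) = G 0 ->
  circle_int g = c * circle_int f.
Proof.
move=> cf dG G0; have [p0 dp] := primP cf.
have dF : primitive g (fun t => G t + c * prim f t).
  move=> t; rewrite -(subrK (c * f t) (g t)).
  by apply: is_deriveD; [exact: dG|apply: is_deriveZ; exact: dp].
by rewrite (circle_intE dF) G0 p0 mulr0 addr0 addrC addKr.
Qed.

(** Both integrals are multiplied by - h C W, so their quotient is stationary along X. By the
    formula for [cL2] in [XD_brackets] this factor is (X C) / C; it expresses that the period, the
    integral of the time density divided by C, is stationary along X too. *)
Lemma diffTS_avg_red : exists2 A,
  diffTS setT (fun x (_ : unit) => avg_red x) z (fun g _ => A g) & A X = 0.
Proof.
have [AT dT ATx] := diffTS_time_density; have [AN dN ANx] := diffTS_cot_density.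
have [r r0 nS] := near_center_gap.
have dIT := diffTS_circle_int dT (ex_intro2 _ _ r r0 (fun g _ =>
  @continuous_time_density (retrTS (z + g)))).
have dIN := diffTS_circle_int dN (ex_intro2 _ _ r r0 (fun g gr =>
  @continuous_cot_density (retrTS (z + g)) (nS g gr))).
have I0 : 0 < circle_int (time_density z).
  apply: circle_int_gt0; first exact: continuous_time_density.
  by move=> t; rewrite invr_gt0 oneDsqr_gt0.
have [RT0 RN0] := flux_periodic.
have IT : circle_int (AT X) = (- h * C * W) * circle_int (time_density z).
  rewrite (_ : AT X = d_time); last exact/funext.
  exact: circle_int_total (@continuous_time_density z) is_derive_time_flux RT0.
have IN : circle_int (AN X) = (- h * C * W) * circle_int (cot_density z).
  rewrite (_ : AN X = d_density); last exact/funext.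
  exact: circle_int_total (continuous_cot_density S0) is_derive_cot_flux RN0.
eexists.
  apply: (diffTS_mul Tz dIN (diffTS_inv Tz dIT _)).
  by exists (circle_int (time_density z)).
by rewrite /= IT IN; field; rewrite gt_eqF.
Qed.

End At.
End AveragedReduced.

(** * Kepler orbits *)

Section Curves.
Context {R : realType} {d : nat}.
Local Notation V := (phase R d).
Implicit Types (f : V -> R) (g : R -> V) (z X : V).

Lemma unif_diff_along f g (t : R) X (A : V -> R) :
  unif_diff setT (fun x (_ : unit) => f x) (g t) (fun h _ => A h) ->
  is_derive t (1 : R) g X -> is_derive t (1 : R) (f \o g) (A X).
Proof.
move=> /unif_diff_differentiable[df dE] dg.
have dg' : differentiable g t by apply/derivable1_diffP; have [] := dg.
have dfg : differentiable ((f : V -> R^o) \o g) t by exact: differentiable_comp.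
apply: DeriveDef; first exact/derivable1_diffP.
rewrite (deriveE _ dfg) diff_comp//= dE; congr A.
by rewrite -(deriveE _ dg'); have [] := dg.
Qed.

(** The curve stays in T S^d, where the retraction is the identity and can be inserted before
    differentiating. *)
Lemma diffTS_along f g (t : R) X (A : V -> R) : (forall s, TS (g s)) ->
  diffTS setT (fun x (_ : unit) => f x) (g t) (fun h _ => A h) ->
  TTS (g t) X -> is_derive t (1 : R) g X -> is_derive t (1 : R) (f \o g) (A X).
Proof.
move=> gT [B uF BA] tX dg.
have := @unif_diff_along (f \o retrTS) g t X (fun h => B h tt) _ dg.
rewrite (BA X tt tX I) (_ : (f \o retrTS) \o g = f \o g).
  by apply; apply: unif_diff_ext uF _ _ => // h [].
by apply/funext => s /=; rewrite retrTS_id.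
Qed.

Lemma is_derive_row n (v : R -> 'rV[R]_n) (t : R) (w : 'rV[R]_n) :
  (forall x, is_derive t (1 : R) (fun s => dotv (v s) x) (dotv w x)) ->
  is_derive t (1 : R) v w.
Proof.
move=> H.
have E (u : 'rV[R]_n) i j : u i j = dotv u (delta_mx ord0 j).
  rewrite /dotv (bigD1 j)//= mxE !eqxx mulr1 big1 ?addr0 => [|k kj].
    by rewrite (ord1 i).
  by rewrite mxE eqxx (negbTE kj) mulr0.
have vE i j : (fun s => v s i j) = fun s => dotv (v s) (delta_mx ord0 j).
  by apply/funext => s; exact: E.
have dv : derivable v t 1.
  by apply/derivable_mxP => i j; rewrite vE; have [] := H (delta_mx ord0 j).
apply: DeriveDef => //; rewrite derive_mx//; apply/matrixP => i j; rewrite mxE vE.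
by have [_ ->] := H (delta_mx ord0 j); rewrite -(E w i j).
Qed.

Lemma is_derive_phase g (t : R) X :
  (forall x, is_derive t (1 : R) (fun s => dotv (g s).1 x) (dotv X.1 x)) ->
  (forall x, is_derive t (1 : R) (fun s => dotv (g s).2 x) (dotv X.2 x)) ->
  is_derive t (1 : R) g X.
Proof.
move=> /is_derive_row d1 /is_derive_row d2.
have e1 : differentiable (fun s => (g s).1) t by apply/derivable1_diffP; have [] := d1.
have e2 : differentiable (fun s => (g s).2) t by apply/derivable1_diffP; have [] := d2.
have gE : g = fun s => ((g s).1, (g s).2).
  by apply/funext => s; rewrite -surjective_pairing.
have dg : differentiable g t by rewrite gE; exact: differentiable_pair.
apply: DeriveDef; first exact/derivable1_diffP.
rewrite (deriveE _ dg) gE (diff_pair e1 e2) [RHS]surjective_pairing.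
have [_ <-] := d1; have [_ <-] := d2.
by rewrite (deriveE _ e1) (deriveE _ e2).
Qed.

End Curves.

(** * Inverse of a function whose derivative is bounded below *)

Section InverseTime.
Context {R : realType}.

Lemma inverse_time (f F : R -> R) (m : R) : 0 < m -> (forall x, m <= f x) ->
  continuous f -> primitive f F -> F 0 = 0 ->
  exists G : R -> R, [/\ G 0 = 0, cancel F G, cancel G F &
    forall t, is_derive t (1 : R) G (f (G t))^-1].
Proof.
move=> m0 mf cf dF F0; have cF := primitive_continuous dF.
have MV x y : x < y -> m * (y - x) <= F y - F x.
  move=> xy; have [|c _ ->] := MVT xy (fun s _ => dF s).
    exact: continuous_subspaceT.
  by rewrite ler_wpM2r// subr_ge0 ltW.
have Finc x y : x < y -> F x < F y.
  move=> xy; rewrite -subr_gt0 (lt_le_trans _ (MV _ _ xy))//.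
  by rewrite mulr_gt0// subr_gt0.
have Finj : injective F.
  move=> x y E; apply/eqP; rewrite eq_le !leNgt; apply/andP; split; apply/negP => /Finc.
    by rewrite E ltxx.
  by rewrite E ltxx.
have Fsurj y : exists x, F x = y.
  (* Slope at least m gives F b >= m b >= |y| and F (- b) <= - |y|; the added 1 keeps b positive. *)
  pose b := `|y| / m + 1.
  have b0 : 0 < b by rewrite ltr_wpDl// divr_ge0// ltW.
  have mb : `|y| <= m * b.
    by rewrite /b mulrDr mulr1 mulrC divfK ?gt_eqF// lerDl ltW.
  have Fb : `|y| <= F b by have := MV _ _ b0; rewrite F0 !subr0; apply: le_trans.
  have FNb : F (- b) <= - `|y|.
    have := MV (- b) 0; rewrite oppr_lt0 F0 sub0r opprK add0r => /(_ b0); lra.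
  have bb : - b <= b by lra.
  have [||x _ Fx] := @IVT _ F (- b) b y bb.
  - exact: continuous_subspaceT.
  - have := ler_norm y; have := ler_norm (- y); rewrite normrN => h1 h2.
    by rewrite ge_min le_max; apply/andP; split; apply/orP; [left|right]; lra.
  by exists x.
have [G HG] := choice Fsurj.
have FG : cancel F G by move=> x; apply: Finj; rewrite HG.
exists G; split=> //; first by rewrite -[X in G X]F0 FG.
move=> t; rewrite -[in is_derive t](HG t); apply: is_derive_inverse.
- by near=> x; exact: FG.
- by near=> x; exact: cF.
- exact: dF.
- by rewrite gt_eqF// (lt_le_trans m0).
Unshelve. all: by end_near. Qed.

End InverseTime.

(** * Conservation of angular momentum and the linear equation of an orbit *)

Section Orbits.
Context {R : realType} {d : nat} (Z : 'rV[R]_d.+1) (mu : R).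
Context (ZZ : dotv Z Z = 1).
Implicit Types (x z : phase R d) (g : R -> phase R d).

Definition XE x := ham_vec x (EU Z mu x) x.2.

Definition kepler_orbit g := forall t : R,
  [/\ TS (g t), cw Z (g t) ^+ 2 < 1 & is_derive t (1 : R) g (XE (g t))].

Lemma XE1 x zeta : TS x -> dotv (XE x).1 zeta = dotv x.2 zeta.
Proof. by move=> [_ QP]; rewrite /XE /= QP scale0r subr0. Qed.

Lemma XE2 x zeta : TS x -> dotv (XE x).2 zeta = mu / cs Z x ^+ 3 * dotv Z zeta
  - (mu / cs Z x ^+ 3 * cw Z x + ck x) * dotv x.1 zeta.
Proof.
move=> [_ QP]; rewrite /XE /= QP scale0r addr0 /EU !dotvE -/(cw Z x) -/(ck x).
ring.
Qed.

Lemma XE_TTS x : TS x -> TTS x (XE x).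
Proof. exact: ham_vec_TTS. Qed.

Lemma invcs_sqr x : cw Z x ^+ 2 < 1 -> (cs Z x ^+ 2)^-1 = 1 + u0 Z x ^+ 2.
Proof.
move=> w1; have s0 := cs_gt0 w1; have s2 := cs_sqr w1.
transitivity ((cs Z x ^+ 2 + cw Z x ^+ 2) / cs Z x ^+ 2).
  by rewrite s2 subrK mul1r.
by rewrite /u0; field; rewrite gt_eqF.
Qed.

Lemma b1_Z x : b1 Z Z x = u0 Z x. Proof. by []. Qed.

Lemma b2_Z x : cw Z x ^+ 2 < 1 -> b2 Z Z x = u1 Z x.
Proof.
move=> w1; have s0 := cs_gt0 w1; have s2 := cs_sqr w1.
rewrite /b2 /u1 -!/(cw Z x) /cy /cp -/(cw Z x) -/(cv Z x).
have -> : cs Z x * cv Z x + cw Z x * cv Z x * cw Z x / cs Z x =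
  cv Z x * (cs Z x ^+ 2 + cw Z x ^+ 2) / cs Z x by field; rewrite gt_eqF.
by rewrite s2 subrK mulr1 invfM mulrA.
Qed.

Lemma state_dot1 x zeta : cw Z x ^+ 2 < 1 ->
  dotv x.1 zeta = cs Z x * b1 Z zeta x.
Proof. by move=> w1; rewrite /b1 mulrC divfK// gt_eqF ?cs_gt0. Qed.

Lemma state_dot2 x zeta : cw Z x ^+ 2 < 1 -> 0 < cL2 Z x ->
  dotv x.2 zeta = cL Z x / cs Z x * b2 Z zeta x
    - cL Z x * cs Z x * u0 Z x * u1 Z x * b1 Z zeta x.
Proof.
move=> w1 L0; rewrite /b1 /b2 /u0 /u1 -/(cp zeta x); field.
by rewrite !gt_eqF ?cs_gt0 ?cL_gt0.
Qed.

(** The choice zeta = Z recovers u0 and u1, hence sin theta; then every scalar product with Q and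
    with Q' is determined. *)
Lemma state_unique x x' : cw Z x ^+ 2 < 1 -> cw Z x' ^+ 2 < 1 ->
  0 < cL2 Z x -> cL2 Z x' = cL2 Z x ->
  (forall zeta, b1 Z zeta x' = b1 Z zeta x) ->
  (forall zeta, b2 Z zeta x' = b2 Z zeta x) -> x' = x.
Proof.
move=> w1 w1' L0 LE B1 B2; have L0' : 0 < cL2 Z x' by rewrite LE.
have uE : u0 Z x' = u0 Z x by rewrite -!b1_Z.
have sE : cs Z x' = cs Z x.
  apply: (@pexpIrn _ 2) => //; rewrite ?nnegrE ?ltW ?cs_gt0//.
  by apply: invr_inj; rewrite !invcs_sqr// uE.
have CE : cL Z x' = cL Z x by rewrite /cL LE.
have vE : u1 Z x' = u1 Z x by rewrite -!b2_Z.
rewrite [x']surjective_pairing [x]surjective_pairing; congr pair.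
  by apply: dotv_ext => zeta; rewrite !state_dot1// sE B1.
by apply: dotv_ext => zeta; rewrite !state_dot2// CE sE uE vE B1 B2.
Qed.

Section OrbitOf.
Context (g : R -> phase R d) (og : kepler_orbit g).

Let gT t : TS (g t). Proof. by have [] := og t. Qed.
Let gw t : cw Z (g t) ^+ 2 < 1. Proof. by have [] := og t. Qed.
Let gd t : is_derive t (1 : R) g (XE (g t)). Proof. by have [] := og t. Qed.

(** The derivative of [cL2] along the Kepler field, in the form of [diffTS_cL2]. It vanishes because
    the force points along the great circle through Z and has no moment about Z. *)
Let L2'0 t : 2 * dotv (g t).2 (XE (g t)).2 * (1 - cw Z (g t) ^+ 2)
  - 2 * ck (g t) * cw Z (g t) * dotv (XE (g t)).1 Z
  - 2 * cv Z (g t) * dotv (XE (g t)).2 Z = 0.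
Proof.
have [QQ QP] := gT t; have s0 := cs_gt0 (gw t); have s2 := cs_sqr (gw t).
rewrite dotvC XE1// !XE2// -s2 (dotvC Z) -!/(cv Z _) -/(cw Z _) QP ZZ.
have -> : mu / cs Z (g t) ^+ 3 * 1 - (mu / cs Z (g t) ^+ 3 * cw Z (g t)
   + ck (g t)) * cw Z (g t) = mu / cs Z (g t) ^+ 3 * (1 - cw Z (g t) ^+ 2)
   - ck (g t) * cw Z (g t) by ring.
by rewrite -s2; field; rewrite gt_eqF.
Qed.

Lemma orbit_L2 t : cL2 Z (g t) = cL2 Z (g 0).
Proof.
apply: (@is_derive_0_is_cst _ (cL2 Z \o g)) => s.
have dL := diffTS_along gT (diffTS_cL2 Z setT (gT s)) (XE_TTS (gT s)) (gd s).
by rewrite /= L2'0 in dL.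
Qed.

Context (L0 : 0 < cL2 Z (g 0)).

Let gL t : 0 < cL2 Z (g t). Proof. by rewrite orbit_L2. Qed.

Lemma orbit_b1 zeta t : is_derive t (1 : R) (b1 Z zeta \o g)
  (cL Z (g 0) * (1 + u0 Z (g t) ^+ 2) * b2 Z zeta (g t)).
Proof.
have db := diffTS_along gT (diffTS_b1 zeta setT (gT t) (gw t)) (XE_TTS (gT t)) (gd t).
have s0 := cs_gt0 (gw t); have C0 := cL_gt0 (gL t).
rewrite /= !XE1// in db.
rewrite -invcs_sqr// (_ : cL Z (g 0) = cL Z (g t)); last by rewrite /cL orbit_L2.
set rhs := (X in is_derive _ _ _ X); move: db.
set lhs := (X in is_derive _ _ _ X) => db; suff <- : lhs = rhs by [].
rewrite /lhs /rhs /b2 -/(cv Z _) -/(cp zeta _); field.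
by rewrite !gt_eqF.
Qed.

(** Together with [orbit_b1] this is the Binet equation rho'' + rho = kappa Z in the polar angle,
    for rho = Q / sin theta, tested against zeta. The common factor is the angular velocity. *)
Lemma orbit_b2 zeta t : is_derive t (1 : R) (b2 Z zeta \o g)
  (cL Z (g 0) * (1 + u0 Z (g t) ^+ 2) *
    (kappa Z mu (g 0) * dotv Z zeta - b1 Z zeta (g t))).
Proof.
have db := diffTS_along gT (diffTS_b2 zeta setT (gT t) (gw t) (gL t)) (XE_TTS (gT t)) (gd t).
have s0 := cs_gt0 (gw t); have C0 := cL_gt0 (gL t).
rewrite /= L2'0 !XE1// !XE2// ZZ in db.
rewrite -invcs_sqr// (_ : cL Z (g 0) = cL Z (g t)); last by rewrite /cL orbit_L2.
have -> : kappa Z mu (g 0) = mu / cL Z (g t) ^+ 2.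
  by rewrite /kappa cL_sqr// orbit_L2.
set rhs := (X in is_derive _ _ _ X); move: db.
set lhs := (X in is_derive _ _ _ X) => db; suff <- : lhs = rhs by [].
rewrite /lhs /rhs /b1 -!/(cv Z _) -!/(cp zeta _) -!/(cw Z _) -!/(cy zeta _).
have kE : ck (g t) = (cL Z (g t) ^+ 2 + cv Z (g t) ^+ 2) / cs Z (g t) ^+ 2.
  rewrite cL_sqr// cs_sqr// /cL2 subrK mulfK// gt_eqF// subr_gt0//.
have [tau t0 [st wt]] := rational_circle s0 (cs_sqr (gw t)).
rewrite kE st wt; field.
by rewrite !gt_eqF// addr_gt0// exprn_gt0.
Qed.

Let z := g 0.
Let C := cL Z z.
Let K := kappa Z mu z.

Let C0 : 0 < C. Proof. exact: cL_gt0. Qed.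

(* For [n] the angular velocity, b1 - kappa (Z . zeta) has derivative n b2, and b2
   has derivative - n (b1 - kappa (Z . zeta)): this pair rotates. *)
Lemma orbit_rotation : exists phi : R -> R, [/\ phi 0 = 0,
  forall t, is_derive t (1 : R) phi (C * (1 + u0 Z (g t) ^+ 2)) &
  forall zeta t,
   b1 Z zeta (g t) = K * dotv Z zeta
     + (b1 Z zeta z - K * dotv Z zeta) * cos (phi t) + b2 Z zeta z * sin (phi t) /\
   b2 Z zeta (g t) = - (b1 Z zeta z - K * dotv Z zeta) * sin (phi t)
     + b2 Z zeta z * cos (phi t)].
Proof.
pose n t := C * (1 + u0 Z (g t) ^+ 2).
have cu : continuous (u0 Z \o g).
  exact: (@primitive_continuous _ _ (b1 Z Z \o g) (orbit_b1 Z)).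
have cn : continuous n.
  move=> t; apply: cvgM; first exact: cvg_cst.
  by apply: cvgD; [exact: cvg_cst|apply: cvgM; exact: cu].
have [phi phi0 dphi] := ex_primitive cn.
exists phi; split=> // zeta t.
pose be1 t := b1 Z zeta (g t) - K * dotv Z zeta.
pose be2 t := b2 Z zeta (g t).
have d1 s : is_derive s (1 : R) be1 (n s * be2 s).
  by rewrite -[n s * _]subr0; apply: is_deriveB; exact: orbit_b1.
have d2 s : is_derive s (1 : R) be2 (- n s * be1 s).
  rewrite (_ : - _ * _ = n s * (K * dotv Z zeta - b1 Z zeta (g s))); last first.
    by rewrite /be1; ring.
  exact: orbit_b2.
have dc s : is_derive s (1 : R) (cos \o phi) (- sin (phi s) * n s).
  exact: is_derive1_comp.
have dn s : is_derive s (1 : R) (sin \o phi) (cos (phi s) * n s).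
  exact: is_derive1_comp.
(* Rotated back by the angle phi, the pair is constant: [E1] and [E2] are the two components. *)
have E1 : be1 t * cos (phi t) - be2 t * sin (phi t) = be1 0.
  have -> : be1 0 = be1 0 * cos (phi 0) - be2 0 * sin (phi 0).
    by rewrite phi0 cos0 sin0; ring.
  apply: (@is_derive_0_is_cst _ (be1 * (cos \o phi) - be2 * (sin \o phi))) => s.
  have dd := is_deriveB (is_deriveM (d1 s) (dc s)) (is_deriveM (d2 s) (dn s)).
  move: dd; set lhs := (X in is_derive _ _ _ X); suff -> : lhs = 0 by [].
  by rewrite /lhs /GRing.scale /=; ring.
have E2 : be1 t * sin (phi t) + be2 t * cos (phi t) = be2 0.
  have -> : be2 0 = be1 0 * sin (phi 0) + be2 0 * cos (phi 0).
    by rewrite phi0 cos0 sin0; ring.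
  apply: (@is_derive_0_is_cst _ (be1 * (sin \o phi) + be2 * (cos \o phi))) => s.
  have dd := is_deriveD (is_deriveM (d1 s) (dn s)) (is_deriveM (d2 s) (dc s)).
  move: dd; set lhs := (X in is_derive _ _ _ X); suff -> : lhs = 0 by [].
  by rewrite /lhs /GRing.scale /=; ring.
have cs2 := cos2Dsin2 (phi t).
split.
  apply/eqP; rewrite -subr_eq0; apply/eqP.
  transitivity (be1 t * (cos (phi t) ^+ 2 + sin (phi t) ^+ 2)
     - be1 0 * cos (phi t) - be2 0 * sin (phi t)).
    by rewrite cs2 /be1 /be2 -/z; ring.
  by rewrite -E1 -E2; ring.
transitivity (be2 t * (cos (phi t) ^+ 2 + sin (phi t) ^+ 2)).
  by rewrite cs2 mulr1.
by rewrite -/(be1 0) -/(be2 0) -E1 -E2; ring.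
Qed.

End OrbitOf.
End Orbits.

(** * The explicit Kepler flow *)

Section Flow.
Context {R : realType} {d : nat} (Z : 'rV[R]_d.+1) (mu : R).
Context (ZZ : dotv Z Z = 1).
Implicit Types x : phase R d.

Local Notation uf := (orbit_cot Z mu).
Local Notation uf' := (orbit_cot' Z mu).
Local Notation fT := (time_density Z mu).

Context (z : phase R d) (Tz : TS z) (w1 : cw Z z ^+ 2 < 1) (L0 : 0 < cL2 Z z).

Let C := cL Z z.
Let K := kappa Z mu z.
Let C0 : 0 < C. Proof. exact: cL_gt0. Qed.

Definition orbit_time (s : R) := C^-1 * prim (fT z) s.

Lemma time_of_primitive : primitive (fun s => C^-1 * fT z s) orbit_time.
Proof. by apply: primitive_Z; have [] := primP (@continuous_time_density _ _ Z mu z). Qed.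

Lemma time_of0 : orbit_time 0 = 0.
Proof. by rewrite /orbit_time (primP (@continuous_time_density _ _ Z mu z)).1 mulr0. Qed.

Lemma orbit_cotE (t : R) : uf z t =
  K * dotv Z Z + (b1 Z Z z - K * dotv Z Z) * cos t + b2 Z Z z * sin t.
Proof. by rewrite ZZ mulr1 b1_Z b2_Z. Qed.

(** The angle phi of an orbit has speed C (1 + u^2), where u depends on the orbit only through phi
    and z. Hence [orbit_time \o phi] has derivative 1 and phi is [G], whatever the orbit. Uniqueness
    of orbits follows from this formula rather than from a Lipschitz estimate. *)
Lemma orbit_param (g : R -> phase R d) (G : R -> R) : kepler_orbit Z mu g -> g 0 = z ->
  cancel orbit_time G -> forall zeta t,
   b1 Z zeta (g t) = K * dotv Z zeta
     + (b1 Z zeta z - K * dotv Z zeta) * cos (G t) + b2 Z zeta z * sin (G t) /\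
   b2 Z zeta (g t) = - (b1 Z zeta z - K * dotv Z zeta) * sin (G t)
     + b2 Z zeta z * cos (G t).
Proof.
move=> og g0 FG; have Lg : 0 < cL2 Z (g 0) by rewrite g0.
have [phi [phi0 dphi HB]] := orbit_rotation ZZ og Lg; rewrite g0 -/C in HB dphi.
suff -> : G = phi by [].
have u0E t : u0 Z (g t) = uf z (phi t) by rewrite orbit_cotE -b1_Z (HB Z t).1.
have dF (s : R) : is_derive s (1 : R) (orbit_time \o phi) 1.
  have := is_derive1_comp (time_of_primitive (phi s)) (dphi s).
  rewrite u0E /time_density.
  have -> : C^-1 / (1 + uf z (phi s) ^+ 2) * (C * (1 + uf z (phi s) ^+ 2)) = 1.
    by field; rewrite !gt_eqF// oneDsqr_gt0.
  by [].
apply/funext => t; rewrite -[RHS]FG; congr G; apply/esym/eqP.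
rewrite -subr_eq0; apply/eqP.
transitivity ((orbit_time \o phi) 0 - 0); last by rewrite /= phi0 time_of0 subrr.
apply: (@is_derive_0_is_cst _ ((orbit_time \o phi) - id)) => s.
by rewrite -(subrr (1 : R)); apply: is_deriveB.
Qed.

Lemma orbit_unique (g g' : R -> phase R d) (G : R -> R) :
  cancel orbit_time G -> kepler_orbit Z mu g -> kepler_orbit Z mu g' ->
  g 0 = z -> g' 0 = z -> g = g'.
Proof.
move=> FG og og' g0 g'0; apply/funext => t.
have [_ wt _] := og t; have [_ wt' _] := og' t.
have Lg : cL2 Z (g t) = cL2 Z z by rewrite (orbit_L2 ZZ og) g0.
have Lg' : cL2 Z (g' t) = cL2 Z z by rewrite (orbit_L2 ZZ og') g'0.
apply: (@state_unique _ _ Z) => //; rewrite ?Lg'// => zeta.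
  by rewrite (orbit_param og g0 FG zeta t).1 (orbit_param og' g'0 FG zeta t).1.
by rewrite (orbit_param og g0 FG zeta t).2 (orbit_param og' g'0 FG zeta t).2.
Qed.

Lemma time_density_lower : exists2 m, 0 < m & forall t, m <= C^-1 * fT z t.
Proof.
have [||m m0 H] := periodic_lower (@pi2_gt0 R) (@continuous_time_density _ _ Z mu z).
- by move=> t; rewrite /time_density /orbit_cot cosD2pi sinD2pi.
- by move=> t; rewrite invr_gt0 oneDsqr_gt0.
exists (C^-1 * m) => [|t]; first by rewrite mulr_gt0 ?invr_gt0.
by rewrite ler_pM2l ?invr_gt0.
Qed.

Lemma ex_angle : exists G : R -> R, [/\ G 0 = 0, cancel orbit_time G, cancel G orbit_time &
    forall t, is_derive t (1 : R) G (C * (1 + uf z (G t) ^+ 2))].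
Proof.
have [m m0 Hm] := time_density_lower.
have cf : continuous (fun s => C^-1 * fT z s).
  by move=> t; apply: cvgM; [exact: cvg_cst|exact: continuous_time_density].
have [G [G0 FG GF dG]] := inverse_time m0 Hm cf time_of_primitive time_of0.
by exists G; split=> // t; have := dG t; rewrite invfM invrK /time_density invrK.
Qed.

(* The point of the orbit of [z] at polar angle [t] is [orbit_at t]. The vectors are
   locked because rewriting with [dotvZl] and the like would unfold them. *)
Definition rho0 : 'rV[R]_d.+1 := locked ((cs Z z)^-1 *: z.1).
Definition om0 : 'rV[R]_d.+1 :=
  locked (C^-1 *: (cs Z z *: z.2 + (cw Z z * cv Z z / cs Z z) *: z.1)).
Let s0 : 0 < cs Z z. Proof. exact: cs_gt0. Qed.
Let s2 : cs Z z ^+ 2 = 1 - cw Z z ^+ 2. Proof. exact: cs_sqr. Qed.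
Let C2 : C ^+ 2 = cL2 Z z. Proof. exact: cL_sqr. Qed.

Lemma rho0E zeta : dotv rho0 zeta = b1 Z zeta z.
Proof. by rewrite /rho0 -!lock dotvZl mulrC. Qed.

Lemma om0E zeta : dotv om0 zeta = b2 Z zeta z.
Proof.
by rewrite /om0 -!lock dotvZl dotvDl !dotvZl -/(cp zeta z) -/(cy zeta z) /b2 mulrC mulrAC.
Qed.

Let kE : ck z = (C ^+ 2 + cv Z z ^+ 2) / cs Z z ^+ 2.
Proof. by rewrite C2 s2 /cL2 subrK mulfK// gt_eqF// subr_gt0. Qed.

Lemma rho00 : dotv rho0 rho0 = 1 + u0 Z z ^+ 2.
Proof.
have [QQ _] := Tz; rewrite -invcs_sqr// /rho0 -!lock !(dotvZl, dotvZr) QQ.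
by field; rewrite gt_eqF.
Qed.

Lemma rho_om0 : dotv rho0 om0 = u0 Z z * u1 Z z.
Proof.
have [QQ QP] := Tz; rewrite /rho0 /om0 -!lock !(dotvZl, dotvZr, dotvDr) QQ QP /u0 /u1.
by rewrite -/C; field; rewrite !gt_eqF.
Qed.

Lemma om00 : dotv om0 om0 = 1 + u1 Z z ^+ 2.
Proof.
have [QQ QP] := Tz.
rewrite /om0 -!lock !(dotvZl, dotvZr, dotvDl, dotvDr) (dotvC z.2) QQ QP -/(ck z) kE /u1 -/C.
transitivity ((C ^+ 2 + cv Z z ^+ 2 * (cs Z z ^+ 2 + cw Z z ^+ 2) / cs Z z ^+ 2)
  / C ^+ 2); first by field; rewrite !gt_eqF.
by rewrite s2 subrK -s2; field; rewrite !gt_eqF.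
Qed.

(** The solution of rho'' + rho = K Z with initial values [rho0] and [om0]; [om] is its
    derivative. *)
Definition rho (t : R) : 'rV[R]_d.+1 :=
  locked (K *: Z + cos t *: (rho0 - K *: Z) + sin t *: om0).
Definition om (t : R) : 'rV[R]_d.+1 :=
  locked (- sin t *: (rho0 - K *: Z) + cos t *: om0).

Lemma rhoZ t : dotv (rho t) Z = uf z t.
Proof. by rewrite orbit_cotE /rho -!lock !(dotvDl, dotvNl, dotvZl) rho0E om0E; ring. Qed.

Lemma omZ t : dotv (om t) Z = uf' z t.
Proof.
rewrite /om -!lock !(dotvDl, dotvNl, dotvZl) rho0E om0E ZZ b1_Z b2_Z//.
by rewrite /orbit_cot' -/K; ring.
Qed.

(** The component of [rho t] along Z is the cotangent, and its projection to the orthogonal of Z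
    stays a unit vector. *)
Lemma rho_rho t : dotv (rho t) (rho t) = 1 + uf z t ^+ 2.
Proof.
rewrite /rho -!lock !(dotvDl, dotvDr, dotvNl, dotvNr, dotvZl, dotvZr) ZZ.
rewrite (dotvC Z) (dotvC Z) (dotvC om0 rho0).
rewrite rho00 rho_om0 om00 !rho0E !om0E b1_Z b2_Z// /orbit_cot -/K.
apply/eqP; rewrite -subr_eq0; apply/eqP.
transitivity (cos t ^+ 2 + sin t ^+ 2 - 1); first ring.
by rewrite cos2Dsin2 subrr.
Qed.

Lemma rho_om t : dotv (rho t) (om t) = uf z t * uf' z t.
Proof.
rewrite /rho /om -!lock !(dotvDl, dotvDr, dotvNl, dotvNr, dotvZl, dotvZr) ZZ.
rewrite (dotvC Z) (dotvC Z) (dotvC om0 rho0).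
by rewrite rho00 rho_om0 om00 !rho0E !om0E b1_Z b2_Z// /orbit_cot /orbit_cot' -/K; ring.
Qed.

Lemma om_om t : dotv (om t) (om t) = 1 + uf' z t ^+ 2.
Proof.
rewrite /om -!lock !(dotvDl, dotvDr, dotvNl, dotvNr, dotvZl, dotvZr) ZZ.
rewrite (dotvC Z) (dotvC Z) (dotvC om0 rho0).
rewrite rho00 rho_om0 om00 !rho0E !om0E b1_Z b2_Z// /orbit_cot' -/K.
apply/eqP; rewrite -subr_eq0; apply/eqP.
transitivity (cos t ^+ 2 + sin t ^+ 2 - 1); first ring.
by rewrite cos2Dsin2 subrr.
Qed.

Lemma is_derive_rho zeta t : is_derive t (1 : R) (fun s => dotv (rho s) zeta)
  (dotv (om t) zeta).
Proof.
have -> : (fun s => dotv (rho s) zeta) = fun s => K * dotv Z zeta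
    + (dotv (rho0 - K *: Z) zeta) * cos s + dotv om0 zeta * sin s.
  by apply/funext => s; rewrite /rho -!lock !(dotvDl, dotvNl, dotvZl); ring.
have -> : dotv (om t) zeta = 0 + (dotv (rho0 - K *: Z) zeta) * (- sin t)
    + dotv om0 zeta * cos t.
  by rewrite /om -!lock !(dotvDl, dotvNl, dotvZl); ring.
exact: is_deriveD.
Qed.

Lemma is_derive_om zeta t : is_derive t (1 : R) (fun s => dotv (om s) zeta)
  (K * dotv Z zeta - dotv (rho t) zeta).
Proof.
have -> : (fun s => dotv (om s) zeta) = fun s =>
    (- dotv (rho0 - K *: Z) zeta) * sin s + dotv om0 zeta * cos s.
  by apply/funext => s; rewrite /om -!lock !(dotvDl, dotvNl, dotvZl); ring.
have -> : K * dotv Z zeta - dotv (rho t) zeta =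
    (- dotv (rho0 - K *: Z) zeta) * cos t + dotv om0 zeta * (- sin t).
  by rewrite /rho -!lock !(dotvDl, dotvNl, dotvZl); ring.
exact: is_deriveD.
Qed.

Lemma rho_om_0 : rho 0 = rho0 /\ om 0 = om0.
Proof.
rewrite /rho /om -!lock cos0 sin0 oppr0 !scale1r !scale0r addr0 add0r.
by split=> //; rewrite addrC subrK.
Qed.

(** Here s is sin theta, as the density is 1 / (1 + cot^2 theta). The second component is the time
    derivative of s rho: the angular velocity is C / s^2, and s has derivative - s^3 u u' in the
    polar angle. *)
Definition orbit_at (t : R) : phase R d :=
  let s := Num.sqrt (fT z t) in
  (s *: rho t, (C / s) *: om t - (C * s * uf z t * uf' z t) *: rho t).

Let sq t := Num.sqrt (fT z t).

Lemma time_density_gt0 t : 0 < fT z t. Proof. by rewrite invr_gt0 oneDsqr_gt0. Qed.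

Let sq0 t : 0 < sq t. Proof. by rewrite sqrtr_gt0 time_density_gt0. Qed.

Let sqE t : 1 + uf z t ^+ 2 = (sq t ^+ 2)^-1.
Proof. by rewrite /sq sqr_sqrtr ?(ltW (time_density_gt0 t))// invrK. Qed.

Let sq_u t : sq t ^+ 2 * uf z t ^+ 2 = 1 - sq t ^+ 2.
Proof.
have E : uf z t ^+ 2 = (sq t ^+ 2)^-1 - 1 by rewrite -sqE addrC addKr.
by rewrite E; field; rewrite gt_eqF.
Qed.

Lemma orbit_at_TS t : TS (orbit_at t).
Proof.
rewrite /TS /= /orbit_at /= -/(sq t); split.
  by rewrite dotvZl dotvZr rho_rho sqE; field; rewrite gt_eqF.
rewrite dotvZl dotvBr !dotvZr rho_rho rho_om sqE.
by field; rewrite gt_eqF.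
Qed.

Lemma orbit_at_w t : cw Z (orbit_at t) = sq t * uf z t.
Proof. by rewrite /cw /orbit_at /= dotvZl rhoZ. Qed.

Lemma orbit_at_w1 t : cw Z (orbit_at t) ^+ 2 < 1.
Proof. by rewrite orbit_at_w exprMn sq_u gtrDl oppr_lt0 exprn_gt0. Qed.

Lemma orbit_at_cs t : cs Z (orbit_at t) = sq t.
Proof.
rewrite /cs orbit_at_w exprMn sq_u opprB addrC subrK sqrtr_sqr.
by rewrite ger0_norm// ltW.
Qed.

Lemma orbit_at_ck t : ck (orbit_at t) = C ^+ 2 * (1 + uf z t ^+ 2 + uf' z t ^+ 2).
Proof.
rewrite /ck /orbit_at /= -/(sq t) !(dotvBl, dotvBr, dotvZl, dotvZr).
rewrite (dotvC (om t) (rho t)) rho_rho rho_om om_om.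
have := sqE t; have := sq_u t; have := sq0 t.
move: (sq t) (uf z t) (uf' z t) => s u v s1 su E.
have sn : s != 0 by rewrite gt_eqF.
transitivity (C ^+ 2 * ((s ^+ 2)^-1 * (1 + v ^+ 2) - 2 * u ^+ 2 * v ^+ 2
   + (s ^+ 2 * (1 + u ^+ 2)) * u ^+ 2 * v ^+ 2)).
  by field; rewrite sn.
rewrite -E.
have -> : s ^+ 2 * (1 + u ^+ 2) = 1 by rewrite E mulfV// expf_neq0.
ring.
Qed.

Lemma orbit_at0 : orbit_at 0 = z.
Proof.
have [r0 m0] := rho_om_0.
have u00 : uf z 0 = u0 Z z by rewrite -rhoZ r0 rho0E b1_Z.
have u10 : uf' z 0 = u1 Z z by rewrite -omZ m0 om0E b2_Z.
have sc : sq 0 = cs Z z.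
  apply: (@pexpIrn _ 2) => //; rewrite ?nnegrE ?ltW//.
  by apply: invr_inj; rewrite invcs_sqr// -sqE u00.
rewrite [RHS]surjective_pairing /orbit_at -/(sq 0) r0 m0 u00 u10 sc; congr pair.
  by apply: dotv_ext => zeta; rewrite dotvZl rho0E (@state_dot1 _ _ Z).
apply: dotv_ext => zeta.
by rewrite dotvBl !dotvZl rho0E om0E (@state_dot2 _ _ Z).
Qed.

Let muE : mu = K * C ^+ 2.
Proof. by rewrite /K /kappa C2 divfK// gt_eqF. Qed.

Lemma is_derive_sq t : is_derive t (1 : R) sq (- sq t ^+ 3 * uf z t * uf' z t).
Proof.
have ds := is_derive1_comp (is_derive1_sqrt (time_density_gt0 t)) (is_derive_time_density Z mu z t).
move: ds; set lhs := (X in is_derive _ _ _ X).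
suff -> : lhs = - sq t ^+ 3 * uf z t * uf' z t by [].
rewrite /lhs sqE -/(sq t) -exprVn invrK; field.
by rewrite gt_eqF.
Qed.

Lemma is_derive_orbit_cot' t : is_derive t (1 : R) (uf' z) (K - uf z t).
Proof.
have := is_derive_om Z t; rewrite ZZ mulr1 rhoZ.
by rewrite (_ : (fun s => _) = uf' z)//; apply/funext => s; rewrite omZ.
Qed.

(** Existence of an orbit through z for all times; thanks to it the [get] in [flow_sKep] is not a
    default value. *)
Lemma orbit_at_orbit (G : R -> R) :
  (forall t, is_derive t (1 : R) G (C * (1 + uf z (G t) ^+ 2))) ->
  kepler_orbit Z mu (orbit_at \o G).
Proof.
move=> dG t; split; [exact: orbit_at_TS|exact: orbit_at_w1|].
have w1t := orbit_at_w1 (G t); have Tt := orbit_at_TS (G t).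
have sn := sq0 (G t); have su : sq (G t) ^+ 2 = 1 - (sq (G t) * uf z (G t)) ^+ 2.
  by rewrite exprMn sq_u opprB addrC subrK.
have [tau t0 [st wt]] := rational_circle sn su.
have t21 : 1 + tau ^+ 2 != 0 by rewrite gt_eqF// oneDsqr_gt0.
have tn0 : tau != 0 by rewrite gt_eqF.
have ut : uf z (G t) = (1 - tau ^+ 2) / (2 * tau).
  rewrite -[LHS](mulKf (lt0r_neq0 sn)) wt st; field.
  by rewrite t21 tn0.
have sqn : sq (G t) != 0 by rewrite gt_eqF.
apply: is_derive_phase => zeta.
  rewrite XE1//=.
  have dF := is_deriveM (is_derive_sq (G t)) (is_derive_rho zeta (G t)).
  have := is_derive1_comp dF (dG t).
  rewrite (_ : _ \o G = fun s => dotv (orbit_at (G s)).1 zeta); last first.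
    by apply/funext => s; rewrite /= dotvZl.
  set lhs := (X in is_derive _ _ _ X); set rhs := (X in _ -> is_derive _ _ _ X).
  suff -> : lhs = rhs by [].
  rewrite /lhs /rhs /GRing.scale /= -/(sq (G t)) !dotvBl !dotvZl sqE.
  by field.
rewrite XE2// orbit_at_cs orbit_at_w orbit_at_ck.
have dsV := is_deriveV sqn (is_derive_sq (G t)).
have dF := is_deriveB
  (is_deriveZ C (is_deriveM dsV (is_derive_om zeta (G t))))
  (is_deriveZ C (is_deriveM (is_deriveM (is_deriveM (is_derive_sq (G t))
    (is_derive_orbit_cot Z mu z (G t))) (is_derive_orbit_cot' (G t))) (is_derive_rho zeta (G t)))).
have := is_derive1_comp dF (dG t).
rewrite (_ : _ \o G = fun s => dotv (orbit_at (G s)).2 zeta); last first.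
  apply/funext => s; rewrite /= dotvBl !dotvZl -/(sq (G s)).
  transitivity (C * ((sq (G s))^-1 * dotv (om (G s)) zeta) -
    C * (sq (G s) * uf z (G s) * uf' z (G s) * dotv (rho (G s)) zeta)) => //.
  ring.
set lhs := (X in is_derive _ _ _ X); set rhs := (X in _ -> is_derive _ _ _ X).
suff -> : lhs = rhs by [].
rewrite /lhs /rhs !fctE /= /GRing.scale /= /GRing.scale /= dotvZl -/(sq (G t)).
move: (dotv (rho _) _) (dotv (om _) _) (dotv Z _) => r o zz.
move: (sq (G t)) (uf z (G t)) (uf' z (G t)) st ut => s u u' -> ->.
rewrite muE; move: K C => k c.
field.
by rewrite t21 tn0.
Qed.

End Flow.

(** * Minimal period and time average of an orbit *)

Section Average.
Context {R : realType} {d : nat} (Z Y : 'rV[R]_d.+1) (mu k0 h : R).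
Context (ZZ : dotv Z Z = 1) (ZY : dotv Z Y = 0).

Lemma cos_eq1_pi2 (t : R) : 0 < t -> t < pi *+ 2 -> cos t != 1.
Proof.
move=> t0 t2; apply/eqP => c1.
have p0 := pi_gt0 R.
have i0 : (0 : R) \in `[0, pi] by rewrite in_itv /= lexx ltW.
have [tp|pt] := leP t pi.
  have : t = 0.
    by apply: cos_inj => //; [rewrite in_itv /= (ltW t0) tp|rewrite c1 cos0].
  by move=> E; rewrite E ltxx in t0.
have : pi *+ 2 - t = 0.
  apply: cos_inj => //.
    by rewrite in_itv /= subr_ge0 (ltW t2) /= mulr2n; move: pt; lra.
  by rewrite addrC cosD2pi cosN c1 cos0.
by move: t2; rewrite -subr_gt0 => + E; rewrite E ltxx.
Qed.

Section At.
Context (z : phase R d) (Tz : TS z) (w1 : cw Z z ^+ 2 < 1) (L0 : 0 < cL2 Z z).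
Context (g : R -> phase R d) (og : kepler_orbit Z mu g) (g0 : g 0 = z).

Let C := cL Z z.
Let K := kappa Z mu z.
Let C0 : 0 < C. Proof. exact: cL_gt0. Qed.
Local Notation time_of := (orbit_time Z mu z).

Let gL t : cL2 Z (g t) = cL2 Z z. Proof. by rewrite (orbit_L2 ZZ og) g0. Qed.

Lemma time_of_lt : {homo time_of : s t / s < t}.
Proof.
move=> s t st; have dF := time_of_primitive Z mu z.
have [|c _ E] := MVT st (fun x _ => dF x).
  exact/continuous_subspaceT/(primitive_continuous dF).
by rewrite -subr_gt0 E !mulr_gt0 ?invr_gt0 ?oneDsqr_gt0 ?subr_gt0.
Qed.

Lemma orbit_closed : g (time_of (pi *+ 2)) = z.
Proof.
have [G [G0 FG GF dG]] := ex_angle mu L0.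
have [_ wt _] := og (time_of (pi *+ 2)).
apply: (@state_unique _ _ Z) => // zeta.
  by rewrite (orbit_param ZZ w1 L0 og g0 FG zeta _).1 FG cos2pi sin2pi; ring.
by rewrite (orbit_param ZZ w1 L0 og g0 FG zeta _).2 FG cos2pi sin2pi; ring.
Qed.

(** An earlier return would make a nontrivial rotation fix the pair (b1 - kappa Z.zeta, b2). It
    would then vanish for every zeta and Q would be a multiple of Z, which w^2 < 1 excludes. Testing
    all zeta, and not only Z, covers the circular orbits, whose cotangent is constant. *)
Lemma orbit_return T : 0 < T -> g T = z -> time_of (pi *+ 2) <= T.
Proof.
move=> T0 gT; have [G [G0 FG GF dG]] := ex_angle mu L0.
rewrite leNgt; apply/negP => T2.
have GT0 : 0 < G T.
  rewrite ltNge; apply/negP; rewrite le_eqVlt => /predU1P[G00|/time_of_lt].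
    by rewrite -(GF T) G00 time_of0 ltxx in T0.
  by rewrite GF time_of0 => /(lt_trans T0); rewrite ltxx.
have GT2 : G T < pi *+ 2.
  rewrite ltNge; apply/negP; rewrite le_eqVlt => /predU1P[G00|/time_of_lt].
    by rewrite -(GF T) -G00 ltxx in T2.
  by rewrite GF => /(lt_trans T2); rewrite ltxx.
have c1 := cos_eq1_pi2 GT0 GT2.
have B1 zeta := (orbit_param ZZ w1 L0 og g0 FG zeta T).1.
have B2 zeta := (orbit_param ZZ w1 L0 og g0 FG zeta T).2.
rewrite gT in B1 B2.
have cs2 := cos2Dsin2 (G T).
have b1Z zeta : b1 Z zeta z = K * dotv Z zeta.
  apply/eqP; rewrite -subr_eq0; set a := _ - _.
  have E1 : a * (1 - cos (G T)) = b2 Z zeta z * sin (G T).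
    by have := B1 zeta; rewrite -/K /a; lra.
  have E2 : b2 Z zeta z * (1 - cos (G T)) = - a * sin (G T).
    by have := B2 zeta; rewrite -/K -/a; lra.
  (* The factor of a is the determinant of the identity minus the rotation. *)
  have : a * ((1 - cos (G T)) ^+ 2 + sin (G T) ^+ 2) = 0.
    transitivity (a * (1 - cos (G T)) * (1 - cos (G T))
      - (- a * sin (G T)) * sin (G T)); first ring.
    by rewrite E1 -E2; ring.
  move/eqP; rewrite mulf_eq0 => /orP[//|/eqP E3].
  have : cos (G T) = 1 by move: E3 cs2; rewrite !expr2; nra.
  by move/eqP; rewrite (negPf c1).
have s0 := cs_gt0 w1.
have QE : z.1 = (cs Z z * K) *: Z.
  by apply: dotv_ext => zeta; rewrite dotvZl (@state_dot1 _ _ Z)// b1Z mulrA.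
have [QQ _] := Tz.
have w2 : cw Z z = cs Z z * K by rewrite /cw QE dotvZl ZZ mulr1.
have E1 : (cs Z z * K) ^+ 2 = 1 by rewrite -[RHS]QQ QE !(dotvZl, dotvZr) ZZ; ring.
by move: w1; rewrite w2 E1 ltxx.
Qed.

Lemma orbit_period : inf [set T | 0 < T /\ g T = z] = time_of (pi *+ 2).
Proof.
have T0 : 0 < time_of (pi *+ 2) by have := time_of_lt (@pi2_gt0 R); rewrite time_of0.
apply/eqP; rewrite eq_le; apply/andP; split.
  apply: ge_inf; last by split=> //; exact: orbit_closed.
  by exists 0 => T [/ltW].
apply: lb_le_inf; first by exists (time_of (pi *+ 2)); split=> //; exact: orbit_closed.
by move=> T [T1 gT]; exact: orbit_return.
Qed.

Local Notation uf := (orbit_cot Z mu).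
Local Notation Pf := (center_lin Z Y mu k0 h).
Local Notation Sf := (center_gap Z Y mu k0 h).
Local Notation fN := (cot_density Z Y mu k0 h).

Lemma orbit_dot_center (G : R -> R) t : cancel time_of G ->
  dotv (g t).1 (k0 *: Z + h *: Y) = cs Z (g t) * Pf z (G t) /\
  1 - dotv (g t).1 (k0 *: Z + h *: Y) ^+ 2 = cs Z (g t) ^+ 2 * Sf z (G t).
Proof.
move=> FG; have [_ wt _] := og t.
have E : dotv (g t).1 (k0 *: Z + h *: Y) = cs Z (g t) * Pf z (G t).
  rewrite dotvDr !dotvZr !(@state_dot1 _ _ Z)//.
  rewrite !(orbit_param ZZ w1 L0 og g0 FG _ _).1 ZY ZZ b1_Z b2_Z//.
  by rewrite /center_lin /orbit_cot /orbit_tilt; ring.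
have uE : u0 Z (g t) = uf z (G t).
  by rewrite -b1_Z (orbit_param ZZ w1 L0 og g0 FG _ _).1 -orbit_cotE.
split=> //; rewrite E /center_gap -uE -invcs_sqr//; field.
by rewrite gt_eqF// cs_gt0.
Qed.

(** The gap times sin^2 theta is the squared sine of the angle to the other center, and each polar
    angle s is reached, at the time [time_of s]. *)
Lemma center_gap_gt0 : (forall t, dotv (g t).1 (k0 *: Z + h *: Y) ^+ 2 < 1) ->
  forall s, 0 < Sf z s.
Proof.
move=> w2 s; have [G [G0 FG GF dG]] := ex_angle mu L0.
have [_ wt _] := og (time_of s).
have [_] := orbit_dot_center (time_of s) FG; rewrite FG => E.
have := w2 (time_of s); rewrite -subr_gt0 E pmulr_rgt0// exprn_gt0// cs_gt0//.
Qed.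

Lemma orbit_average (c : R) : (forall s, 0 < Sf z s) ->
  (time_of (pi *+ 2))^-1 *
  \int[lebesgue_measure]_(t in `[0, time_of (pi *+ 2)])
    (c * (dotv (g t).1 (k0 *: Z + h *: Y)
      / Num.sqrt (1 - dotv (g t).1 (k0 *: Z + h *: Y) ^+ 2)))
  = c * avg_red Z Y mu k0 h z.
Proof.
move=> S0; have [G [G0 FG GF dG]] := ex_angle mu L0.
have T0 : 0 < time_of (pi *+ 2) by have := time_of_lt (@pi2_gt0 R); rewrite time_of0.
have cN := continuous_cot_density S0; have [N0 dN] := primP cN.
have -> : (fun t => c * (dotv (g t).1 (k0 *: Z + h *: Y)
      / Num.sqrt (1 - dotv (g t).1 (k0 *: Z + h *: Y) ^+ 2))) =
   fun t => c / C * (fN z (G t) * (C * (1 + uf z (G t) ^+ 2))).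
  apply/funext => t; have [-> ->] := orbit_dot_center t FG.
  have [_ wt _] := og t; have s0 := cs_gt0 wt.
  rewrite sqrtrM ?sqr_ge0// sqrtr_sqr ger0_norm ?(ltW s0)//.
  rewrite /cot_density /time_density.
  have q0 : Num.sqrt (Sf z (G t)) != 0 by rewrite gt_eqF// sqrtr_gt0.
  have u10 : 1 + uf z (G t) ^+ 2 != 0 by rewrite gt_eqF// oneDsqr_gt0.
  by field; rewrite q0 u10 !gt_eqF.
have cG : continuous G := primitive_continuous dG.
(* The change of variable from time to polar angle is made on primitives. *)
rewrite (@Rintegral_primitive _ _ (fun t => c / C * prim (fN z) (G t)))//.
- rewrite FG G0 N0 mulr0 subr0 -/(circle_int _) /avg_red /orbit_time.
  rewrite -/(circle_int _) -/C; field.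
  rewrite !gt_eqF// circle_int_gt0//; first exact: continuous_time_density.
  by move=> t; rewrite invr_gt0 oneDsqr_gt0.
- move=> t; apply: cvgM; first exact: cvg_cst.
  apply: cvgM.
    by apply: (@continuous_comp _ _ _ G (fN z)); [exact: cG|exact: cN].
  apply: cvgM; first exact: cvg_cst.
  have cu : continuous (fun s => uf z (G s)).
    move=> s; apply: (@continuous_comp _ _ _ G (uf z)); first exact: cG.
    exact: continuous_orbit_cot.
  by apply: cvgD; [exact: cvg_cst|apply: cvgM; exact: cu].
- move=> t; apply: is_deriveZ.
  by have := is_derive1_comp (dN (G t)) (dG t).
Qed.

End At.
End Average.

(** * Positive angular momentum of non-singular orbits *)

Section NoCollision.
Context {R : realType}.

Lemma unbounded_convex (f p q : R -> R) (c : R) : 0 < c ->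
  primitive p f -> primitive q p -> (forall t, c <= q t) ->
  forall M, exists t, M < f t.
Proof.
move=> c0 df dp qc M.
have p_ge t : 0 <= t -> c * t <= p t - p 0.
  move=> t0; have [|x _ ->] := MVT_segment t0 (fun s _ => dp s).
    exact/continuous_subspaceT/(primitive_continuous dp).
  by rewrite subr0 ler_wpM2r.
have f_ge t : 0 <= t -> f 0 + p 0 * t + c / 2 * t ^+ 2 <= f t.
  move=> t0.
  have dF s : is_derive s (1 : R) (fun s => f s - p 0 * s - c / 2 * s ^+ 2)
      (p s - p 0 * 1 - c / 2 * (2 * s * 1)).
    exact: (is_deriveB (is_deriveB (df s) (is_deriveZ (p 0) (is_derive_id s 1)))
      (is_deriveZ (c / 2) (is_derive_sqr (is_derive_id s 1)))).
  have [|x x0t E] := MVT_segment t0 (fun s _ => dF s).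
    exact/continuous_subspaceT/(primitive_continuous dF).
  have x0 : 0 <= x by rewrite (itvP x0t).
  have : 0 <= (p x - p 0 * 1 - c / 2 * (2 * x * 1)) * (t - 0).
    rewrite subr0 mulr_ge0//; have := p_ge x x0; lra.
  rewrite -E; lra.
(* Chosen so that c t / 2 = c / 2 + |f 0| + |p 0| + |M|; as t >= 1, the quadratic term then
   outweighs the others. *)
pose t := 1 + 2 * (`|f 0| + `|p 0| + `|M|) / c.
have t1 : 1 <= t by rewrite lerDl divr_ge0 ?(ltW c0)// mulr_ge0// !addr_ge0.
exists t; apply: lt_le_trans (f_ge t _); last by rewrite (le_trans _ t1).
have ct : c / 2 * t = c / 2 + (`|f 0| + `|p 0| + `|M|).
  by rewrite /t; field; rewrite gt_eqF.
have h1 := ler_norm (- f 0); have h2 := ler_norm (- p 0); have h3 := ler_norm M.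
rewrite !normrN in h1 h2.
have t0 : 0 <= t by rewrite (le_trans _ t1).
have -> : c / 2 * t ^+ 2 = (c / 2 + (`|f 0| + `|p 0| + `|M|)) * t.
  by rewrite -ct; ring.
have n1 := normr_ge0 (f 0); have n2 := normr_ge0 (p 0); have n3 := normr_ge0 M.
have : 0 <= (`|p 0| + p 0) * t by rewrite mulr_ge0//; lra.
have : 0 <= (`|f 0| + `|M|) * (t - 1) by rewrite mulr_ge0//; lra.
have : 0 < c / 2 * t by rewrite ct; lra.
lra.
Qed.

Context {d : nat} (Z : 'rV[R]_d.+1) (mu : R).
Context (ZZ : dotv Z Z = 1) (mu0 : mu != 0).

Lemma cL2_ge0 (x : phase R d) : TS x -> cw Z x ^+ 2 < 1 -> 0 <= cL2 Z x.
Proof.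
move=> [QQ QP] w1; have s0 := cs_gt0 w1; have s2 := cs_sqr w1.
(* This is sin^2 theta times the velocity of the normalized projection of Q to the orthogonal of
   Z. *)
pose b := cs Z x *: x.2 + (cw Z x * cv Z x / cs Z x) *: x.1 - (cv Z x / cs Z x) *: Z.
suff <- : dotv b b = cL2 Z x by exact: dotv_ge0.
rewrite /b !(dotvDl, dotvDr, dotvNl, dotvNr, dotvZl, dotvZr) ZZ QQ.
rewrite !(dotvC Z) (dotvC x.2 x.1) QP -/(cw Z x) -/(cv Z x) -/(ck x) /cL2 -s2.
transitivity (ck x * cs Z x ^+ 2 + cv Z x ^+ 2 / cs Z x ^+ 2
   * (1 - cw Z x ^+ 2 - 2 * cs Z x ^+ 2)).
  by field; rewrite gt_eqF.
by rewrite -s2; field; rewrite gt_eqF.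
Qed.

(* If the angular momentum vanishes, the second derivative of the central angle is
   - mu / sin^2 theta: the angle is unbounded on R. *)
Lemma orbit_L2_gt0 (g : R -> phase R d) : kepler_orbit Z mu g -> 0 < cL2 Z (g 0).
Proof.
move=> og; have gT t : TS (g t) by have [] := og t.
have gw t : cw Z (g t) ^+ 2 < 1 by have [] := og t.
have gd t : is_derive t (1 : R) g (XE Z mu (g t)) by have [] := og t.
rewrite lt_neqAle cL2_ge0// andbT; apply/eqP => L0.
have kE t : ck (g t) * cs Z (g t) ^+ 2 = cv Z (g t) ^+ 2.
  apply/eqP; rewrite cs_sqr// -subr_eq0 -/(cL2 Z (g t)).
  by rewrite (orbit_L2 ZZ og) -L0.
have w11 t : -1 < cw Z (g t) < 1.
  by rewrite -ltr_norml -sqrtr_sqr -sqrtr1 ltr_sqrt// gw.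
pose th t := acos (cw Z (g t)).
pose p t := - (cv Z (g t) / cs Z (g t)).
have dth t : is_derive t (1 : R) th (p t).
  have dw := diffTS_along gT (diffTS_dot1 setT Z (gT t)) (XE_TTS Z mu (gT t)) (gd t).
  have := is_derive1_comp (is_derive1_acos (w11 t)) dw.
  by rewrite XE1// -/(cs Z (g t)) -/(cv Z (g t)) mulNr mulrC.
have dp t : is_derive t (1 : R) p (- (mu / cs Z (g t) ^+ 2)).
  have dvs := diffTS_mul (gT t) (diffTS_dot2 [set: unit] Z (gT t)) (diffTS_csV [set: unit] (gT t) (gw t)).
  have := is_deriveN (diffTS_along gT dvs (XE_TTS Z mu (gT t)) (gd t)).
  have s0 := cs_gt0 (gw t).
  set lhs := (X in is_derive _ _ _ X); suff -> : lhs = - (mu / cs Z (g t) ^+ 2) by [].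
  rewrite /lhs XE1// XE2// ZZ -!/(cw Z _) -!/(cv Z _).
  transitivity (- (mu * (1 - cw Z (g t) ^+ 2) / cs Z (g t) ^+ 4)
     + cw Z (g t) * (ck (g t) * cs Z (g t) ^+ 2 - cv Z (g t) ^+ 2) / cs Z (g t) ^+ 3).
    by field; rewrite gt_eqF.
  by rewrite kE -cs_sqr// subrr; field; rewrite gt_eqF.
have s_le1 t : 1 <= (cs Z (g t) ^+ 2)^-1.
  by rewrite invcs_sqr// lerDl sqr_ge0.
have w_le1 t : -1 <= cw Z (g t) <= 1 by have /andP[? ?] := w11 t; rewrite !ltW.
(* Since sin theta <= 1, the second derivative has size at least |mu|: the angle would exceed pi for
   mu < 0 and become negative for mu > 0. *)
have [mu_lt0|mu_gt0|mu_eq0] := ltgtP mu 0; last by have := mu0; rewrite mu_eq0 eqxx.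
- have [||t] := @unbounded_convex th p _ (- mu) _ dth dp _ pi.
  + by rewrite oppr_gt0.
  + by move=> t; rewrite -mulNr -[leLHS]mulr1 ler_pM2l ?oppr_gt0.
  + by rewrite ltNge acos_lepi.
- have dth' t : is_derive t (1 : R) (fun t => - th t) (- p t) by exact: is_deriveN.
  have dp' t : is_derive t (1 : R) (fun t => - p t) (mu / cs Z (g t) ^+ 2).
    by rewrite -[_ / _]opprK; exact: is_deriveN.
  have [|t] := @unbounded_convex _ _ _ mu mu_gt0 dth' dp' _ 0.
  + by move=> t; rewrite -[leLHS]mulr1 ler_pM2l.
  + by rewrite oppr_gt0 ltNge acos_ge0.
Qed.

End NoCollision.

(** * The two-center problem *)

Section Link.
Context {R : realType} {d : nat} (d2 : (2 <= d)%N) (a : R).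
Implicit Types x z : phase R d.

Local Notation gam := (Num.sqrt (1 + a ^+ 2)).
Local Notation Z := (Z1 d a).

(** Completes [Z1] to an orthonormal basis of the plane of the last two coordinates, which also
    contains [Z2]. *)
Definition Zperp : 'rV[R]_d.+1 := gam^-1 *:
  \row_(i < d.+1) (if i == d.-1 :> nat then 1 else if i == d :> nat then a else 0).

Local Notation Y := Zperp.

Let g0 : 0 < gam. Proof. by rewrite sqrtr_gt0 oneDsqr_gt0. Qed.
Let gE : gam ^+ 2 = 1 + a ^+ 2.
Proof. by rewrite sqr_sqrtr// ltW// oneDsqr_gt0. Qed.

Lemma dotv_co (u v : 'rV[R]_d.+1) : dotv u v =
  \sum_(1 <= i < d) co u i * co v i + co u d * co v d + co u d.+1 * co v d.+1.
Proof.
case: d d2 u v => [//|n _] u v.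
rewrite big_add1 /= big_mkord /dotv !big_ord_recr /= /co /=.
have inj (i : 'I_n.+2) : inord i = i by rewrite inord_val.
congr (_ + _ + _).
- apply: eq_bigr => i _.
  by rewrite -(inj (widen_ord _ (widen_ord _ i))).
- by rewrite -(inj (widen_ord _ ord_max)).
- by rewrite -(inj ord_max).
Qed.

Lemma dotv_last2 (x : 'rV[R]_d.+1) (al be : R) :
  dotv x (\row_(i < d.+1) (if i == d.-1 :> nat then al
    else if i == d :> nat then be else 0)) = co x d * al + co x d.+1 * be.
Proof.
rewrite dotv_co big_nat_cond big1 => [|i /andP[/andP[i1 id] _]].
  rewrite add0r /co /= !mxE !inordK//=; last by rewrite ltnS leq_pred.
  by rewrite !eqxx gtn_eqF// ltn_predL ltnW.
have ip : (i.-1 < d.-1)%N by rewrite -ltnS !prednK// (ltn_trans _ id).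
rewrite /co !mxE inordK; last by rewrite ltnS (leq_trans (leq_pred _))// ltnW.
by rewrite !ltn_eqF ?mulr0//; rewrite (leq_trans ip) ?leq_pred.
Qed.

Lemma dot_Z (x : 'rV[R]_d.+1) : dotv x Z = (a * co x d - co x d.+1) / gam.
Proof. by rewrite /Z1 dotvZr dotv_last2; ring. Qed.

Lemma dot_Y (x : 'rV[R]_d.+1) : dotv x Y = (co x d + a * co x d.+1) / gam.
Proof. by rewrite /Zperp dotvZr dotv_last2; ring. Qed.

Lemma dot_Z2 (x : 'rV[R]_d.+1) : dotv x (Z2 d a) = (- a * co x d - co x d.+1) / gam.
Proof. by rewrite /Z2 dotvZr dotv_last2; ring. Qed.

Let gn : gam != 0. Proof. by rewrite gt_eqF. Qed.

Lemma co_Z2 : (co Z d = a / gam) * (co Z d.+1 = - gam^-1).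
Proof.
rewrite /co /Z1 /= !mxE !inordK ?ltnS ?leq_pred//= !eqxx.
by rewrite gtn_eqF ?ltn_predL ?(ltnW d2)//; split; ring.
Qed.

Lemma co_Y2 : (co Y d = gam^-1) * (co Y d.+1 = a / gam).
Proof.
rewrite /co /Zperp /= !mxE !inordK ?ltnS ?leq_pred//= !eqxx.
by rewrite gtn_eqF ?ltn_predL ?(ltnW d2)//; split; ring.
Qed.

Lemma dot_ZZ : dotv Z Z = 1.
Proof.
rewrite dot_Z !co_Z2; transitivity ((1 + a ^+ 2) / gam ^+ 2); first by field.
by rewrite gE divff// gt_eqF// oneDsqr_gt0.
Qed.

Lemma dot_YY : dotv Y Y = 1.
Proof.
rewrite dot_Y !co_Y2; transitivity ((1 + a ^+ 2) / gam ^+ 2); first by field.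
by rewrite gE divff// gt_eqF// oneDsqr_gt0.
Qed.

Lemma dot_ZY : dotv Z Y = 0.
Proof. by rewrite dot_Y !co_Z2; field. Qed.

(** For a = tan alpha the two centers lie at angle alpha on either side of the south pole;
    [center_cos] and [center_sin] are cos(2 alpha) and - sin(2 alpha). *)
Definition center_cos : R := (1 - a ^+ 2) / (1 + a ^+ 2).
Definition center_sin : R := - (2 * a) / (1 + a ^+ 2).

Let a21 : 1 + a ^+ 2 != 0. Proof. by rewrite gt_eqF// oneDsqr_gt0. Qed.

Lemma Z2E : Z2 d a = center_cos *: Z + center_sin *: Y.
Proof.
apply: dotv_ext => x; rewrite dotvC dot_Z2 dotvC dotvDr 2!dotvZr dot_Z dot_Y.
by rewrite /center_cos /center_sin; field; rewrite gn a21.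
Qed.

Lemma center_cos_sin : center_cos ^+ 2 + center_sin ^+ 2 = 1.
Proof. by rewrite /center_cos /center_sin; field. Qed.

Context (m1 : R).
Let mu := m1 * gam.

(** By Lagrange's identity the first d - 1 coordinates enter only through the three entries of their
    Gram matrix, and these follow from |Q| = 1, Q.Q' = 0, |Q'|^2 and the components along Z and
    Y. *)
Lemma D_funE z : TS z -> D_fun a m1 z = Dred Z Y mu center_cos center_sin z.
Proof.
move=> [QQ QP].
have cwE : cw Z z = (a * co z.1 d - co z.1 d.+1) / gam := dot_Z z.1.
have cvE : cv Z z = (a * co z.2 d - co z.2 d.+1) / gam := dot_Z z.2.
have cyE : cy Y z = (co z.1 d + a * co z.1 d.+1) / gam := dot_Y z.1.
have cpE : cp Y z = (co z.2 d + a * co z.2 d.+1) / gam := dot_Y z.2.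
rewrite dotv_co in QQ; rewrite dotv_co in QP.
have ckE : ck z = _ := dotv_co z.2 z.2.
rewrite /D_fun /=.
under eq_bigr do under eq_bigr do rewrite /Lang.
rewrite -lagrange_nat.
set Sqq := \sum_(1 <= i < d) co z.1 i ^+ 2.
set Spp := \sum_(1 <= i < d) co z.2 i ^+ 2.
set Sqp := \sum_(1 <= i < d) co z.1 i * co z.2 i.
have E2 : \sum_(1 <= i < d) (Lang z i d + a * Lang z i d.+1) ^+ 2 =
    gam ^+ 2 * (cp Y z ^+ 2 * Sqq - 2 * cp Y z * cy Y z * Sqp + cy Y z ^+ 2 * Spp).
  rewrite cpE cyE /Sqq /Sqp /Spp !mulr_sumr -sumrB -big_split /= mulr_sumr.
  by apply: eq_bigr => i _; rewrite /Lang; field.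
have E3 : \sum_(1 <= i < d) (Lang z i d + a * Lang z i d.+1) * Lang z i d.+1 =
    gam * (cp Y z * co z.2 d.+1 * Sqq - (cp Y z * co z.1 d.+1 + cy Y z * co z.2 d.+1)
       * Sqp + cy Y z * co z.1 d.+1 * Spp).
  rewrite cpE cyE /Sqq /Sqp /Spp !mulr_sumr -sumrB -big_split /= mulr_sumr.
  by apply: eq_bigr => i _; rewrite /Lang; field.
rewrite E2 E3.
have Q1 : co z.1 d = (a * cw Z z + cy Y z) / gam.
  by rewrite cwE cyE; transitivity (co z.1 d * (1 + a ^+ 2) / gam ^+ 2);
    [rewrite gE mulfK|field].
have Q2 : co z.1 d.+1 = (- cw Z z + a * cy Y z) / gam.
  by rewrite cwE cyE; transitivity (co z.1 d.+1 * (1 + a ^+ 2) / gam ^+ 2);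
    [rewrite gE mulfK|field].
have P1 : co z.2 d = (a * cv Z z + cp Y z) / gam.
  by rewrite cvE cpE; transitivity (co z.2 d * (1 + a ^+ 2) / gam ^+ 2);
    [rewrite gE mulfK|field].
have P2 : co z.2 d.+1 = (- cv Z z + a * cp Y z) / gam.
  by rewrite cvE cpE; transitivity (co z.2 d.+1 * (1 + a ^+ 2) / gam ^+ 2);
    [rewrite gE mulfK|field].
have g2 (p q r s : R) : (a * p + q) / gam * ((a * r + s) / gam)
    + (- p + a * q) / gam * ((- r + a * s) / gam) = p * r + q * s.
  transitivity ((1 + a ^+ 2) / gam ^+ 2 * (p * r + q * s)); first by field.
  by rewrite gE divff// mul1r.
have SqqE : Sqq = 1 - cw Z z ^+ 2 - cy Y z ^+ 2.
  have : Sqq + (cw Z z * cw Z z + cy Y z * cy Y z) = 1.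
    by rewrite -g2 -Q1 -Q2 addrA -[RHS]QQ; congr (_ + _ + _); exact: eq_bigr.
  by rewrite !expr2; lra.
have SqpE : Sqp = - cw Z z * cv Z z - cy Y z * cp Y z.
  have : Sqp + (cw Z z * cv Z z + cy Y z * cp Y z) = 0.
    by rewrite -g2 -Q1 -Q2 -P1 -P2 addrA -[RHS]QP.
  lra.
have SppE : Spp = ck z - cv Z z ^+ 2 - cp Y z ^+ 2.
  have : Spp + (cv Z z * cv Z z + cp Y z * cp Y z) = ck z.
    by rewrite -g2 -P1 -P2 addrA ckE; congr (_ + _ + _); exact: eq_bigr.
  by rewrite !expr2; lra.
have -> : co z.1 d + a * co z.1 d.+1 = gam * cy Y z by rewrite cyE; field.
have -> : Num.sqrt ((1 + a ^+ 2) * Sqq + (gam * cy Y z) ^+ 2) = gam * cs Z z.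
  rewrite -[RHS]ger0_norm ?mulr_ge0 ?sqrtr_ge0// -sqrtr_sqr; congr Num.sqrt.
  rewrite exprMn gE SqqE exprMn gE /cs sqr_sqrtr; first ring.
  rewrite subr_ge0 /cw; apply: dotv_unit_le1; last exact: dot_ZZ.
  by rewrite dotv_co.
have -> : 2 * a * m1 / gam * (gam * cy Y z / (gam * cs Z z)) =
    - center_sin * (mu * (cy Y z / cs Z z)).
  rewrite /center_sin /mu [(gam * cs Z z)^-1]invfM.
  move: (cy Y z) ((cs Z z)^-1) gE gn => y s'; move: (gam) => g <- gn'.
  by field.
rewrite SqqE SqpE SppE Q2 P2 /Dred /cL2 /center_cos gE.
move: (cw Z z) (cv Z z) (cy Y z) (cp Y z) (ck z) (mu * _) => w v y p k my.
by rewrite /center_sin; field; rewrite gn a21.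
Qed.

Lemma E_sKepE z : TS z -> E_sKep a m1 z = Ered Z mu z.
Proof.
move=> [QQ _]; have w1 : -1 <= dotv z.1 Z <= 1.
  rewrite -ler_norml -sqrtr_sqr -sqrtr1 ler_wsqrtr//.
  by apply: dotv_unit_le1; last exact: dot_ZZ.
by rewrite /E_sKep /central_angle /cot acosK ?in_itv//= sin_acos.
Qed.

Lemma cot_acosE (w : R) : w ^+ 2 <= 1 -> cot (acos w) = w / Num.sqrt (1 - w ^+ 2).
Proof.
move=> w2; have w1 : -1 <= w <= 1 by rewrite -ler_norml -sqrtr_sqr -sqrtr1 ler_wsqrtr.
by rewrite /cot acosK ?in_itv//= sin_acos.
Qed.

Lemma hamiltonian_E_sKep z : TS z -> cw Z z ^+ 2 < 1 ->
  hamiltonian_field (E_sKep a m1) z = XE Z mu z.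
Proof.
move=> Tz w1; apply: hamiltonian_fieldE => //.
have dE : diffTS setT (fun x (_ : unit) => E_sKep a m1 x) z
    (fun g _ => dotv (EU Z mu z) g.1 + dotv z.2 g.2).
  apply: diffTS_near (diffTS_Ered mu [set: unit] Tz w1) _ => //.
  (* The two functions agree on all of T S^d, so any radius does. *)
  by exists 1 => // g _ Tg i _; rewrite E_sKepE.
by have [] := diffTS_dTS Tz dE.
Qed.

Lemma D_fun_diff z : TS z -> cw Z z ^+ 2 < 1 ->
  differentiableTS (D_fun a m1) z /\
  hamiltonian_field (D_fun a m1) z = ham_vec z (DU Z Y mu center_cos center_sin z)
    (DW Z Y center_cos center_sin z).
Proof.
move=> Tz w1.
have dD : diffTS setT (fun x (_ : unit) => D_fun a m1 x) z
    (fun g _ => dotv (DU Z Y mu center_cos center_sin z) g.1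
      + dotv (DW Z Y center_cos center_sin z) g.2).
  apply: diffTS_near (diffTS_Dred Y mu center_cos center_sin [set: unit] Tz w1) _ => //.
  by exists 1 => // g _ Tg i _; rewrite D_funE.
have [dF dE] := diffTS_dTS Tz dD; split=> //.
exact: hamiltonian_fieldE.
Qed.

Lemma nonsingular_orbitP z (g : R -> phase R d) :
  nonsingular_orbit a m1 z g <-> g 0 = z /\ kepler_orbit Z mu g.
Proof.
split=> [[g0z H]|[g0z og]]; split=> // t.
  have [Tt gZ gNZ dg] := H t; have [QQ _] := Tt.
  have w1 : cw Z (g t) ^+ 2 < 1 by apply: dotv_unit_lt1 => //; exact: dot_ZZ.
  by split=> //; rewrite -hamiltonian_E_sKep.
have [Tt w1 dg] := og t; split=> //; last by rewrite hamiltonian_E_sKep.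
  by move=> E; move: w1; rewrite /cw E dot_ZZ expr1n ltxx.
by move=> E; move: w1; rewrite /cw E dotvNl dot_ZZ sqrrN expr1n ltxx.
Qed.

(** Besides [TS z] the hypotheses are open conditions and mention no given orbit: the explicit orbit
    inhabits the set under [get] and [orbit_unique] identifies the chosen one. So the formula also
    holds at the neighbours of a point of the region. *)
Lemma avg_V_sph2E (m2 : R) z : TS z -> cw Z z ^+ 2 < 1 -> 0 < cL2 Z z ->
  (forall t, 0 < center_gap Z Y mu center_cos center_sin z t) ->
  avg_V_sph2 a m1 m2 z = - m2 * gam * avg_red Z Y mu center_cos center_sin z.
Proof.
move=> Tz w1 L0 S0; have [G [G0 FG GF dG]] := ex_angle mu L0.
pose g := orbit_at Z mu z \o G.
have og : kepler_orbit Z mu g by apply: orbit_at_orbit => //; exact: dot_ZZ.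
have g0z : g 0 = z by rewrite /g /= G0 orbit_at0//; exact: dot_ZZ.
have flowE t : flow_sKep a m1 t z = g t.
  have ng : nonsingular_orbit a m1 z g by apply/nonsingular_orbitP.
  have [f0 of_] : get [set f | nonsingular_orbit a m1 z f] 0 = z /\
      kepler_orbit Z mu (get [set f | nonsingular_orbit a m1 z f]).
    by apply/nonsingular_orbitP; exact: (getPex (ex_intro _ g ng)).
  by rewrite /flow_sKep (orbit_unique dot_ZZ w1 L0 FG of_ og f0 g0z).
have perE : period_sKep a m1 z = orbit_time Z mu z (pi *+ 2).
  rewrite -(orbit_period dot_ZZ Tz w1 L0 og g0z) /period_sKep.
  by congr inf; apply/seteqP; split=> T /=; rewrite flowE.
rewrite -(orbit_average dot_ZZ dot_ZY w1 L0 og g0z (- m2 * gam) S0).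
rewrite /avg_V_sph2 perE; congr (_ * _); apply: eq_Rintegral => t _.
rewrite flowE /V_sph2 /central_angle -Z2E cot_acosE//.
have [[QQ _] _ _] := og t; apply: dotv_unit_le1 => //.
rewrite Z2E !(dotvDl, dotvDr) 4!dotvZl 4!dotvZr dot_ZZ dot_YY (dotvC Y) dot_ZY.
by rewrite -[RHS]center_cos_sin; ring.
Qed.

End Link.

Theorem proposition2p3 (R : realType) (d : nat) (a m1 m2 : R)
    (d_ge2 : (2 <= d)%N) (a_gt0 : 0 < a) (m1_neq0 : m1 != 0)
    (z : phase R d) (hz : region_sph a m1 z) :
  [/\ differentiableTS (E_sph_avg a m1 m2) z,
      differentiableTS (D_fun a m1) z &
      poisson (E_sph_avg a m1 m2) (D_fun a m1) z = 0].
Proof.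
pose Z := Z1 d a; pose Y := @Zperp R d a; pose mu := m1 * Num.sqrt (1 + a ^+ 2).
pose k0 := center_cos a; pose h := center_sin a.
have ZZ : dotv Z Z = 1 := dot_ZZ d_ge2 a.
have YY : dotv Y Y = 1 := dot_YY d_ge2 a.
have ZY : dotv Z Y = 0 := dot_ZY d_ge2 a.
have kh : k0 ^+ 2 + h ^+ 2 = 1 := center_cos_sin a.
have h0 : h < 0 by rewrite /h /center_sin mulNr oppr_lt0 divr_gt0 ?mulr_gt0// oneDsqr_gt0.
have mu0 : mu != 0 by rewrite mulf_neq0// gt_eqF// sqrtr_gt0 oneDsqr_gt0.
have [g /nonsingular_orbitP[//|g0 og] gZ2] := hz.
have [Tz w1 _] := og 0; rewrite g0 in Tz w1.
have L0 := orbit_L2_gt0 ZZ mu0 og; rewrite g0 in L0.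
have Z2Z2 : dotv (Z2 d a) (Z2 d a) = 1.
  rewrite (Z2E d_ge2) !(dotvDl, dotvDr) 4!dotvZl 4!dotvZr -/Z -/Y ZZ YY (dotvC Y) ZY.
  by rewrite -[RHS]kh /k0 /h; ring.
have S0 : forall t, 0 < center_gap Z Y mu k0 h z t.
  apply: (center_gap_gt0 ZZ ZY w1 L0 og g0) => t; rewrite /k0 /h /Z /Y -Z2E//.
  have [[QQ _] _ _] := og t; have [n1 n2] := gZ2 t.
  exact: dotv_unit_lt1.
have [dD XD] := D_fun_diff d_ge2 m1 Tz w1.
have [Av dAv Av0] := diffTS_avg_red Tz w1 L0 S0 ZZ YY ZY h0 kh.
have dE : diffTS setT (fun x (_ : unit) => E_sph_avg a m1 m2 x) z
    (fun g _ => dotv (EU Z mu z) g.1 + dotv z.2 g.2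
      + (- m2 * Num.sqrt (1 + a ^+ 2)) * Av g).
  apply: diffTS_near (diffTS_add (diffTS_Ered mu [set: unit] Tz w1)
    (diffTS_scale (- m2 * Num.sqrt (1 + a ^+ 2)) dAv)) _ => //.
  (* The closed form of the average needs a positive gap, a positive [cL2] and cw^2 < 1; each of
     these persists on a ball around z. *)
  have [r1 r10 H1] := near_center_gap Tz w1 L0 S0 ZZ YY ZY.
  have [r2 r20 H2] := diffTS_pos Tz (diffTS_cL2 Z [set: unit] Tz) L0 (fun _ _ => lexx _).
  have dw := diffTS_sub (diffTS_const [set: unit] 1 z)
    (diffTS_mul Tz (diffTS_dot1 [set: unit] Z Tz) (diffTS_dot1 [set: unit] Z Tz)).
  have w10 : 0 < 1 - cw Z z ^+ 2 by rewrite subr_gt0.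
  have [|r3 r30 H3] := diffTS_pos Tz dw w10; first by move=> i _; rewrite expr2.
  exists (Num.min r1 (Num.min r2 r3)); first by rewrite !lt_min r10 r20.
  move=> e; rewrite !lt_min => /and3P[e1 e2 e3] Te i _.
  rewrite /E_sph_avg (E_sKepE d_ge2)// (avg_V_sph2E d_ge2)//.
  - by have := H3 e e3 tt I; rewrite subr_gt0 -expr2.
  - exact: (H2 e e2 tt I).
  - exact: H1.
have [dF dFE] := diffTS_dTS Tz dE.
split=> //; rewrite /poisson XD dFE; last exact: ham_vec_TTS.
(* The bracket is the derivative along the field of D: [E0] disposes of the Kepler energy and [Av0]
   of the average. *)
have [E0 _] := XD_brackets mu k0 h ZZ YY ZY Tz w1 L0.
by rewrite -/Z -/Y -/mu -/k0 -/h Av0 mulr0 addr0 {1}/EU dotvZl (dotvC Z).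
Qed.
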